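(* Let $H\ge 0$ and let $1\le k<d$ be integers. Let $h$ be a $d$-dimensional fractional Gaussian field with Hurst parameter $H$, i.e. $h\sim \mathrm{FGF}_s(\mathbb R^d)$ with $s=H+\frac d2$, and let $V\subset\mathbb R^d$ be a fixed $k$-dimensional linear subspace. Then the restriction of $h$ to $V\cong\mathbb R^k$ is, up to a multiplicative constant, a $k$-dimensional fractional Gaussian field with Hurst parameter $H$; that is, there is a constant $C>0$ such that $h|_V$ has the law of $C\,\bar h$, where $\bar h\sim\mathrm{FGF}_{H+k/2}(\mathbb R^k)$.
   Context: Conventions. $\mathcal S(\mathbb R^d)$ is the real Schwartz space. The Fourier transform is $\widehat\phi(\xi)=(2\pi)^{-d/2}\int_{\mathbb R^d}\phi(x)e^{-i\xi\cdot x}dx$. For $r\in\mathbb R$, $\mathcal S_r(\mathbb R^d)$ is the set of $\phi\in\mathcal S(\mathbb R^d)$ with $\int x^\beta\phi(x)dx=0$ for all multi-indices $\beta$ with $|\beta|\le r$ (so $\mathcal S_r=\mathcal S$ if $r<0$), with the subspace topology; $\mathcal S_r'(\mathbb R^d)$ is its topological dual (tempered distributions modulo polynomials of degree $\le r$). Sobolev spaces. For $s\in\mathbb R$, $\dot H^s(\mathbb R^d)$ is the Hilbert completion of $\{f\in\mathcal S(\mathbb R^d): |\xi|^s\widehat f\in L^2\}$ under $(f,g)_{\dot H^s}=\int|\xi|^{2s}\widehat f(\xi)\overline{\widehat g(\xi)}d\xi$, identified with the set of $f\in\mathcal S'_{s-d/2}(\mathbb R^d)$ with $\widehat f\in L^2(|\xi|^{2s}d\xi)$.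 Fractional Gaussian field. For $s\in\mathbb R$ the Hurst parameter is $H=s-\frac d2$. $h\sim\mathrm{FGF}_s(\mathbb R^d)$ means $h$ is a random element of $\mathcal S_H'(\mathbb R^d)$ such that for every $\phi\in\mathcal S_H(\mathbb R^d)$, $(h,\phi)$ is a centered Gaussian with variance $\|\phi\|^2_{\dot H^{-s}(\mathbb R^d)}$. Let $T_s(\mathbb R^d)$ be the closure of $\mathcal S_H(\mathbb R^d)$ in $\dot H^{-s}(\mathbb R^d)$; the isometry $\phi\mapsto(h,\phi)$ from $\mathcal S_H(\mathbb R^d)$ to $L^2(\Omega)$ extends to $T_s(\mathbb R^d)$, defining $(h,\phi)$ for $\phi\in T_s(\mathbb R^d)$. Restriction. Identify $V$ isometrically with $\mathbb R^k$. For $\phi\in\mathcal S_H(\mathbb R^k)$ let $\phi^\uparrow\in\mathcal S'(\mathbb R^d)$ be given by $(\phi^\uparrow,f)=\int_V f(x)\phi(x)\,dx$ ($k$-dimensional Lebesgue measure on $V$). The restriction $h|_V$ is the Gaussian process $\phi\mapsto (h,\phi^\uparrow)$, $\phi\in\mathcal S_H(\mathbb R^k)$, where it is part of the claim that $\phi^\uparrow\in T_s(\mathbb R^d)$. *)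

(* Defs.v *)
From HB Require Import structures.
From mathcomp Require Import all_boot all_order all_algebra.
From mathcomp Require Import all_classical all_reals all_analysis.
From mathcomp.real_closed Require Import complex.

Set Implicit Arguments.
Unset Strict Implicit.
Unset Printing Implicit Defensive.
Import Order.TTheory GRing.Theory Num.Theory.
Import numFieldNormedType.Exports.
Local Open Scope classical_set_scope.
Local Open Scope ring_scope.

(* The Borel sigma-algebra of R^n = 'rV[R]_n, generated by the coordinates. *)
Definition rV_display : measure_display. Proof. exact. Qed.

Section measurable_rV.
Context {R : realType} {n : nat}.

Definition rV_coord (i : 'I_n) (x : 'rV[R]_n) : measurableTypeR R := x 0 i.

Let rV_set0 : g_sigma_preimage rV_coord set0.
Proof. exact: sigma_algebra0. Qed.

Let rV_setC A : g_sigma_preimage rV_coord A -> g_sigma_preimage rV_coord (~` A).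
Proof. exact: sigma_algebraC. Qed.

Let rV_bigcup (F : _^nat) : (forall i, g_sigma_preimage rV_coord (F i)) ->
  g_sigma_preimage rV_coord (\bigcup_i (F i)).
Proof. exact: sigma_algebra_bigcup. Qed.

HB.instance Definition _ := @isMeasurable.Build rV_display
  'rV[R]_n (g_sigma_preimage rV_coord) rV_set0 rV_setC rV_bigcup.

Lemma measurable_rV_coord (i : 'I_n) : measurable_fun setT (rV_coord i).
Proof.
move=> _ Y mY; rewrite setTI; apply: sub_sigma_algebra => /=.
rewrite -bigcup_seq/=; exists i => /=; first by rewrite mem_index_enum.
by exists Y => //; rewrite setTI.
Qed.

Lemma measurable_fun_rV d (T : measurableType d) (f : T -> 'rV[R]_n) :
  (forall i, measurable_fun setT (rV_coord i \o f)) -> measurable_fun setT f.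
Proof.
move=> mf _ A mA; rewrite setTI.
suff: (measurable : set (set 'rV[R]_n)) `<=` [set B | measurable (f @^-1` B)].
  exact.
apply: smallest_sub.
  split => [|B mB|F mF] /=.
  - by rewrite preimage_set0.
  - by rewrite setTD preimage_setC; exact: measurableC.
  - by rewrite preimage_bigcup; exact: bigcupT_measurable.
move=> B; rewrite -bigcup_seq => -[i _ [C mC <-]] /=.
by have := mf i measurableT C mC; rewrite !setTI.
Qed.

End measurable_rV.

Section lebesgue_rV.
Context {R : realType}.

Definition cons_rV n (p : measurableTypeR R * 'rV[R]_n) : 'rV[R]_n.+1 :=
  \row_i (if unlift 0 i is Some j then p.2 0 j else p.1).

Definition uncons_rV n (x : 'rV[R]_n.+1) : measurableTypeR R * 'rV[R]_n :=
  (x 0 0, \row_i x 0 (lift 0 i)).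

Lemma cons_rV0 n (p : measurableTypeR R * 'rV[R]_n) : cons_rV p 0 0 = p.1 :> R.
Proof. by rewrite mxE unlift_none. Qed.

Lemma cons_rVS n (p : measurableTypeR R * 'rV[R]_n) (i : 'I_n) : cons_rV p 0 (lift 0 i) = p.2 0 i.
Proof. by rewrite mxE liftK. Qed.

Lemma cons_rVK n : cancel (@cons_rV n) (@uncons_rV n).
Proof.
move=> [a x]; rewrite /uncons_rV cons_rV0; congr pair.
by apply/rowP => i; rewrite mxE cons_rVS.
Qed.

Lemma measurable_cons_rV n : measurable_fun setT (@cons_rV n).
Proof.
apply: measurable_fun_rV => i; have [->|[j ->]] : i = 0 \/ exists j, i = lift 0 j.
  by case: (unliftP 0 i) => [j ->|->]; [right; exists j|left].
  rewrite (_ : _ \o _ = fst); first exact: measurable_fst.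
  by apply/funext => p /=; rewrite /rV_coord cons_rV0.
rewrite (_ : _ \o _ = rV_coord j \o snd).
  by apply: measurableT_comp; [exact: measurable_rV_coord|exact: measurable_snd].
by apply/funext => p /=; rewrite /rV_coord cons_rVS.
Qed.

Lemma measurable_uncons_rV n : measurable_fun setT (@uncons_rV n).
Proof.
apply: measurable_fun_pair; first exact: measurable_rV_coord.
apply: measurable_fun_rV => i; rewrite (_ : _ \o _ = rV_coord (lift 0 i)).
  exact: measurable_rV_coord.
by apply/funext => x /=; rewrite /rV_coord mxE.
Qed.

Section step.
Context {n : nat} (m : {sigma_finite_measure set 'rV[R]_n -> \bar R}).

Definition lebesgue_cons : set 'rV[R]_n.+1 -> \bar R :=
  pushforward (@lebesgue_measure R \x m)%E (@cons_rV n).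

Let lebesgue_cons0 : lebesgue_cons set0 = 0%E.
Proof. by rewrite /lebesgue_cons /pushforward preimage_set0 measure0. Qed.

Let lebesgue_cons_ge0 A : (0 <= lebesgue_cons A)%E.
Proof. by rewrite /lebesgue_cons /pushforward; exact: measure_ge0. Qed.

Let lebesgue_cons_sigma_additive : semi_sigma_additive lebesgue_cons.
Proof.
move=> F mF tF mUF; rewrite /lebesgue_cons /pushforward preimage_bigcup.
have mc A : measurable A -> measurable (@cons_rV n @^-1` A).
  by move=> mA; rewrite -[_ @^-1` _]setTI; exact: measurable_cons_rV.
apply: measure_semi_sigma_additive.
- by move=> i; exact: mc.
- apply/trivIsetP => /= i j _ _ ij; rewrite -preimage_setI.
  by move/trivIsetP : tF => /(_ _ _ _ _ ij) ->//; rewrite preimage_set0.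
- by rewrite -preimage_bigcup; exact: mc.
Qed.

HB.instance Definition _ := isMeasure.Build _ _ _ lebesgue_cons
  lebesgue_cons0 lebesgue_cons_ge0 lebesgue_cons_sigma_additive.

Let lebesgue_cons_sigma_finite : sigma_finite setT lebesgue_cons.
Proof.
have /sigma_finiteP[F [FT ndF Foo]] := sigma_finiteT (@lebesgue_measure R).
have /sigma_finiteP[G [GT ndG Goo]] := sigma_finiteT m.
exists (fun i => @uncons_rV n @^-1` (F i `*` G i)).
  rewrite -preimage_bigcup -[LHS](preimage_setT (@uncons_rV n)); congr (_ @^-1` _).
  rewrite -setXTT FT GT predeqE => -[x y]; split.
    move=> [/= [i _ Fix] [j _ Gjy]]; exists (maxn i j) => //; split.
    - by move: x Fix; exact/subsetPset/ndF/leq_maxl.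
    - by move: y Gjy; exact/subsetPset/ndG/leq_maxr.
  by move=> [i _ []/= ? ?]; split; exists i.
move=> i; have [mF Fi] := Foo i; have [mG Gi] := Goo i; split.
  rewrite -[_ @^-1` _]setTI; apply: measurable_uncons_rV => //.
  exact: measurableX.
rewrite /lebesgue_cons /pushforward -comp_preimage.
rewrite (_ : _ \o _ = id) ?preimage_id; last first.
  by apply/funext => x /=; rewrite cons_rVK.
by rewrite product_measure1E// lte_mul_pinfty// ge0_fin_numE.
Qed.

HB.instance Definition _ := Measure_isSigmaFinite.Build _ _ _ lebesgue_cons
  lebesgue_cons_sigma_finite.

End step.

Fixpoint lebesgue_rV (n : nat) : {sigma_finite_measure set 'rV[R]_n -> \bar R} :=
  match n with
  | 0 => \d_(0 : 'rV[R]_0)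
  | n'.+1 => lebesgue_cons (lebesgue_rV n')
  end.

(* [lebesgue_rV n] is the measure for which boxes have their usual volume. *)
Lemma lebesgue_rV_box n (A : 'I_n -> set (measurableTypeR R)) :
  (forall i, measurable (A i)) ->
  lebesgue_rV n [set x | forall i, A i (x 0 i)] =
    (\prod_(i < n) @lebesgue_measure R (A i))%E.
Proof.
elim: n A => [|n IH] A mA /=.
  by rewrite big_ord0 diracE mem_set// => -[].
rewrite /lebesgue_cons /pushforward big_ord_recl -IH//.
rewrite -product_measure1E//.
  congr (_ _); apply/seteqP; split => -[a x] /=.
    move=> AX; split; first by have := AX 0; rewrite cons_rV0.
    by move=> i; have := AX (lift 0 i); rewrite cons_rVS.
  move=> [Aa Ax] i; case: (unliftP 0 i) => [j ->|->].
    by rewrite cons_rVS.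
  by rewrite cons_rV0.
rewrite [X in measurable X](_ : _ =
    \bigcap_(i in [set: 'I_n]) (rV_coord i @^-1` A (lift 0 i))); last first.
  by apply/seteqP; split => x /= Ax i => [_|]; [exact: Ax|exact: (Ax i I)].
apply: fin_bigcap_measurable => // i _; rewrite -[_ @^-1` _]setTI.
exact: measurable_rV_coord.
Qed.

End lebesgue_rV.

Section schwartz.
Context {R : realType} {d : nat}.
Implicit Types (f g phi psi : 'rV[R]_d -> R) (u : ('rV[R]_d -> R) -> R).

Definition dotrV (x y : 'rV[R]_d) : R := \sum_(i < d) x 0 i * y 0 i.

(* The library norm of a row vector is the max norm; this is the Euclidean one. *)
Definition enorm (x : 'rV[R]_d) : R := Num.sqrt (dotrV x x).

Definition partial (s : seq 'I_d) f : 'rV[R]_d -> R :=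
  foldr (fun i g x => 'D_(delta_mx 0 i) g x) f s.

Definition smooth f := forall s x, differentiable (partial s f) x.

Definition schwartz f := smooth f /\
  forall (N : nat) (s : seq 'I_d),
    exists M : R, forall x, (1 + enorm x) ^+ N * `|partial s f x| <= M.

Definition monomial (b : 'I_d -> nat) (x : 'rV[R]_d) : R :=
  \prod_(i < d) x 0 i ^+ b i.

(* The space S_r: Schwartz functions whose moments of order at most [r] vanish. *)
Definition schwartz_mom (r : R) phi := schwartz phi /\
  forall b : 'I_d -> nat, (\sum_(i < d) b i)%:R <= r ->
    \int[lebesgue_rV d]_x (monomial b x * phi x) = 0.

(* Closeness in the Schwartz topology: the sets [schwartz_close N e phi] with
   [0 < e] form a neighbourhood basis at [phi]. *)
Definition schwartz_close (N : nat) (e : R) phi psi :=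
  forall (s : seq 'I_d), (size s <= N)%N ->
    forall x, (1 + enorm x) ^+ N * `|partial s (psi \- phi) x| <= e.

(* The dual S_r'; a functional is represented by a total function of which only
   the values on S_r are meaningful. *)
Definition schwartz_dual (r : R) u :=
  (forall (a : R) phi psi, schwartz_mom r phi -> schwartz_mom r psi ->
    u (fun x => a * phi x + psi x) = a * u phi + u psi) /\
  (forall phi, schwartz_mom r phi -> forall e : R, 0 < e ->
    exists N : nat, exists2 delta : R, 0 < delta &
      forall psi, schwartz_mom r psi -> schwartz_close N delta phi psi ->
        `|u psi - u phi| < e).

Definition fourier phi (xi : 'rV[R]_d) : R[i] :=
  ((2 * pi) `^ (- (d%:R / 2)))%:C%C *
  ((\int[lebesgue_rV d]_x (phi x * cos (dotrV xi x))) -i*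
   (\int[lebesgue_rV d]_x (phi x * sin (dotrV xi x))))%C.

Definition sqnormC (z : R[i]) : R := complex.Re z ^+ 2 + complex.Im z ^+ 2.

Definition wL2norm2 (s : R) (g : 'rV[R]_d -> R[i]) : \bar R :=
  (\int[lebesgue_rV d]_xi (enorm xi `^ (2 * s) * sqnormC (g xi))%:E)%E.

Definition hdot_norm2 (s : R) phi : \bar R := wL2norm2 s (fourier phi).

(* [u] belongs to \dot H^s, seen inside S'_(s - d/2), and its Fourier transform,
   defined by (\hat u, psi) = (u, \hat psi), is the function [g]. Testing against
   real [psi] suffices, by complex linearity. *)
Definition hdot (s : R) u (g : 'rV[R]_d -> R[i]) :=
  let r := s - d%:R / 2 in
  [/\ schwartz_dual r u,
      measurable_fun setT (fun xi => complex.Re (g xi) : measurableTypeR R),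
      measurable_fun setT (fun xi => complex.Im (g xi) : measurableTypeR R),
      (wL2norm2 s g < +oo)%E &
      forall psi, schwartz psi ->
        schwartz_mom r (fun x => complex.Re (fourier psi x)) ->
        schwartz_mom r (fun x => complex.Im (fourier psi x)) ->
        u (fun x => complex.Re (fourier psi x)) =
          \int[lebesgue_rV d]_xi (complex.Re (g xi) * psi xi) /\
        u (fun x => complex.Im (fourier psi x)) =
          \int[lebesgue_rV d]_xi (complex.Im (g xi) * psi xi)].

(* T_s, the closure of S_H in \dot H^(-s), where H = s - d/2. *)
Definition fgf_test (s : R) u := exists2 g, hdot (- s) u g &
  forall e : R, 0 < e -> exists2 phi, schwartz_mom (s - d%:R / 2) phi &
    (wL2norm2 (- s) (fun xi => fourier phi xi - g xi)%R < e%:E)%E.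

End schwartz.

Section fgf.
Context {R : realType}.

(* [normal_prob 0 0] is not the Dirac mass at 0, so the degenerate case has to
   be singled out. *)
Definition centered_gaussian d (T : measurableType d) (P : probability T R)
    (X : T -> R) (v : \bar R) :=
  measurable_fun setT (X : T -> measurableTypeR R) /\
  exists sigma : R, [/\ 0 <= sigma, (sigma ^+ 2)%:E = v &
    forall A : set (measurableTypeR R), measurable A ->
      P (X @^-1` A) = if sigma == 0 then \d_(0 : measurableTypeR R) A
                      else normal_prob 0 sigma A].

(* [h w] is the sample [h(w)] in S_H'(R^n), H = s - n/2. *)
Definition is_fgf (n : nat) (s : R) d (T : measurableType d)
    (P : probability T R) (h : T -> ('rV[R]_n -> R) -> R) :=
  let H := s - n%:R / 2 in
  (forall w, schwartz_dual H (h w)) /\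
  (forall phi, schwartz_mom H phi ->
    centered_gaussian P (fun w => h w phi) (hdot_norm2 (- s) phi)).

(* [X] is (a version of) the value at [u] of the L^2(P)-continuous extension of
   [phi |-> (h, phi)] to T_s. *)
Definition is_fgf_ext (n : nat) (s : R) d (T : measurableType d)
    (P : probability T R) (h : T -> ('rV[R]_n -> R) -> R)
    (u : ('rV[R]_n -> R) -> R) (X : T -> R) :=
  measurable_fun setT (X : T -> measurableTypeR R) /\
  forall (phi : nat -> 'rV[R]_n -> R) g,
    (forall j, schwartz_mom (s - n%:R / 2) (phi j)) -> hdot (- s) u g ->
    wL2norm2 (- s) (fun xi => fourier (phi j) xi - g xi) @[j --> \oo] --> 0%E ->
    (\int[P]_w ((h w (phi j) - X w) ^+ 2)%:E)%E @[j --> \oo] --> 0%E.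

(* (h, u) for [u] in T_s, a random variable defined up to null sets. *)
Definition fgf_ext (n : nat) (s : R) d (T : measurableType d)
    (P : probability T R) (h : T -> ('rV[R]_n -> R) -> R)
    (u : ('rV[R]_n -> R) -> R) : T -> R :=
  get [set X | is_fgf_ext s P h u X].

Definition isometry_onto (n k : nat) (V : {vspace 'rV[R]_n})
    (J : 'Hom('rV[R]_k, 'rV[R]_n)) :=
  (forall x, enorm (J x) = enorm x) /\ limg J = V.

(* phi^up, with [V] parametrized by R^k through the isometry [J]. *)
Definition lift_test (n k : nat) (J : 'Hom('rV[R]_k, 'rV[R]_n))
    (phi : 'rV[R]_k -> R) : ('rV[R]_n -> R) -> R :=
  fun f => \int[lebesgue_rV k]_x (f (J x) * phi x).

Definition fgf_restr (n k : nat) (s : R) d (T : measurableType d)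
    (P : probability T R) (h : T -> ('rV[R]_n -> R) -> R)
    (J : 'Hom('rV[R]_k, 'rV[R]_n)) : T -> ('rV[R]_k -> R) -> R :=
  fun w phi => fgf_ext s P h (lift_test J phi) w.

(* The real processes [X] and [Y], indexed by [I] and possibly living on
   different probability spaces, have the same law along [D], i.e. the same
   finite-dimensional distributions. *)
Definition same_law (I : Type) (D : set I)
    d (T : measurableType d) (P : probability T R) (X : T -> I -> R)
    d' (T' : measurableType d') (P' : probability T' R) (Y : T' -> I -> R) :=
  forall (m : nat) (t : 'I_m -> I), (forall i, D (t i)) ->
    forall B : set 'rV[R]_m, measurable B ->
      P [set w | B (\row_i X w (t i))] = P' [set w | B (\row_i Y w (t i))].

(* [X], indexed by S_H(R^n) with H = s - n/2, has the joint law of [c] times an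
   FGF_s: linear combinations of its values are centered Gaussian with the
   variance dictated by linearity of FGF_s in the test function. This does not
   refer to any particular FGF_s sample in S_H'. *)
Definition has_fgf_law (n : nat) (s c : R) d (T : measurableType d)
    (P : probability T R) (X : T -> ('rV[R]_n -> R) -> R) :=
  forall (m : nat) (a : 'I_m -> R) (phi : 'I_m -> 'rV[R]_n -> R),
    (forall i, schwartz_mom (s - n%:R / 2) (phi i)) ->
    centered_gaussian P (fun w => \sum_(i < m) a i * X w (phi i))
      ((c ^+ 2)%:E *
       hdot_norm2 (- s) (fun x => \sum_(i < m) a i * phi i x)%R)%E.

End fgf.

(* Main.v *)
(* Write s = H + d/2, complete the isometry J to an orthogonal splitting R^d = R^k x R^p
   with p = d - k, and let xi = (eta, zeta) be the frequency in these coordinates. The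
   Fourier transform of phi^up is (2 pi)^(-p/2) phi^(eta), and scaling zeta by |eta| gives
     int (|eta|^2 + |zeta|^2)^(-s) dzeta = c |eta|^(p - 2 s) = c |eta|^(-2 (H + k/2)),
   so that the squared \dot H^(-s)(R^d) norm of phi^up is C^2 = (2 pi)^(-p) c times the
   squared \dot H^(-(H + k/2))(R^k) norm of phi.
   Tensoring phi with narrow Gaussian densities in the p transverse directions keeps the
   vanishing moments and converges to phi^up in \dot H^(-s). Hence (h, phi^up) is an L^2
   limit of centered Gaussians, which is identified through its characteristic function.
   All uniqueness statements (invariance of Lebesgue measure under rotations and
   dilations, uniqueness of the Fourier transform of a functional, equality of laws) are
   instances of one theorem, [cf_unique], for integrable densities that may change sign. *)

Require Import Defs.
From HB Require Import structures.
From mathcomp Require Import all_boot all_order all_algebra.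
From mathcomp Require Import all_classical all_reals all_analysis.
From mathcomp.real_closed Require Import complex.
From mathcomp Require Import measurable_realfun lebesgue_integral_under.
From mathcomp Require Import ring lra.

Set Implicit Arguments.
Unset Strict Implicit.
Unset Printing Implicit Defensive.
Import Order.TTheory GRing.Theory Num.Theory.
Import numFieldNormedType.Exports.
Local Open Scope classical_set_scope.
Local Open Scope ring_scope.

(** * One-dimensional Gaussian densities *)

(** Two obstacles shape the proof. First, [fgf_ext] quantifies over every function [g] representing
    the functional and every sequence converging to it, so the representative must be unique up to
    null sets. Testing against Gaussians times cosines and sines reduces this to [cf_unique] for
    densities such as the real part of [g] times a Gaussian; this is where signs change. Such tests
    are admissible because the moment order [- s - n/2] is negative. Second, the norms must be
    finite. Near frequency 0 this is not derived from the vanishing moments by a Taylor expansion: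
    the field itself supplies it, since a Gaussian variance is finite and mollified functions are
    legitimate arguments of [h]. At high frequency an unsharp half of Plancherel's theorem is
    enough. [cf_unique] rests on the Gaussian being its own Fourier transform: averaging the cosine
    and sine integrals against a Gaussian yields a convolution with a narrow Gaussian, whose
    integrals over orthants tend to those of the original density. *)

Section normal.
Context {R : realType}.
Notation mu := (@lebesgue_measure R).

(** The fundamental theorem of calculus on [[-(n+1), n+1]], the truncated integrals being dominated
    by [|g|]. Every integration by parts below is an instance; the shift by one keeps the interval
    nondegenerate. *)
Lemma integralT_derive_eq0 (G g : R -> R) :
  (forall x, is_derive x (1 : R) G (g x)) -> continuous g -> mu.-integrable setT (EFin \o g) ->
  G n%:R @[n --> \oo] --> 0 -> G (- n%:R) @[n --> \oo] --> 0 ->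
  \int[mu]_x g x = 0.
Proof.
move=> dG cg ig G1 G2.
have E1 n : (\int[mu]_(x in `[(- n.+1%:R)%R, n.+1%:R]) (g x)%:E = (G n.+1%:R - G (- n.+1%:R))%:E)%E.
  have dG' x : derivable G x 1 by apply: (@ex_derive _ _ _ _ _ _ _ (dG x)).
  have cG : continuous G.
    by move=> x; apply: differentiable_continuous; apply/derivable1_diffP.
  apply: continuous_FTC2.
  - by rewrite gtrN// ltr0n.
  - exact: continuous_subspaceT.
  - split => //; first exact: cvg_at_right_filter (cG _).
    exact: cvg_at_left_filter (cG _).
  - by move=> x _; rewrite derive1E; apply: derive_val.
have c1 : (\int[mu]_(x in `[(- n.+1%:R)%R, n.+1%:R]) (g x)%:E)%E @[n --> \oo] --> (\int[mu]_x (g x)%:E)%E.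
  under eq_fun do rewrite integral_mkcond.
  apply: (@dominated_cvg _ _ _ mu _ measurableT _ _ (abse \o (EFin \o g))) => //.
  - move=> n; apply/(measurable_restrictT _ _).1 => //.
    by apply: measurable_funTS; exact: measurable_int ig.
  - move=> x _; apply: cvg_near_cst; exists (Num.truncn `|x|) => // n /= xn.
    rewrite patchE mem_set//= in_itv/=.
    have : `|x| <= n.+1%:R.
      apply: ltW; apply: (lt_le_trans (truncnS_gt _)); rewrite ler_nat ltnS //.
    by rewrite ler_norml.
  - exact: integrable_abse.
  - by move=> n x _; rewrite patchE; case: ifP => //= _; rewrite normr0 lee_fin.
have c2 : (\int[mu]_(x in `[(- n.+1%:R)%R, n.+1%:R]) (g x)%:E)%E @[n --> \oo] --> 0%:E.
  under eq_fun do rewrite E1.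
  apply: cvg_EFin; first by near=> n.
  rewrite -[X in _ --> X](subr0 0); apply: cvgB.
    by rewrite (cvg_shiftS (fun n => G n%:R)).
  by rewrite (cvg_shiftS (fun n => G (- n%:R))).
by rewrite /Rintegral; have -> := cvg_unique _ c1 c2.
Unshelve. all: by end_near. Qed.

Lemma is_derive_normal_pdf (s x : R) : s != 0 ->
  is_derive x (1 : R) (normal_pdf 0 s) (- (x / s ^+ 2) * normal_pdf 0 s x).
Proof.
move=> s0; rewrite normal_pdfE // /normal_fun.
apply: is_derive_eq.
by rewrite /GRing.scale/= subr0; field.
Qed.

Lemma normal_peak_double (s : R) : normal_peak (s *+ 2) = normal_peak s / 2.
Proof.
rewrite /normal_peak -invfM; congr _^-1.
rewrite (_ : (s *+ 2) ^+ 2 * pi *+ 2 = (s ^+ 2 * pi *+ 2) * 2 ^+ 2); last by ring.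
rewrite sqrtrM; last by rewrite mulrn_wge0// mulr_ge0 ?sqr_ge0 ?pi_ge0.
by rewrite sqrtr_sqr ger0_norm.
Qed.

(** Doubling the deviation absorbs the square: the quotient of the two exponentials is the
    exponential of [3 (x - m)^2 / (8 s^2)], which dominates its linear part. Half of the constant 8
    compensates the halved peak. *)
Lemma normal_pdf_sqr_le (m s x : R) : s != 0 ->
  (x - m) ^+ 2 * normal_pdf m s x <= 8 * s ^+ 2 * normal_pdf m (s *+ 2) x.
Proof.
move=> s0; have s20 : s *+ 2 != 0 by rewrite mulrn_eq0.
rewrite !normal_pdfE // /normal_fun normal_peak_double.
rewrite (_ : 8 * s ^+ 2 * _ = normal_peak s * (4 * s ^+ 2 * expR (- (x - m) ^+ 2 / ((s *+ 2) ^+ 2 *+ 2)))); last by field.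
rewrite mulrCA ler_wpM2l ?normal_peak_ge0//.
set E := expR _; set F := expR _.
have -> : E = F * expR (- ((x - m)^+2 * 3 / (8 * s ^+ 2))).
  rewrite -expRD; congr expR; field. done.
rewrite mulrCA mulrC ler_wpM2r ?expR_ge0//.
have := expR_ge1Dx ((x - m) ^+ 2 * 3 / (8 * s ^+ 2)).
rewrite expRN; set G := expR _ => h.
have G0 : 0 < G by exact: expR_gt0.
rewrite ler_pdivrMr//.
apply: le_trans (_ : 4 * s ^+2 * (1 + (x - m) ^+ 2 * 3 / (8 * s ^+ 2)) <= _); last first.
  by rewrite ler_wpM2l// mulr_ge0// sqr_ge0.
rewrite mulrDr.
have -> : 4 * s ^+ 2 * ((x - m) ^+ 2 * 3 / (8 * s ^+ 2)) = (x - m) ^+2 * (3/2) by field.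
have := sqr_ge0 (x - m); have := sqr_ge0 s; nra.
Qed.

Lemma normal_pdf_sqr_bound (s x : R) : s != 0 ->
  x ^+ 2 * normal_pdf 0 s x <= 8 * s ^+ 2 * normal_peak (s *+ 2).
Proof.
move=> s0; have s20 : s *+ 2 != 0 by rewrite mulrn_eq0.
have := normal_pdf_sqr_le 0 x s0; rewrite subr0 => /le_trans; apply.
by rewrite ler_wpM2l ?(mulr_ge0 (ler0n _ 8) (sqr_ge0 s)) ?normal_pdf_ub.
Qed.

Lemma integrable_sqr_normal_pdf (s : R) : s != 0 ->
  mu.-integrable setT (EFin \o (fun x => x ^+ 2 * normal_pdf 0 s x)).
Proof.
move=> s0.
apply: (@le_integrable _ _ _ mu _ measurableT _ (fun x => (8 * s ^+ 2)%:E * (normal_pdf 0 (s *+ 2) x)%:E)%E).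
- apply/measurable_EFinP; apply: measurable_funM => //; exact: measurable_normal_pdf.
- move=> x _; have := normal_pdf_sqr_le 0 x s0; rewrite subr0 => h.
  rewrite -EFinM /= lee_fin !ger0_norm//.
    by rewrite mulr_ge0 ?normal_pdf_ge0// mulr_ge0 ?sqr_ge0.
  by rewrite mulr_ge0 ?sqr_ge0 ?normal_pdf_ge0.
- by apply: integrableZl => //; exact: integrable_normal_pdf.
Qed.

(** Chebyshev's inequality with [normal_pdf_sqr_le] in the role of the second moment, whence 8
    instead of 1. *)
Lemma normal_prob_tail (m s e : R) : s != 0 -> 0 < e ->
  (normal_prob m s [set y | (e <= `|y - m|)%R] <= (8 * s ^+ 2 / e ^+ 2)%:E)%E.
Proof.
move=> s0 e0; rewrite /normal_prob.
have mA : measurable [set y : R | e <= `|y - m|].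
  rewrite -[X in measurable X]setTI; apply: (measurable_fun_ler) => //.
  by apply: measurableT_comp => //; apply: measurable_funB.
have c0 : 0 <= 8 * s ^+ 2 / e ^+ 2 by rewrite divr_ge0 ?sqr_ge0// mulr_ge0 ?sqr_ge0.
apply: le_trans (_ : \int[mu]_(y in [set y | (e <= `|y - m|)%R]) ((8 * s ^+ 2 / e ^+ 2)%:E * (normal_pdf m (s *+ 2) y)%:E) <= _)%E.
  apply: ge0_le_integral => //.
  - by move=> y _; rewrite lee_fin normal_pdf_ge0.
  - by apply: measurable_funTS; apply/measurable_EFinP; exact: measurable_normal_pdf.
  - apply: measurable_funTS; apply/measurable_EFinP; apply: measurable_funM => //; exact: measurable_normal_pdf.
  - move=> y /= ey; rewrite -EFinM lee_fin mulrAC ler_pdivlMr ?exprn_gt0//.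
    apply: le_trans (normal_pdf_sqr_le m y s0); rewrite mulrC ler_wpM2r ?normal_pdf_ge0//.
    by rewrite -(real_normK (num_real (y - m))) lerXn2r// nnegrE// ltW.
apply: le_trans (_ : \int[mu]_y ((8 * s ^+ 2 / e ^+ 2)%:E * (normal_pdf m (s *+ 2) y)%:E) <= _)%E.
  apply: ge0_subset_integral => //.
  - apply/measurable_EFinP; apply: measurable_funM => //; exact: measurable_normal_pdf.
  - by move=> y _; rewrite -EFinM lee_fin mulr_ge0 ?normal_pdf_ge0.
rewrite ge0_integralZl//; first by rewrite integral_normal_pdf mule1.
- by apply/measurable_EFinP; exact: measurable_normal_pdf.
- by move=> y _; rewrite lee_fin normal_pdf_ge0.
Qed.

(* Narrow normal laws smooth the indicator of a closed half-line: the bound is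
   shifted by more than the standard deviation, so that the limit is exact at [c]. *)
Lemma cvg_normal_prob_ray (m c : R) :
  normal_prob m (n.+1%:R^-1 ^+ 2) `]-oo, (c + n.+1%:R^-1)]%classic @[n --> \oo] -->
  (if (m <= c)%R then 1 else 0)%E.
Proof.
pose e n : R := n.+1%:R^-1.
have e0 n : 0 < e n by rewrite invr_gt0.
have ne0 n : e n ^+ 2 != 0 by rewrite gt_eqF// exprn_gt0.
have ce : e n @[n --> \oo] --> 0 by exact: cvg_harmonic.
have cek k : e n ^+ k.+1 @[n --> \oo] --> 0.
  by have := cvg_comp _ _ ce (@exprn_continuous R k.+1 0); rewrite expr0n.
have mR n : measurable (`]-oo, (c + e n)]%classic : set R) by exact: measurable_itv.
have [mc|cm] := leP m c.
  (* Deviation [e n ^+ 2] against distance [e n] turns the tail bound into [8 * e n ^+ 2]. *)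
  apply: (@squeeze_cvge _ _ _ _ (fun n => (1 - 8 * e n ^+ 2)%:E) _ (fun=> 1%E)).
  - near=> n; rewrite probability_le1// andbT.
    rewrite -[X in normal_prob _ _ X]setCK probability_setC; last exact: measurableC.
    rewrite EFinB leeB//.
    apply: le_trans (_ : normal_prob m (e n ^+ 2) [set y | (e n <= `|y - m|)%R] <= _)%E.
      apply: le_measure; rewrite ?inE.
      + exact: measurableC.
      + rewrite -[X in measurable X]setTI; apply: (measurable_fun_ler) => //.
        by apply: measurableT_comp => //; apply: measurable_funB.
      + move=> y /=; rewrite in_itv/= => /negP; rewrite -ltNge => h.
        rewrite -/(e n) in h; rewrite ler_normr; apply/orP; left.
        by rewrite lerBrDr ltW// (le_lt_trans _ h)// addrC lerD2r.
    apply: le_trans (normal_prob_tail m (ne0 n) (e0 n)) _.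
    by rewrite lee_fin le_eqVlt; apply/orP; left; apply/eqP; field; rewrite gt_eqF.
  - apply: cvg_EFin; first by near=> n.
    rewrite -[X in _ --> X]subr0; apply: cvgB; first exact: cvg_cst.
    rewrite -(mulr0 8); apply: cvgM; first exact: cvg_cst.
    exact: (cek 1%N).
  - exact: cvg_cst.
(* Half of the gap: once [e n < g], the whole shifted ray stays at distance at least [g] from
   [m]. *)
pose g := (m - c) / 2; have g0 : 0 < g by rewrite /g; lra.
apply: (@squeeze_cvge _ _ _ _ (fun=> 0%E) _ (fun n => (8 / g ^+ 2 * e n ^+ 4)%:E)).
- near=> n; rewrite measure_ge0/=.
  have eg : e n < g by near: n; exact: (cvgr_lt _ ce).
  apply: le_trans (_ : normal_prob m (e n ^+ 2) [set y | (g <= `|y - m|)%R] <= _)%E.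
    apply: le_measure; rewrite ?inE//.
    + rewrite -[X in measurable X]setTI; apply: (measurable_fun_ler) => //.
      by apply: measurableT_comp => //; apply: measurable_funB.
    + move=> y /=; rewrite in_itv/= -/(e n) => h.
      rewrite ler_normr opprB; apply/orP; right; rewrite lerBrDr -lerBrDl.
      by apply: (le_trans h); move: eg; rewrite /g; lra.
  apply: le_trans (normal_prob_tail m (ne0 n) g0) _.
  by rewrite lee_fin le_eqVlt; apply/orP; left; apply/eqP; field; rewrite gt_eqF.
- exact: cvg_cst.
- apply: cvg_EFin; first by near=> n.
  rewrite -(mulr0 (8 / g ^+ 2)); apply: cvgM; first exact: cvg_cst.
  exact: (cek 3%N).
Unshelve. all: by end_near. Qed.

Lemma integrable_norm_normal_pdf (s : R) : s != 0 ->
  mu.-integrable setT (EFin \o (fun x => `|x| * normal_pdf 0 s x)).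
Proof.
move=> s0.
have := integrableD measurableT (integrable_normal_pdf 0 s) (integrable_sqr_normal_pdf s0).
apply: le_integrable => //.
  apply/measurable_EFinP; apply: measurable_funM; last exact: measurable_normal_pdf.
  exact: normr_measurable.
move=> x _; rewrite /= lee_fin -[X in X + _]mul1r -mulrDl.
rewrite !normrM normr_id ler_wpM2r// ger0_norm ?addr_ge0 ?sqr_ge0//.
by rewrite -(real_normK (num_real x)); nra.
Qed.

Lemma cvg_norm_inv_bound (u : nat -> R) K : (forall n, n%:R * `|u n| <= K) ->
  u n @[n --> \oo] --> 0.
Proof.
move=> uK; apply/cvgrPdist_lt => e e0.
exists (Num.truncn (K / e)).+1 => // n /= Kn; rewrite sub0r normrN.
rewrite ltNge; apply/negP => une.
have : K / e < n%:R by apply: (lt_le_trans (truncnS_gt _)); rewrite ler_nat.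
rewrite ltr_pdivrMr// => h.
have := uK n; rewrite leNgt => /negP; apply.
by apply: (lt_le_trans h); rewrite ler_wpM2l.
Qed.

Let nrm (s x : R) : `|- s ^+ 2 * x| = s ^+ 2 * `|x|.
Proof. by rewrite normrM normrN (ger0_norm (sqr_ge0 s)). Qed.

(** The density times [x^2 - s^2] is the derivative of [- s^2 x] times the density. *)
Lemma normal_pdf_moment2 (s : R) : s != 0 ->
  \int[mu]_x (x ^+ 2 * normal_pdf 0 s x) = s ^+ 2.
Proof.
move=> s0.
have i2 := integrable_sqr_normal_pdf s0.
have i0 : mu.-integrable setT (EFin \o (fun x => s ^+ 2 * normal_pdf 0 s x)).
  by apply: (integrableZl _ (s ^+ 2) (integrable_normal_pdf 0 s)).
have : \int[mu]_x (x ^+ 2 * normal_pdf 0 s x - s ^+ 2 * normal_pdf 0 s x) = 0.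
  apply: (@integralT_derive_eq0 (fun x => - s ^+ 2 * (x * normal_pdf 0 s x)) (fun x => x ^+ 2 * normal_pdf 0 s x - s ^+ 2 * normal_pdf 0 s x)).
  - move=> x; have dN := is_derive_normal_pdf x s0.
    by apply: is_derive_eq; rewrite /GRing.scale/=; field.
  - move=> x; apply: cvgB; apply: cvgM; try exact: continuous_normal_pdf.
      exact: exprn_continuous.
    exact: cvg_cst.
  - exact: (integrableB measurableT i2 i0).
  - apply: (@cvg_norm_inv_bound _ (s ^+ 2 * (8 * s ^+ 2 * normal_peak (s *+ 2)))) => n.
    rewrite nrm mulrCA ler_wpM2l ?sqr_ge0//.
    rewrite normrM ger0_norm// (ger0_norm (normal_pdf_ge0 _ _ _)) mulrA -expr2.
    exact: normal_pdf_sqr_bound.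
  - apply: (@cvg_norm_inv_bound _ (s ^+ 2 * (8 * s ^+ 2 * normal_peak (s *+ 2)))) => n.
    rewrite nrm mulrCA ler_wpM2l ?sqr_ge0//.
    rewrite normrM (ger0_norm (normal_pdf_ge0 _ _ _)) normrN ger0_norm// mulrA -expr2 -sqrrN.
    exact: normal_pdf_sqr_bound.
rewrite RintegralB// RintegralZl//; last exact: integrable_normal_pdf.
by rewrite [X in _ - _ * X]/Rintegral integral_normal_pdf mulr1 => /eqP; rewrite subr_eq0 => /eqP.
Qed.

(** The phase [c] treats cosine and sine at once: [c = - pi / 2] turns one into the other. *)
Let cosF (s c b : R) : R := \int[mu]_x (normal_pdf 0 s x * cos (b * x + c)).

Let meas_cos (f : R -> R) : continuous f -> forall b c : R, measurable_fun setT (fun x => f (b * x + c)).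
Proof.
move=> cf b c; apply: measurableT_comp; first exact: continuous_measurable_fun.
by apply: measurable_funD => //; exact: mulrl_measurable.
Qed.

Let integrable_normal_mul (s : R) (f : R -> R) : measurable_fun setT f ->
  (forall x, `|f x| <= 1) -> mu.-integrable setT (EFin \o (fun x => normal_pdf 0 s x * f x)).
Proof.
move=> mf f1; apply: (le_integrable measurableT _ _ (integrable_normal_pdf 0 s)).
  by apply/measurable_EFinP; apply: measurable_funM => //; exact: measurable_normal_pdf.
by move=> x _; rewrite /= lee_fin normrM ler_piMr.
Qed.

Let cos_le (x : R) : `|cos x| <= 1. Proof. by rewrite ler_norml cos_geN1 cos_le1. Qed.
Let sin_le (x : R) : `|sin x| <= 1. Proof. by rewrite ler_norml sin_geN1 sin_le1. Qed.

Let integrable_id_normal_mul (s : R) (f : R -> R) : s != 0 -> measurable_fun setT f ->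
  (forall x, `|f x| <= 1) -> mu.-integrable setT (EFin \o (fun x => x * normal_pdf 0 s x * f x)).
Proof.
move=> s0 mf f1; apply: (le_integrable measurableT _ _ (integrable_norm_normal_pdf s0)).
  apply/measurable_EFinP; apply: measurable_funM => //.
  by apply: measurable_funM => //; exact: measurable_normal_pdf.
move=> x _; rewrite /= lee_fin normrM [leRHS]normrM normr_id.
by rewrite -[leRHS]normrM ler_piMr.
Qed.

Let parts (s c b : R) : s != 0 ->
  \int[mu]_x (x * normal_pdf 0 s x * sin (b * x + c)) = s ^+ 2 * b * cosF s c b.
Proof.
move=> s0.
have i1 := integrable_id_normal_mul s0 (meas_cos (@continuous_sin R) b c) (fun=> sin_le _).
have i2 := integrable_normal_mul s (meas_cos (@continuous_cos R) b c) (fun=> cos_le _).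
have i3 : mu.-integrable setT (EFin \o (fun x => s ^+ 2 * b * (normal_pdf 0 s x * cos (b * x + c)))).
  by apply: (integrableZl _ (s ^+ 2 * b) i2).
(* The boundary terms are only taken at integers, where [|t| <= t^2], so that the bound on the
   squared weight applies once more. *)
have bnd t : `|t| <= 0 \/ 1 <= `|t| -> `|t| * `|- s ^+ 2 * (normal_pdf 0 s t * sin (b * t + c))| <= s ^+ 2 * (8 * s ^+ 2 * normal_peak (s *+ 2)).
  move=> ht; rewrite nrm mulrCA ler_wpM2l ?sqr_ge0//.
  apply: le_trans (normal_pdf_sqr_bound t s0); rewrite -(real_normK (num_real t)).
  rewrite normrM (ger0_norm (normal_pdf_ge0 _ _ _)).
  have := normal_pdf_ge0 0 s t; set N := normal_pdf _ _ _ => N0.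
  have := sin_le (b * t + c); set S := `|sin _| => S1; have S0 : 0 <= S by exact: normr_ge0.
  have : 0 <= `|t| by []. set T := `|t| in ht *. move=> T0.
  have NS : N * S <= N by rewrite ler_piMr.
  case: ht => hT.
    have -> : T = 0 by apply/eqP; rewrite eq_le hT.
    by rewrite expr2 !mul0r.
  apply: le_trans (_ : T * N <= _); first by rewrite ler_wpM2l.
  by rewrite ler_wpM2r// expr2 ler_peMl.
have natd n : (`|n%:R : R| <= 0) \/ 1 <= `|n%:R : R|.
  by case: n => [|n]; [left; rewrite normr0|right; rewrite ger0_norm// ler1n].
have : \int[mu]_x (x * normal_pdf 0 s x * sin (b * x + c) - s ^+ 2 * b * (normal_pdf 0 s x * cos (b * x + c))) = 0.
  apply: (@integralT_derive_eq0 (fun x => - s ^+ 2 * (normal_pdf 0 s x * sin (b * x + c))) (fun x => x * normal_pdf 0 s x * sin (b * x + c) - s ^+ 2 * b * (normal_pdf 0 s x * cos (b * x + c)))).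
  - move=> x; have dN := is_derive_normal_pdf x s0.
    have dl : is_derive x (1 : R) (fun x => b * x + c) b.
      by apply: is_derive_eq; rewrite /GRing.scale/=; ring.
    have dS : is_derive x (1 : R) (fun x => sin (b * x + c)) (cos (b * x + c) * b).
      exact: (@is_derive1_comp _ sin).
    by apply: is_derive_eq; rewrite /GRing.scale/=; field.
  - have cl x : {for x, continuous (fun x => b * x + c)}.
      by apply: cvgD; [apply: cvgM => //; exact: cvg_cst|exact: cvg_cst].
    move=> x; apply: cvgB; apply: cvgM.
    + by apply: cvgM => //; exact: continuous_normal_pdf.
    + by apply: (continuous_comp (cl x)); exact: continuous_sin.
    + exact: cvg_cst.
    + apply: cvgM; first exact: continuous_normal_pdf.
      by apply: (continuous_comp (cl x)); exact: continuous_cos.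
  - exact: (integrableB measurableT i1 i3).
  - apply: (@cvg_norm_inv_bound _ (s ^+ 2 * (8 * s ^+ 2 * normal_peak (s *+ 2)))) => n.
    by rewrite -[X in X * _](ger0_norm (ler0n _ _)); exact: bnd.
  - apply: (@cvg_norm_inv_bound _ (s ^+ 2 * (8 * s ^+ 2 * normal_peak (s *+ 2)))) => n.
    rewrite -[X in X * _](ger0_norm (ler0n _ _)) -[X in X * _]normrN; apply: bnd.
    by rewrite normrN.
rewrite RintegralB// RintegralZl//.
by move=> /eqP; rewrite subr_eq0 => /eqP.
Qed.

Let cosF_derive (s c b : R) : s != 0 ->
  is_derive b (1 : R) (cosF s c) (- (s ^+ 2 * b * cosF s c b)).
Proof.
move=> s0.
pose f (b x : R) : R := normal_pdf 0 s x * cos (b * x + c).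
have df x y : is_derive x (1 : R) (f ^~ y) (- (y * normal_pdf 0 s y * sin (x * y + c))).
  have dl : is_derive x (1 : R) (fun x => x * y + c) y.
    by apply: is_derive_eq; rewrite /GRing.scale/=; ring.
  have dC : is_derive x (1 : R) (fun x => cos (x * y + c)) (- sin (x * y + c) * y).
    exact: (@is_derive1_comp _ cos).
  by apply: is_derive_eq; rewrite /GRing.scale/=; ring.
have df' x y : partial1of2 f x y = - (y * normal_pdf 0 s y * sin (x * y + c)).
  by rewrite partial1of2E; apply: derive_val.
have Ib : `](b - 1), (b + 1)[%classic b by rewrite /= in_itv/=; apply/andP; split; lra.
have H1 : forall x, `](b - 1), (b + 1)[%classic x -> mu.-integrable setT (EFin \o f x).
  move=> x _; exact: (integrable_normal_mul s (meas_cos (@continuous_cos R) x c) (fun=> cos_le _)).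
have H2 : forall x y, `](b - 1), (b + 1)[%classic x -> [set: R] y -> derivable (f ^~ y) x 1.
  by move=> x y _ _; apply: ex_derive.
have H3 : forall y, 0 <= `|y| * normal_pdf 0 s y.
  by move=> y; rewrite mulr_ge0 ?normal_pdf_ge0.
have H4 : forall x y, `](b - 1), (b + 1)[%classic x -> [set: R] y -> `|partial1of2 f x y| <= `|y| * normal_pdf 0 s y.
  move=> x y _ _; rewrite df' normrN normrM normrM [X in _ * X * _]ger0_norm ?normal_pdf_ge0//.
  by rewrite ler_piMr// mulr_ge0 ?normal_pdf_ge0.
apply: DeriveDef.
  exact: (derivable_under_integral measurableT Ib H1 H2 H3 (integrable_norm_normal_pdf s0) H4).
rewrite -derive1E.
rewrite [LHS](differentiation_under_integral measurableT Ib H1 H2 H3 (integrable_norm_normal_pdf s0) H4).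
under eq_Rintegral do rewrite df' -mulN1r.
rewrite RintegralZl//; last exact: (integrable_id_normal_mul s0 (meas_cos (@continuous_sin R) b c) (fun=> sin_le _)).
by rewrite parts// mulN1r.
Qed.

(** [cosF_derive] is the linear equation [F' = - s^2 b F]; dividing by its exponential solution
    leaves a constant, read off at [b = 0]. *)
Let cosFE (s c b : R) : s != 0 -> cosF s c b = cos c * expR (- (s ^+ 2 * b ^+ 2 / 2)).
Proof.
move=> s0.
pose D b := cosF s c b * expR (s ^+ 2 * b ^+ 2 / 2).
have : D b = D 0.
  apply: is_derive_0_is_cst => x; rewrite /D.
  have dF := cosF_derive c x s0.
  have dl : is_derive x (1 : R) (fun b => s ^+ 2 * b ^+ 2 / 2) (s ^+ 2 * x).
    by apply: is_derive_eq; rewrite /GRing.scale/=; field.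
  have dE : is_derive x (1 : R) (fun b => expR (s ^+ 2 * b ^+ 2 / 2)) (expR (s ^+ 2 * x ^+ 2 / 2) * (s ^+ 2 * x)).
    exact: (@is_derive1_comp _ expR).
  by apply: is_derive_eq; rewrite /GRing.scale/=; ring.
rewrite /D expr0n /= mulr0 mul0r expR0 mulr1.
have -> : cosF s c 0 = cos c.
  rewrite /cosF; under eq_Rintegral do rewrite mul0r add0r.
  rewrite RintegralZr//; last exact: integrable_normal_pdf.
  by rewrite /Rintegral integral_normal_pdf mul1r.
by move=> <-; rewrite -mulrA -expRD subrr expR0 mulr1.
Qed.

Lemma normal_pdf_cf (s b : R) : s != 0 ->
  \int[mu]_x (normal_pdf 0 s x * cos (b * x)) = expR (- (s ^+ 2 * b ^+ 2 / 2))
  /\ \int[mu]_x (normal_pdf 0 s x * sin (b * x)) = 0.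
Proof.
move=> s0; split.
  by have := cosFE 0 b s0; rewrite cos0 mul1r => <-; apply: eq_Rintegral => x _; rewrite addr0.
have := cosFE (- (pi / 2)) b s0; rewrite cosN cos_pihalf mul0r => E; rewrite -[RHS]E.
by apply: eq_Rintegral => x _; rewrite cosBpihalf.
Qed.

End normal.

(** * Integration on row vectors *)

Section Rint.
Context d1 d2 (T1 : measurableType d1) (T2 : measurableType d2) (R : realType).
Context (m1 : {sigma_finite_measure set T1 -> \bar R}) (m2 : {sigma_finite_measure set T2 -> \bar R}).

(** The inner [Rintegral] is [fine] of an integral that is finite only almost everywhere, so the two
    iterated integrands agree up to a null set. *)
Lemma Rintegral_fubini1 (f : T1 * T2 -> R) : (m1 \x m2)%E.-integrable setT (EFin \o f) ->
  \int[m1]_x \int[m2]_y f (x, y) = \int[(m1 \x m2)%E]_z f z.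
Proof.
move=> fi; rewrite /Rintegral; congr fine.
rewrite -(integral12_prod_meas1 fi); apply: ae_eq_integral => //.
- apply/measurable_EFinP. apply: measurableT_comp => //. exact: measurable_fubini_F fi.
- exact: measurable_fubini_F fi.
- have := ae_integrable1 fi; apply: filterS => x xi _.
  by rewrite /fubini_F fineK//; apply: integrable_fin_num.
Qed.

Lemma Rintegral_fubini2 (f : T1 * T2 -> R) : (m1 \x m2)%E.-integrable setT (EFin \o f) ->
  \int[m2]_y \int[m1]_x f (x, y) = \int[(m1 \x m2)%E]_z f z.
Proof.
move=> fi; rewrite /Rintegral; congr fine.
rewrite -(integral21_prod_meas1 fi); apply: ae_eq_integral => //.
- apply/measurable_EFinP. apply: measurableT_comp => //. exact: measurable_fubini_G fi.
- exact: measurable_fubini_G fi.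
- have := ae_integrable2 fi; apply: filterS => x xi _.
  by rewrite /fubini_G fineK//; apply: integrable_fin_num.
Qed.

(** No section of [f] is assumed integrable, so the positive and negative parts go through Tonelli
    separately. *)
Lemma measurable_Rintegral (f : T1 * T2 -> R) : measurable_fun setT f ->
  measurable_fun setT (fun x => \int[m2]_y f (x, y)).
Proof.
move=> mf; rewrite /Rintegral; apply: (measurableT_comp (@fine_measurable _ _ _)) => //.
under eq_fun do rewrite integralE.
apply: emeasurable_funB.
- have mp : measurable_fun setT (EFin \o f)^\+%E.
    by apply: measurable_funepos; apply/measurable_EFinP.
  have h := measurable_fun_fubini_tonelli_F (m2 := m2) _ mp (funepos_ge0 _).
  rewrite (_ : (fun x => _) = fubini_F m2 (EFin \o f)^\+%E) //.
  apply/funext => x; apply: eq_integral => y _; by rewrite !funeposE.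
- have mn : measurable_fun setT (EFin \o f)^\-%E.
    by apply: measurable_funeneg; apply/measurable_EFinP.
  have h' := measurable_fun_fubini_tonelli_F (m2 := m2) _ mn (funeneg_ge0 _).
  rewrite (_ : (fun x => _) = fubini_F m2 (EFin \o f)^\-%E) //.
  apply/funext => x; apply: eq_integral => y _; by rewrite !funenegE.
Qed.

Lemma integrable_prod (f : T1 -> R) (g : T2 -> R) :
  m1.-integrable setT (EFin \o f) -> m2.-integrable setT (EFin \o g) ->
  (m1 \x m2)%E.-integrable setT (EFin \o (fun z => f z.1 * g z.2)).
Proof.
move=> fi gi.
have mf : measurable_fun setT f by apply/measurable_EFinP; exact: measurable_int fi.
have mg : measurable_fun setT g by apply/measurable_EFinP; exact: measurable_int gi.
apply/integrable12ltyP.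
  apply/measurable_EFinP; apply: measurable_funM; exact: measurableT_comp.
under eq_integral.
  move=> x _ /=.
  under eq_integral do rewrite normrM EFinM.
  rewrite ge0_integralZl//; last by apply/measurable_EFinP; exact: measurableT_comp.
  over.
rewrite ge0_integralZr//; last first.
- exact: integral_ge0.
- by apply/measurable_EFinP; exact: measurableT_comp.
have /integrableP[_ h1] := fi; have /integrableP[_ h2] := gi.
by apply: lte_mul_pinfty => //; [exact: integral_ge0|rewrite ge0_fin_numE //; exact: integral_ge0].
Qed.

Lemma Rintegral_prod (f : T1 -> R) (g : T2 -> R) :
  m1.-integrable setT (EFin \o f) -> m2.-integrable setT (EFin \o g) ->
  \int[(m1 \x m2)%E]_z (f z.1 * g z.2) = (\int[m1]_x f x) * \int[m2]_y g y.
Proof.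
move=> fi gi; rewrite -Rintegral_fubini1 /=; last exact: integrable_prod.
under eq_Rintegral do rewrite RintegralZl//.
by rewrite RintegralZr.
Qed.

End Rint.

Section EFin_integrable.
Context d (T : measurableType d) (R : realType) (m : {measure set T -> \bar R}) (D : set T).
Hypothesis mD : measurable D.

Lemma integrableZl_EFin (k : R) (f : T -> R) : m.-integrable D (EFin \o f) ->
  m.-integrable D (EFin \o (fun x => k * f x)).
Proof. by move=> fi; exact: (integrableZl mD k fi). Qed.

Lemma integrableD_EFin (f g : T -> R) : m.-integrable D (EFin \o f) ->
  m.-integrable D (EFin \o g) -> m.-integrable D (EFin \o (fun x => f x + g x)).
Proof. by move=> fi gi; exact: (integrableD mD fi gi). Qed.

Lemma integrableB_EFin (f g : T -> R) : m.-integrable D (EFin \o f) ->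
  m.-integrable D (EFin \o g) -> m.-integrable D (EFin \o (fun x => f x - g x)).
Proof. by move=> fi gi; exact: (integrableB mD fi gi). Qed.

Lemma Rintegral_EFin (f : T -> R) : m.-integrable D (EFin \o f) ->
  (\int[m]_(x in D) (f x)%:E = (\int[m]_(x in D) f x)%:E)%E.
Proof. by move=> fi; rewrite /Rintegral fineK//; exact: integrable_fin_num. Qed.

End EFin_integrable.

Section rV.
Context {R : realType}.

Lemma measurable_ball_rV n (x : 'rV[R]_n) (r : R) : measurable (ball x r : set 'rV[R]_n).
Proof.
have [r0|r0] := ltP 0 r; last first.
  rewrite (_ : ball x r = set0) //; apply/seteqP; split => // y [].
  by rewrite ltNge r0.
have -> : (ball x r : set 'rV[R]_n) =
    \bigcap_(i in [set: 'I_n]) (rV_coord i @^-1` (ball (x 0 i) r)).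
  apply/seteqP; split => y /=.
    by move=> [_ h] i _; exact: h.
  by move=> h; split => // j i; rewrite (ord1 j); exact: (h i I).
apply: fin_bigcap_measurable => // i _; rewrite -[_ @^-1` _]setTI.
by apply: measurable_rV_coord => //; exact: measurable_ball.
Qed.

(** The sigma-algebra is generated by the coordinates, so this is second countability: max-norm
    balls are cubes, and those with rational centre and radius suffice. *)
Lemma open_measurable_rV n (U : set 'rV[R]_n) : open U -> measurable U.
Proof.
move=> oU.
pose q (p : 'rV[rat]_n * rat) : set 'rV[R]_n := ball (map_mx ratr p.1 : 'rV[R]_n) (ratr p.2).
rewrite (_ : U = \bigcup_(p in [set p | q p `<=` U]) q p).
  rewrite bigcup_mkcond; apply: countable_bigcupT_measurable => [|p].
    exact: countableP.
  by case: ifP => // _; exact: measurable_ball_rV.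
apply/seteqP; split => [x Ux|x [p /= pU]]; last exact: pU.
have /nbhs_ballP[e /= e0 eU] : nbhs x U by exact: open_nbhs_nbhs.
have [r r0 re] : exists2 r : rat, 0 < ratr r :> R & ratr r < e / 2.
  have /rat_in_itvoo[r] : 0 < e / 2 by rewrite divr_gt0.
  by rewrite in_itv/= => /andP[? ?]; exists r.
have h (i : 'I_n) : exists y : rat, ball (x 0 i) (ratr r) (ratr y : R).
  have /rat_in_itvoo[y] : x 0 i - ratr r < x 0 i + ratr r by lra.
  rewrite in_itv/= => /andP[? ?]; exists y.
  by rewrite /ball/= ltr_norml; apply/andP; split; lra.
have [y yP] := choice h.
exists (\row_i y i, r) => /=.
  move=> z; rewrite /q /= => qz; apply: eU.
  apply: (@le_ball _ _ _ (ratr r + ratr r)); first by lra.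
  apply: ball_triangle qz.
  by split => // j i; rewrite (ord1 j) !mxE; exact: yP.
split => // j i; rewrite (ord1 j) !mxE; apply: ball_sym; exact: yP.
Qed.

Lemma continuous_measurable_rV n (f : 'rV[R]_n -> R) : continuous f -> measurable_fun setT f.
Proof.
move=> cf; apply: (measurability _ (RGenOpens.measurableE R)).
move=> _ [_ [a [b ->]] <-]; rewrite setTI; apply: open_measurable_rV.
by apply: open_comp => // x _; exact: cf.
Qed.

Lemma measurable_dotrV n (b : 'rV[R]_n) : measurable_fun setT (dotrV b).
Proof.
apply: measurable_sum => i; apply: measurable_funM => //.
exact: measurable_rV_coord.
Qed.

Lemma measurable_enorm n : measurable_fun setT (@enorm R n).
Proof.
rewrite /enorm; apply: (measurableT_comp (continuous_measurable_fun (@sqrt_continuous R))) => //.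
apply: measurable_sum => i; apply: measurable_funM => //; exact: measurable_rV_coord.
Qed.

Lemma ge0_integral_lebesgue_rVS n (f : 'rV[R]_n.+1 -> \bar R) :
  measurable_fun setT f -> (forall x, 0 <= f x)%E ->
  (\int[lebesgue_rV n.+1]_x f x =
   \int[@lebesgue_measure R]_a \int[lebesgue_rV n]_x f (cons_rV (a, x)))%E.
Proof.
move=> mf f0 /=; rewrite /lebesgue_cons.
rewrite (ge0_integral_pushforward (@measurable_cons_rV R n)) // preimage_setT.
rewrite fubini_tonelli1//; last by move=> x; exact: f0.
by apply: measurableT_comp => //; exact: measurable_cons_rV.
Qed.

Lemma integrable_cons_rV n (f : 'rV[R]_n.+1 -> R) :
  (lebesgue_rV n.+1).-integrable setT (EFin \o f) ->
  (@lebesgue_measure R \x lebesgue_rV n)%E.-integrable setT (EFin \o (f \o @cons_rV R n)).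
Proof.
move=> fi.
have mf : measurable_fun setT f by apply/measurable_EFinP; exact: measurable_int fi.
have mfc : measurable_fun setT (f \o @cons_rV R n).
  by apply: measurableT_comp => //; exact: measurable_cons_rV.
apply/integrableP; split; first exact/measurable_EFinP.
have /integrableP[_] := fi.
rewrite /= /lebesgue_cons (ge0_integral_pushforward (@measurable_cons_rV R n)) //.
by apply/measurable_EFinP/measurableT_comp.
Qed.

Lemma Rintegral_lebesgue_rVS n (f : 'rV[R]_n.+1 -> R) :
  (lebesgue_rV n.+1).-integrable setT (EFin \o f) ->
  \int[lebesgue_rV n.+1]_x f x =
  \int[(@lebesgue_measure R \x lebesgue_rV n)%E]_z f (cons_rV z).
Proof.
move=> fi.
have mf : measurable_fun setT f by apply/measurable_EFinP; exact: measurable_int fi.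
rewrite /Rintegral /= /lebesgue_cons; congr fine.
rewrite (integral_pushforward (@measurable_cons_rV R n)) //.
  exact/measurable_EFinP.
by rewrite preimage_setT; exact: integrable_cons_rV.
Qed.

Lemma ge0_integral_rV_prod n (F : 'I_n -> R -> R) :
  (forall i, measurable_fun setT (F i)) -> (forall i x, 0 <= F i x) ->
  (\int[lebesgue_rV n]_x (\prod_(i < n) F i (x 0 i))%:E =
   \prod_(i < n) \int[@lebesgue_measure R]_a (F i a)%:E)%E.
Proof.
elim: n F => [|n IH] F mF F0.
  rewrite big_ord0; under eq_integral do rewrite big_ord0.
  by rewrite integral_cst //= diracT mul1e.
have mprod k (G : 'I_k -> R -> R) : (forall i, measurable_fun setT (G i)) ->
    measurable_fun setT (fun x : 'rV[R]_k => \prod_(i < k) G i (x 0 i)).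
  move=> mG; apply: measurable_prod => i _; apply: measurableT_comp => //.
  exact: measurable_rV_coord.
rewrite ge0_integral_lebesgue_rVS; first last.
- by move=> x; rewrite lee_fin prodr_ge0.
- by apply/measurable_EFinP; exact: mprod.
rewrite big_ord_recl -IH //.
have mP : measurable_fun setT (fun x : 'rV[R]_n => (\prod_(i < n) F (lift ord0 i) (x 0 i))%:E).
  apply/measurable_EFinP; apply: (mprod n (fun i => F (lift ord0 i))) => i.
  exact: mF.
have P0 x : (0 <= (\prod_(i < n) F (lift ord0 i) ((x : 'rV[R]_n) 0 i))%:E)%E.
  by rewrite lee_fin prodr_ge0.
rewrite -ge0_integralZr//; first last.
- by apply: integral_ge0 => x _.
- by move=> x _; rewrite lee_fin.
- by apply/measurable_EFinP; exact: mF.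
apply: eq_integral => a _; rewrite -ge0_integralZl//; last by rewrite lee_fin.
apply: eq_integral => x _; rewrite big_ord_recl cons_rV0 -EFinM; congr (_ * _)%:E.
by apply: eq_bigr => i _; rewrite cons_rVS.
Qed.

Definition gauss_rV n (s : R) (x : 'rV[R]_n) : R := \prod_(i < n) normal_pdf 0 s (x 0 i).

Lemma gauss_rV_ge0 n s (x : 'rV[R]_n) : 0 <= gauss_rV s x.
Proof. by apply: prodr_ge0 => i _; exact: normal_pdf_ge0. Qed.

Lemma measurable_gauss_rV n s : measurable_fun setT (@gauss_rV n s).
Proof.
apply: measurable_prod => i _; apply: measurableT_comp => //.
  exact: measurable_normal_pdf.
exact: measurable_rV_coord.
Qed.

Lemma integral_gauss_rV n s : (\int[lebesgue_rV n]_x (gauss_rV s x)%:E = 1)%E.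
Proof.
rewrite /gauss_rV.
rewrite (@ge0_integral_rV_prod n (fun _ => normal_pdf 0 s)) //.
- by apply: big1 => i _; exact: integral_normal_pdf.
- by move=> _; exact: measurable_normal_pdf.
- by move=> _ x; exact: normal_pdf_ge0.
Qed.

Lemma integrable_gauss_rV n s : (lebesgue_rV n).-integrable setT (EFin \o @gauss_rV n s).
Proof.
apply/integrableP; split; first by apply/measurable_EFinP; exact: measurable_gauss_rV.
under eq_integral do rewrite /= ger0_norm ?gauss_rV_ge0//.
by rewrite integral_gauss_rV ltry.
Qed.

(** The product form suits Fubini; this radial form is what makes the density compatible with
    rotations and dilations. *)
Lemma gauss_rVE n s (x : 'rV[R]_n) : s != 0 ->
  gauss_rV s x = normal_peak s ^+ n * expR (- (dotrV x x / (s ^+ 2 *+ 2))).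
Proof.
move=> s0; rewrite /gauss_rV.
under eq_bigr do rewrite normal_pdfE // /normal_fun.
rewrite big_split /= prodr_const card_ord -expR_sum; congr (_ * expR _).
rewrite /dotrV mulr_suml -sumrN; apply: eq_bigr => i _.
by rewrite subr0 expr2 mulNr.
Qed.

Lemma dotrV_cons n (b : 'rV[R]_n.+1) (z : measurableTypeR R * 'rV[R]_n) :
  dotrV b (cons_rV z) = b 0 0 * z.1 + dotrV (\row_i b 0 (lift 0 i)) z.2.
Proof.
rewrite /dotrV big_ord_recl cons_rV0; congr (_ + _).
by apply: eq_bigr => i _; rewrite cons_rVS mxE.
Qed.

Lemma gauss_rV_cons n s (z : measurableTypeR R * 'rV[R]_n) :
  gauss_rV s (cons_rV z) = normal_pdf 0 s z.1 * gauss_rV s z.2.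
Proof.
rewrite /gauss_rV big_ord_recl cons_rV0; congr (_ * _).
by apply: eq_bigr => i _; rewrite cons_rVS.
Qed.

Lemma integrable_mul_bounded d (T : measurableType d) (m : {measure set T -> \bar R}) (f g : T -> R) :
  m.-integrable setT (EFin \o f) -> measurable_fun setT g -> (forall x, `|g x| <= 1) ->
  m.-integrable setT (EFin \o (fun x => f x * g x)).
Proof.
move=> fi mg g1.
have mf : measurable_fun setT f by apply/measurable_EFinP; exact: measurable_int fi.
apply: le_integrable fi => //.
  by apply/measurable_EFinP; exact: measurable_funM.
by move=> x _; rewrite /= lee_fin normrM ler_piMr.
Qed.

Lemma normr_cos_le1 (x : R) : `|cos x| <= 1.
Proof. by rewrite ler_norml cos_geN1 cos_le1. Qed.

Lemma normr_sin_le1 (x : R) : `|sin x| <= 1.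
Proof. by rewrite ler_norml sin_geN1 sin_le1. Qed.

Lemma measurable_cos : measurable_fun setT (@cos R).
Proof. exact: continuous_measurable_fun (@continuous_cos R). Qed.

Lemma measurable_sin : measurable_fun setT (@sin R).
Proof. exact: continuous_measurable_fun (@continuous_sin R). Qed.

(** Cosine and sine have to be carried together, since the addition formulas mix them in the
    induction on [n]. *)
Lemma gauss_rV_cf n (s : R) (b : 'rV[R]_n) : s != 0 ->
  \int[lebesgue_rV n]_x (gauss_rV s x * cos (dotrV b x)) = expR (- (s ^+ 2 * dotrV b b / 2))
  /\ \int[lebesgue_rV n]_x (gauss_rV s x * sin (dotrV b x)) = 0.
Proof.
move=> s0; elim: n b => [|n IH] b.
  have -> : dotrV b b = 0 by rewrite /dotrV big_ord0.
  rewrite mulr0 mul0r oppr0 expR0; split.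
    under eq_Rintegral.
      by move=> x _; rewrite /gauss_rV /dotrV !big_ord0 cos0 mulr1; over.
    rewrite /Rintegral integral_cst // mul1e [X in fine X](_ : _ = 1%E) //; exact: diracT.
  under eq_Rintegral.
    by move=> x _; rewrite /gauss_rV /dotrV !big_ord0 sin0 mulr0; over.
  by rewrite /Rintegral integral_cst // mul0e.
have ig : forall f : R -> R, measurable_fun setT f -> (forall x, `|f x| <= 1) ->
   forall k (b : 'rV[R]_k), (lebesgue_rV k).-integrable setT (EFin \o (fun x => gauss_rV s x * f (dotrV b x))).
  move=> f mf f1 k c; apply: integrable_mul_bounded => //; first exact: integrable_gauss_rV.
  by apply: measurableT_comp => //; exact: measurable_dotrV.
have ig1 : forall f : R -> R, measurable_fun setT f -> (forall x, `|f x| <= 1) ->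
   forall c : R, (@lebesgue_measure R).-integrable setT (EFin \o (fun x => normal_pdf 0 s x * f (c * x))).
  move=> f mf f1 c; apply: integrable_mul_bounded => //; first exact: integrable_normal_pdf.
  by apply: measurableT_comp => //; exact: mulrl_measurable.
have C1 := ig _ measurable_cos normr_cos_le1.
have S1 := ig _ measurable_sin normr_sin_le1.
have C2 := ig1 _ measurable_cos normr_cos_le1.
have S2 := ig1 _ measurable_sin normr_sin_le1.
pose b' : 'rV[R]_n := \row_i b 0 (lift 0 i).
have [IHc IHs] := IH b'.
have [Nc Ns] := normal_pdf_cf (b 0 0) s0.
rewrite !Rintegral_lebesgue_rVS; [|exact: S1|exact: C1].
have mixB (p q u v x y : R) : p * q * (u * v - x * y) = p * u * (q * v) - p * x * (q * y) by ring.
have mixD (p q u v x y : R) : p * q * (u * v + x * y) = p * u * (q * v) + p * x * (q * y) by ring.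
under eq_Rintegral do rewrite gauss_rV_cons dotrV_cons -/b' cosD mixB.
under [X in _ /\ X = _]eq_Rintegral do rewrite gauss_rV_cons dotrV_cons -/b' sinD mixD.
have P (f g : R -> R) (k1 : measurable_fun setT f) (k2 : forall x, `|f x| <= 1)
  (k3 : measurable_fun setT g) (k4 : forall x, `|g x| <= 1) :=
   (integrable_prod (ig1 _ k1 k2 (b 0 0)) (ig _ k3 k4 _ b'), Rintegral_prod (ig1 _ k1 k2 (b 0 0)) (ig _ k3 k4 _ b')).
have [Pcc Ecc] := P _ _ measurable_cos normr_cos_le1 measurable_cos normr_cos_le1.
have [Pss Ess] := P _ _ measurable_sin normr_sin_le1 measurable_sin normr_sin_le1.
have [Pcs Ecs] := P _ _ measurable_cos normr_cos_le1 measurable_sin normr_sin_le1.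
have [Psc Esc] := P _ _ measurable_sin normr_sin_le1 measurable_cos normr_cos_le1.
rewrite RintegralB // RintegralD // Ecc Ess Ecs Esc Nc Ns IHc IHs !mul0r !mulr0 addr0 subr0; split => //.
rewrite -expRD; congr expR.
have -> : dotrV b b = b 0 0 ^+ 2 + dotrV b' b'.
  by rewrite /dotrV big_ord_recl expr2; congr (_ + _); apply: eq_bigr => i _; rewrite mxE.
by field.
Qed.
End rV.

(** * Uniqueness of characteristic functions *)

Definition orthant {R : realType} n (c : 'rV[R]_n) : set 'rV[R]_n :=
  [set x | forall i, (x 0 i <= c 0 i)%R].

Section cf.
Context {R : realType} d {T : measurableType d} (m : {sigma_finite_measure set T -> \bar R}).
Context n (X : T -> 'rV[R]_n) (f : T -> R).
Hypothesis mX : measurable_fun setT X.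
Hypothesis fi : m.-integrable setT (EFin \o f).

Lemma dotrVC k (x y : 'rV[R]_k) : dotrV x y = dotrV y x.
Proof. by apply: eq_bigr => i _; rewrite mulrC. Qed.

Lemma dotrVBl k (x y z : 'rV[R]_k) : dotrV (x - y) z = dotrV x z - dotrV y z.
Proof. by rewrite /dotrV -sumrB; apply: eq_bigr => i _; rewrite !mxE mulrBl. Qed.

Lemma measurable_dotrV2 d' (T' : measurableType d') (x y : T' -> 'rV[R]_n) :
  measurable_fun setT x -> measurable_fun setT y -> measurable_fun setT (fun t => dotrV (x t) (y t)).
Proof.
move=> mx my; apply: measurable_sum => i; apply: measurable_funM.
  exact: (measurableT_comp (measurable_rV_coord i) mx).
exact: (measurableT_comp (measurable_rV_coord i) my).
Qed.

(** Fubini, once the exponential on the left is written as the characteristic function of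
    [gauss_rV s] at [y - X t]. The right-hand side sees [f] and [X] only through their cosine and
    sine integrals. *)
Lemma gauss_smoothing (s : R) (y : 'rV[R]_n) : s != 0 ->
  \int[m]_t (f t * expR (- (s ^+ 2 * dotrV (y - X t) (y - X t) / 2))) =
  \int[lebesgue_rV n]_b (gauss_rV s b *
    (cos (dotrV b y) * (\int[m]_t (f t * cos (dotrV b (X t)))) +
     sin (dotrV b y) * (\int[m]_t (f t * sin (dotrV b (X t)))))).
Proof.
move=> s0.
have mf : measurable_fun setT f by apply/measurable_EFinP; exact: measurable_int fi.
have mXf : measurable_fun setT (fun z : T * 'rV[R]_n => X z.1) by apply: measurableT_comp.
have mD : measurable_fun setT (fun z : T * 'rV[R]_n => dotrV (y - X z.1) z.2).
  under eq_fun do rewrite dotrVBl.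
  apply: measurable_funB; last exact: measurable_dotrV2.
  by apply: measurable_dotrV2 => //; exact: measurable_cst.
have I : (m \x lebesgue_rV n)%E.-integrable setT
    (EFin \o (fun z : T * 'rV[R]_n => (f z.1 * gauss_rV s z.2) * cos (dotrV (y - X z.1) z.2))).
  apply: integrable_mul_bounded; last by move=> z; exact: normr_cos_le1.
    exact: (integrable_prod fi (integrable_gauss_rV n s)).
  by apply: measurableT_comp => //; exact: measurable_cos.
transitivity (\int[m]_t \int[lebesgue_rV n]_b ((f t * gauss_rV s b) * cos (dotrV (y - X t) b))).
  apply: eq_Rintegral => t _.
  under eq_Rintegral do rewrite -mulrA.
  rewrite RintegralZl//; first by rewrite (gauss_rV_cf _ s0).1.
  apply: integrable_mul_bounded; first exact: integrable_gauss_rV.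
    by apply: measurableT_comp; [exact: measurable_cos|exact: measurable_dotrV].
  by move=> x; exact: normr_cos_le1.
rewrite (Rintegral_fubini1 I) -(Rintegral_fubini2 I) /=.
apply: eq_Rintegral => b _.
have iC : m.-integrable setT (EFin \o (fun t => f t * cos (dotrV b (X t)))).
  apply: integrable_mul_bounded => //; last by move=> x; exact: normr_cos_le1.
  apply: measurableT_comp; first exact: measurable_cos.
  by apply: measurable_dotrV2 => //; exact: measurable_cst.
have iS : m.-integrable setT (EFin \o (fun t => f t * sin (dotrV b (X t)))).
  apply: integrable_mul_bounded => //; last by move=> x; exact: normr_sin_le1.
  apply: measurableT_comp; first exact: measurable_sin.
  by apply: measurable_dotrV2 => //; exact: measurable_cst.
under eq_Rintegral.
  move=> t _; rewrite dotrVBl !(dotrVC _ b) cosB.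
  rewrite (_ : f t * _ * _ = (gauss_rV s b * cos (dotrV b y)) * (f t * cos (dotrV b (X t)))
    + (gauss_rV s b * sin (dotrV b y)) * (f t * sin (dotrV b (X t)))); last by ring.
  over.
rewrite RintegralD//; last 2 first.
- exact: integrableZl_EFin.
- exact: integrableZl_EFin.
by rewrite !RintegralZl// mulrDr !mulrA.
Qed.


Definition rayind (c x : R) : R := \1_(`]-oo, c]%classic) x.

(** As a function of [y]: the density of [x] plus independent centered Gaussian noise of deviation
    [e], cut to the orthant below [c]. *)
Let box_kernel (e : R) (c x y : 'rV[R]_n) : R :=
  \prod_(i < n) (rayind (c 0 i) (y 0 i) * normal_pdf (x 0 i) e (y 0 i)).

Let box_kernel_ge0 e c x y : 0 <= box_kernel e c x y.
Proof. by apply: prodr_ge0 => i _; rewrite mulr_ge0 ?normal_pdf_ge0. Qed.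

Let fin_normal (x e c : R) : (fine (normal_prob x e `]-oo, c]%classic))%:E = normal_prob x e `]-oo, c]%classic.
Proof. by rewrite fineK// fin_num_measure//. Qed.

Let integral_box_kernel e c x : (\int[lebesgue_rV n]_y (box_kernel e c x y)%:E =
  (\prod_(i < n) fine (normal_prob (x 0 i) e `]-oo, c 0 i]%classic))%:E)%E.
Proof.
rewrite /box_kernel (@ge0_integral_rV_prod _ n (fun i y => rayind (c 0 i) y * normal_pdf (x 0 i) e y)).
- rewrite -prodEFin; apply: eq_bigr => i _; rewrite fin_normal /normal_prob.
  rewrite [RHS]integral_mkcond; apply: eq_integral => y _.
  rewrite patchE /rayind indicE; case: ifPn => _; last by rewrite mul0r.
  by rewrite mul1r.
- move=> i; apply: measurable_funM; last exact: measurable_normal_pdf.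
  by apply: measurable_indic.
- by move=> i y; rewrite mulr_ge0 ?normal_pdf_ge0.
Qed.

Let measurable_box_kernel e c : e != 0 ->
  measurable_fun setT (fun z : T * 'rV[R]_n => box_kernel e c (X z.1) z.2).
Proof.
move=> e0; apply: measurable_prod => i _.
have mz : measurable_fun setT (fun z : T * 'rV[R]_n => z.2 0 i).
  exact: (measurableT_comp (measurable_rV_coord i) measurable_snd).
have mx : measurable_fun setT (fun z : T * 'rV[R]_n => X z.1 0 i).
  apply: (measurableT_comp (measurable_rV_coord i)).
  exact: (measurableT_comp mX measurable_fst).
apply: measurable_funM.
  by apply: measurableT_comp => //; exact: measurable_indic.
under eq_fun => z do rewrite normal_pdfE// normal_fun_center.
rewrite -(_ : normal_pdf 0 e \o (fun z : T * 'rV[R]_n => z.2 0 i - X z.1 0 i) = (fun z => _)).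
  by apply: measurableT_comp; [exact: measurable_normal_pdf|exact: measurable_funB].
by apply/funext => z /=; rewrite normal_pdfE.
Qed.

Let box_kernelE e c x y : e != 0 -> box_kernel e c x y =
  ((\prod_(i < n) rayind (c 0 i) (y 0 i)) * normal_peak e ^+ n) *
  expR (- (e^-1 ^+ 2 * dotrV (y - x) (y - x) / 2)).
Proof.
move=> e0; rewrite /box_kernel big_split -mulrA; congr (_ * _).
under eq_bigr do rewrite normal_pdfE // /normal_fun.
rewrite big_split prodr_const card_ord -expR_sum /=; congr (_ * expR _).
rewrite /dotrV mulr_sumr mulr_suml -sumrN; apply: eq_bigr => i _.
by rewrite !mxE; field.
Qed.

Lemma normr_prod_le1 k (F : 'I_k -> R) : (forall i, 0 <= F i <= 1) -> `|\prod_(i < k) F i| <= 1.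
Proof.
move=> F01; suff /andP[h0 h1] : 0 <= \prod_(i < k) F i <= 1 by rewrite ger0_norm.
elim/big_ind : _ => [|x y /andP[x0 x1] /andP[y0 y1]|i _]; last exact: F01.
  by rewrite ler01 lexx.
by rewrite mulr_ge0//= mulr_ile1.
Qed.

Lemma normal01 (x e c : R) : 0 <= fine (normal_prob x e `]-oo, c]%classic) <= 1.
Proof. by rewrite fine_ge0//= -lee_fin fin_normal probability_le1. Qed.

Lemma measurable_boxprob (e : R) (c : 'rV[R]_n) : e != 0 ->
  measurable_fun setT (fun t => \prod_(i < n) fine (normal_prob (X t 0 i) e `]-oo, c 0 i]%classic)).
Proof.
move=> e0; rewrite (_ : (fun t => _) = fun t => \int[lebesgue_rV n]_y (box_kernel e c (X t) y)).
  exact: measurable_Rintegral (measurable_box_kernel c e0).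
by apply/funext => t; rewrite /Rintegral integral_box_kernel.
Qed.

(** Fubini in the noisy variable [y]. The inner integral is the left-hand side of [gauss_smoothing]
    at [s = e^-1], so the smoothed integral is also a function of the cosine and sine integrals. *)
Lemma box_smoothing (e : R) (c : 'rV[R]_n) : e != 0 ->
  \int[m]_t (f t * \prod_(i < n) fine (normal_prob (X t 0 i) e `]-oo, c 0 i]%classic)) =
  \int[lebesgue_rV n]_y (((\prod_(i < n) rayind (c 0 i) (y 0 i)) * normal_peak e ^+ n) *
    \int[m]_t (f t * expR (- (e^-1 ^+ 2 * dotrV (y - X t) (y - X t) / 2)))).
Proof.
move=> e0.
have mf : measurable_fun setT f by apply/measurable_EFinP; exact: measurable_int fi.
have mfz : measurable_fun setT (fun z : T * 'rV[R]_n => f z.1) by apply: measurableT_comp.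
have mK := measurable_box_kernel c e0.
have I : (m \x lebesgue_rV n)%E.-integrable setT
    (EFin \o (fun z : T * 'rV[R]_n => f z.1 * box_kernel e c (X z.1) z.2)).
  apply/integrable12ltyP; first by apply/measurable_EFinP; exact: measurable_funM.
  have /integrableP[_] := fi; apply: le_lt_trans; apply: ge0_le_integral => //.
  - by move=> t _; exact: integral_ge0.
  - apply: (measurable_fun_fubini_tonelli_F (m2 := lebesgue_rV n) (fun z => `|(f z.1 * box_kernel e c (X z.1) z.2)%:E|)%E) => //.
    by apply: measurableT_comp => //; apply/measurable_EFinP; exact: measurable_funM.
  - by apply: measurableT_comp => //; exact/measurable_EFinP.
  - move=> t _ /=.
    under eq_integral do rewrite normrM (ger0_norm (box_kernel_ge0 _ _ _ _)) EFinM.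
    rewrite ge0_integralZl//; last first.
    + by move=> y _; rewrite lee_fin.
    + by apply/measurable_EFinP; exact: (measurableT_comp mK (pair1_measurable t)).
    rewrite integral_box_kernel -EFinM lee_fin ler_piMr//.
    by apply: le_trans (ler_norm _) _; apply: normr_prod_le1 => i; exact: normal01.
transitivity (\int[m]_t \int[lebesgue_rV n]_y (f t * box_kernel e c (X t) y)).
  apply: eq_Rintegral => t _; rewrite RintegralZl//.
    by rewrite [in RHS]/Rintegral integral_box_kernel.
  apply/integrableP; split.
    by apply/measurable_EFinP; exact: (measurableT_comp mK (pair1_measurable t)).
  under eq_integral do rewrite /= (ger0_norm (box_kernel_ge0 _ _ _ _)).
  by rewrite integral_box_kernel ltry.
rewrite (Rintegral_fubini1 I) -(Rintegral_fubini2 I) /=.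
apply: eq_Rintegral => y _; rewrite -RintegralZl//.
  by apply: eq_Rintegral => t _; rewrite box_kernelE// mulrCA.
apply: integrable_mul_bounded => //.
  apply: measurableT_comp => //; apply: measurable_funN; apply: measurable_funM => //.
  apply: measurable_funM => //; apply: measurable_sum => i.
  have : measurable_fun setT (fun t => y 0 i - X t 0 i).
    by apply: measurable_funB => //; exact: (measurableT_comp (measurable_rV_coord i) mX).
  move=> h; under eq_fun do rewrite !mxE; exact: measurable_funM.
move=> t; rewrite ger0_norm ?expR_ge0// -expR0 ler_expR oppr_le0 divr_ge0// mulr_ge0 ?sqr_ge0//.
by apply: sumr_ge0 => i _; rewrite -expr2 sqr_ge0.
Qed.

(** Dominated convergence under [|f|]. Because the corner is shifted by more than the noise, the
    pointwise limit is exact on the boundary of the orthant too, which may carry mass. *)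
Lemma cvg_box (c : 'rV[R]_n) :
  (\int[m]_t (f t * \prod_(i < n) fine (normal_prob (X t 0%R i) (j.+1%:R^-1 ^+ 2)%R `]-oo, (c 0%R i + j.+1%:R^-1)%R]%classic))%:E)%E
     @[j --> \oo] --> (\int[m]_(t in X @^-1` (orthant c)) (f t)%:E)%E.
Proof.
have mf : measurable_fun setT f by apply/measurable_EFinP; exact: measurable_int fi.
have e0 j : (j.+1%:R^-1 ^+ 2 : R) != 0 by rewrite gt_eqF// exprn_gt0// invr_gt0.
rewrite integral_mkcond.
apply: (@dominated_cvg _ _ _ m _ measurableT _ _ (abse \o (EFin \o f))) => //.
- move=> j; apply/measurable_EFinP; apply: measurable_funM => //.
  have := measurable_boxprob (\row_i (c 0 i + j.+1%:R^-1)) (e0 j).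
  by under eq_fun do under eq_bigr do rewrite mxE.
- move=> t _.
  have -> : ((fun t => (f t)%:E) \_ (X @^-1` (orthant c))) t =
      (f t * \prod_(i < n) (if X t 0 i <= c 0 i then 1 else 0))%:E.
    rewrite patchE; case: ifPn => [/set_mem/= h|/negP h].
      by rewrite big1 ?mulr1// => i _; rewrite h.
    have /existsNP[i /negP hi] : ~ forall i, X t 0 i <= c 0 i.
      by move=> h'; apply: h; exact: mem_set.
    by rewrite (bigD1 i)//= (negPf hi) mul0r mulr0.
  apply: cvg_EFin; first by near=> j.
  apply: cvgM; first exact: cvg_cst.
  apply: cvg_big => [|i _]; first exact: mul_continuous.
  rewrite -[X in _ --> X]/(fine (if X t 0 i <= c 0 i then 1 else 0)%:E).
  apply: fine_cvg.
  have := @cvg_normal_prob_ray R (X t 0 i) (c 0 i); by case: ifP.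
- exact: integrable_abse.
- move=> j t _; rewrite /= lee_fin normrM ler_piMr//.
  by apply: normr_prod_le1 => i; exact: normal01.
Unshelve. all: by end_near. Qed.

End cf.

Lemma measurable_rV_orthants {R : realType} (n : nat) : @measurable _ 'rV[R]_n =
  <<s [set A | exists c : 'rV[R]_n, A = orthant c] >>.
Proof.
set G := [set A | _].
apply/seteqP; split; last first.
  apply: smallest_sub; first exact: sigma_algebra_measurable.
  move=> _ [c ->]; rewrite (_ : orthant c = \bigcap_(i in [set: 'I_n]) (rV_coord i @^-1` `]-oo, c 0 i]%classic)).
    apply: fin_bigcap_measurable => // i _; rewrite -[_ @^-1` _]setTI.
    exact: measurable_rV_coord.
  apply/seteqP; split => x /= h i; first by move=> _ /=; rewrite in_itv/=; exact: h.
  by have := h i I; rewrite /= in_itv.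
pose T' := g_sigma_algebraType G.
suff mid : measurable_fun setT ((fun x => x) : T' -> 'rV[R]_n).
  by move=> A mA; have := mid measurableT A mA; rewrite setTI.
apply: measurable_fun_rV => i; apply: (measurability _ (RGenOInfty.measurableE R)).
move=> _ [_ [a ->] <-]; rewrite setTI -[X in measurable X]setCK; apply: measurableC.
(* The half-space [x 0 i <= a] is exhausted by orthants whose other coordinates are at most [N]. *)
rewrite (_ : ~` _ = \bigcup_N ([set x | forall j, (x 0 j <= if j == i then a else N%:R)%R] : set T')).
  apply: bigcupT_measurable => N; apply: sub_sigma_algebra.
  by exists (\row_j (if j == i then a else N%:R)); apply/seteqP; split => x /= h j; have := h j; rewrite !mxE.
apply/seteqP; split => x /=.
  rewrite in_itv/= andbT => /negP; rewrite -leNgt => xa.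
  exists (\max_(j < n) (Num.truncn `|rV_coord j x|).+1)%N => // j; case: eqP => [->//|_].
  apply: (le_trans (ler_norm _)); apply: ltW; apply: lt_le_trans (truncnS_gt _) _.
  by rewrite ler_nat (leq_bigmax (F := fun j => (Num.truncn `|rV_coord j x|).+1)).
by move=> [N _ /(_ i)]; rewrite eqxx in_itv/= andbT => h; apply/negP; rewrite -leNgt.
Qed.

Lemma trivIset_preimage (aT rT : Type) (f : aT -> rT) (F : (set rT)^nat) :
  trivIset setT F -> trivIset setT (fun i => f @^-1` F i).
Proof.
move=> /trivIsetP tF; apply/trivIsetP => i j _ _ ij.
by rewrite -preimage_setI tF// preimage_set0.
Qed.

Section cf_unique.
Context {R : realType} {n : nat}.
Context d1 {T1 : measurableType d1} (m1 : {sigma_finite_measure set T1 -> \bar R}).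
Context d2 {T2 : measurableType d2} (m2 : {sigma_finite_measure set T2 -> \bar R}).
Context (X1 : T1 -> 'rV[R]_n) (f1 : T1 -> R) (X2 : T2 -> 'rV[R]_n) (f2 : T2 -> R).
Hypothesis mX1 : measurable_fun setT X1.
Hypothesis mX2 : measurable_fun setT X2.
Hypothesis fi1 : m1.-integrable setT (EFin \o f1).
Hypothesis fi2 : m2.-integrable setT (EFin \o f2).
Hypothesis eq_cos : forall b, \int[m1]_t (f1 t * cos (dotrV b (X1 t))) =
  \int[m2]_t (f2 t * cos (dotrV b (X2 t))).
Hypothesis eq_sin : forall b, \int[m1]_t (f1 t * sin (dotrV b (X1 t))) =
  \int[m2]_t (f2 t * sin (dotrV b (X2 t))).

(** Each side is the limit of smoothed integrals, and for every fixed smoothing these are one and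
    the same expression in the cosine and sine integrals. *)
Let eq_orthant (c : 'rV[R]_n) :
  (\int[m1]_(t in X1 @^-1` (orthant c)) (f1 t)%:E =
   \int[m2]_(t in X2 @^-1` (orthant c)) (f2 t)%:E)%E.
Proof.
have c1 := @cvg_box _ _ _ m1 _ _ _ mX1 fi1 c; have c2 := @cvg_box _ _ _ m2 _ _ _ mX2 fi2 c.
rewrite -(cvg_lim _ c1)// -(cvg_lim _ c2)//; apply: congr_lim; apply/funext => j.
have e0 : (j.+1%:R^-1 ^+ 2 : R) != 0 by rewrite gt_eqF// exprn_gt0// invr_gt0.
have bs d (T : measurableType d) (m : {sigma_finite_measure set T -> \bar R})
   (X : T -> 'rV[R]_n) (f : T -> R) (mX : measurable_fun setT X) (fi : m.-integrable setT (EFin \o f)) :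
  (\int[m]_t (f t * \prod_(i < n) fine (normal_prob (X t 0%R i) (j.+1%:R^-1 ^+ 2)%R `]-oo, (c 0%R i + j.+1%:R^-1)%R]%classic))%:E)%E =
  (\int[lebesgue_rV n]_y (((\prod_(i < n) rayind (c 0 i + j.+1%:R^-1) (y 0 i)) * normal_peak (j.+1%:R^-1 ^+ 2) ^+ n) *
    \int[lebesgue_rV n]_b (gauss_rV ((j.+1%:R^-1 ^+ 2)^-1) b *
    (cos (dotrV b y) * (\int[m]_t (f t * cos (dotrV b (X t)))) +
     sin (dotrV b y) * (\int[m]_t (f t * sin (dotrV b (X t))))))))%:E.
  rewrite Rintegral_EFin//.
    have := box_smoothing mX fi (\row_i (c 0 i + j.+1%:R^-1)) e0.
    under eq_Rintegral do under eq_bigr do rewrite mxE.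
    move=> ->; congr EFin; apply: eq_Rintegral => y _.
    rewrite gauss_smoothing ?invr_eq0//; congr (_ * _ * _).
    by apply: eq_bigr => i _; rewrite mxE.
  apply: integrable_mul_bounded => //.
    have := measurable_boxprob mX (\row_i (c 0 i + j.+1%:R^-1)) e0.
    by under eq_fun do under eq_bigr do rewrite mxE.
  by move=> t; apply: normr_prod_le1 => i; exact: normal01.
apply: etrans (bs _ _ _ _ _ mX1 fi1) _; apply: etrans (esym (bs _ _ _ _ _ mX2 fi2)).
apply: (congr1 EFin).
apply: eq_Rintegral => y _; congr (_ * _); apply: eq_Rintegral => b _.
by rewrite eq_cos eq_sin.
Qed.

(** Dynkin's argument starting from the orthants, which are stable under intersection. Integrability
    of the signed densities replaces finiteness of measures: complements go by subtraction, disjoint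
    unions by countable additivity of the integral. *)
Theorem cf_unique (B : set 'rV[R]_n) : measurable B ->
  (\int[m1]_(t in X1 @^-1` B) (f1 t)%:E = \int[m2]_(t in X2 @^-1` B) (f2 t)%:E)%E.
Proof.
move=> mB.
have mpre d (T : measurableType d) (X : T -> 'rV[R]_n) (mX : measurable_fun setT X)
    (S : set 'rV[R]_n) : measurable S -> measurable (X @^-1` S).
  by move=> mS; rewrite -[_ @^-1` _]setTI; exact: mX.
(* The total integrals, from which complements subtract, agree by the case [b = 0]. *)
have eqT : (\int[m1]_t (f1 t)%:E = \int[m2]_t (f2 t)%:E)%E.
  rewrite !Rintegral_EFin//; congr EFin; have := eq_cos 0.
  have d0 x : dotrV (0 : 'rV[R]_n) x = 0.
    by rewrite /dotrV big1// => i _; rewrite mxE mul0r.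
  under eq_Rintegral do rewrite d0 cos0 mulr1.
  by under [X in _ = X -> _]eq_Rintegral do rewrite d0 cos0 mulr1.
have intS d (T : measurableType d) (m : {sigma_finite_measure set T -> \bar R}) (f : T -> R) (A : set T) :
   m.-integrable setT (EFin \o f) -> measurable A -> m.-integrable A (EFin \o f).
  by move=> fi mA; apply: (integrableS measurableT mA) => //.
have compl d (T : measurableType d) (m : {sigma_finite_measure set T -> \bar R}) (f : T -> R) (A : set T) :
   m.-integrable setT (EFin \o f) -> measurable A ->
   (\int[m]_(x in ~` A) (f x)%:E = \int[m]_x (f x)%:E - \int[m]_(x in A) (f x)%:E)%E.
  move=> fi mA; have mCA : measurable (~` A) by exact: measurableC.
  rewrite -(setvU A) integral_setU//=.
  - by rewrite addeK//; apply: integrable_fin_num => //; exact: intS.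
  - by rewrite setvU; exact: measurable_int fi.
  - by apply/disj_setPS => x [].
move: B mB; rewrite measurable_rV_orthants.
apply: (@dynkin_induction _ _ _ (fun B => (\int[m1]_(t in X1 @^-1` B) (f1 t)%:E = \int[m2]_(t in X2 @^-1` B) (f2 t)%:E)%E) (@measurable_rV_orthants R n)).
- move=> _ _ [c1 ->] [c2 ->]; exists (\row_i Num.min (c1 0 i) (c2 0 i)).
  apply/seteqP; split => x /=.
    by move=> [h1 h2] i; rewrite mxE le_min h1 h2.
  by move=> h; split => i; have := h i; rewrite mxE le_min => /andP[].
- by rewrite !preimage_setT.
- by move=> _ [c ->]; exact: eq_orthant.
- move=> S mS e; rewrite -!preimage_setC.
  by rewrite !compl// ?eqT ?e//; exact: mpre.
- move=> F mF tF eF; rewrite !preimage_bigcup !integral_bigcup//=.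
  + by apply: congr_lim; apply/funext => k; apply: eq_bigr => i _; exact: eF.
  + exact: trivIset_preimage.
  + by move=> k; exact: mpre.
  + apply: intS => //; apply: bigcupT_measurable => k; exact: mpre.
  + exact: trivIset_preimage.
  + by move=> k; exact: mpre.
  + apply: intS => //; apply: bigcupT_measurable => k; exact: mpre.
Qed.
End cf_unique.

(** * Rotations and dilations *)

Section dotrV.
Context {R : realType}.

Lemma dotrV_mx n (x y : 'rV[R]_n) : dotrV x y = (x *m y^T) 0 0.
Proof. by rewrite mxE; apply: eq_bigr => i _; rewrite !mxE. Qed.

Lemma dotrV_mulmx n k (b : 'rV[R]_n) (x : 'rV[R]_k) (A : 'M[R]_(k, n)) :
  dotrV b (x *m A) = dotrV (b *m A^T) x.
Proof. by rewrite !dotrV_mx trmx_mul mulmxA. Qed.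

Lemma dotrV_ge0 n (x : 'rV[R]_n) : 0 <= dotrV x x.
Proof. by apply: sumr_ge0 => i _; rewrite -expr2 sqr_ge0. Qed.

Lemma dotrVDr n (x y z : 'rV[R]_n) : dotrV x (y + z) = dotrV x y + dotrV x z.
Proof. by rewrite !dotrV_mx linearD mulmxDr mxE. Qed.

Lemma dotrVDl n (x y z : 'rV[R]_n) : dotrV (y + z) x = dotrV y x + dotrV z x.
Proof. by rewrite !(dotrVC _ x) dotrVDr. Qed.

Lemma dotrVZr n (a : R) (x y : 'rV[R]_n) : dotrV x (a *: y) = a * dotrV x y.
Proof. by rewrite !dotrV_mx linearZ /= -scalemxAr mxE. Qed.

Lemma dotrVZl n (a : R) (x y : 'rV[R]_n) : dotrV (a *: x) y = a * dotrV x y.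
Proof. by rewrite !(dotrVC _ y) dotrVZr. Qed.

Lemma sqr_enorm n (x : 'rV[R]_n) : enorm x ^+ 2 = dotrV x x.
Proof. by rewrite sqr_sqrtr// dotrV_ge0. Qed.

Lemma enorm_ge0 n (x : 'rV[R]_n) : 0 <= enorm x.
Proof. exact: sqrtr_ge0. Qed.

Lemma measurable_mulmx_rV n k (A : 'M[R]_(k, n)) :
  measurable_fun setT (fun x : 'rV[R]_k => x *m A).
Proof.
apply: measurable_fun_rV => i.
rewrite (_ : _ \o _ = fun x : 'rV[R]_k => \sum_j x 0 j * A j i); last first.
  by apply/funext => x /=; rewrite /rV_coord mxE.
by apply: measurable_sum => j; apply: measurable_funM => //; exact: measurable_rV_coord.
Qed.

Lemma measurable_addrV n d (T : measurableType d) (f g : T -> 'rV[R]_n) :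
  measurable_fun setT f -> measurable_fun setT g -> measurable_fun setT (fun t => f t + g t).
Proof.
move=> mf mg; apply: measurable_fun_rV => i.
rewrite (_ : _ \o _ = fun t => f t 0 i + g t 0 i); last first.
  by apply/funext => x /=; rewrite /rV_coord mxE.
by apply: measurable_funD; [exact: (measurableT_comp (measurable_rV_coord i) mf)|exact: (measurableT_comp (measurable_rV_coord i) mg)].
Qed.

Lemma measurable_scalerV n (a : R) : measurable_fun setT (fun x : 'rV[R]_n => a *: x).
Proof.
apply: measurable_fun_rV => i.
rewrite (_ : _ \o _ = fun x : 'rV[R]_n => a * x 0 i); last first.
  by apply/funext => x /=; rewrite /rV_coord mxE.
by apply: measurable_funM => //; exact: measurable_rV_coord.
Qed.

Lemma normal_peak_scale (s r : R) : s != 0 -> 0 < r -> normal_peak (s / r) = r * normal_peak s.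
Proof.
move=> s0 r0; rewrite /normal_peak.
rewrite (_ : (s / r) ^+ 2 * pi *+ 2 = (s ^+ 2 * pi *+ 2) * r^-1 ^+ 2); last by field; rewrite gt_eqF.
rewrite sqrtrM; last by rewrite mulrn_wge0// mulr_ge0 ?sqr_ge0 ?pi_ge0.
by rewrite sqrtr_sqr ger0_norm ?invr_ge0 ?(ltW r0)// invfM invrK mulrC.
Qed.

End dotrV.

Section gauss_pushforward.
Context {R : realType} {n : nat}.

Let E (j : nat) (x : 'rV[R]_n) : R := expR (- (dotrV x x / (j.+1%:R ^+ 2 *+ 2))).

(** The weights increase to 1, so monotone convergence applies, also when the limit is infinite. *)
Lemma cvg_gauss_weight d (T : measurableType d) (m : {measure set T -> \bar R}) (X : T -> 'rV[R]_n)
    (A : set T) (F : T -> R) :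
  measurable_fun setT X -> measurable A -> measurable_fun setT F -> (forall t, 0 <= F t) ->
  (\int[m]_(t in A) (F t * expR (- (dotrV (X t) (X t) / (j.+1%:R ^+ 2 *+ 2))))%:E)%E @[j --> \oo] -->
  (\int[m]_(t in A) (F t)%:E)%E.
Proof.
move=> mX mA mF F0.
have -> : (\int[m]_(t in A) (F t)%:E = \int[m]_(t in A) limn (fun j => (F t * E j (X t))%:E))%E.
  apply: eq_integral => t _; apply/esym/cvg_lim => //.
  apply: cvg_EFin; first by near=> j.
  rewrite -[X in _ --> X]mulr1; apply: cvgMr.
  suff h : - (dotrV (X t) (X t) / (j.+1%:R ^+ 2 *+ 2)) @[j --> \oo] --> (0 : R).
    by have := cvg_comp _ _ h (@continuous_expR R 0); rewrite expR0.
  rewrite -oppr0; apply: cvgN; rewrite -(mulr0 (dotrV (X t) (X t))); apply: cvgM; first exact: cvg_cst.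
  apply: (@cvg_norm_inv_bound _ _ 1) => j.
  rewrite ger0_norm ?invr_ge0 ?mulrn_wge0 ?sqr_ge0// ler_pdivrMr ?mul1r.
    by have := ler0n R j; rewrite -natr1 mulr2n; nra.
  by rewrite pmulrn_lgt0// exprn_gt0.
apply: cvg_monotone_convergence => //.
- move=> j; apply: measurable_funTS; apply/measurable_EFinP; apply: measurable_funM => //.
  rewrite /E; apply: measurableT_comp => //.
  apply: (measurable_funN (f := fun t => dotrV (X t) (X t) / _)).
  by apply: measurable_funM => //; exact: measurable_dotrV2.
- by move=> j t _; rewrite lee_fin mulr_ge0// expR_ge0.
- move=> t _ i j ij; rewrite lee_fin ler_wpM2l// ler_expR lerN2.
  rewrite ler_wpM2l ?dotrV_ge0// lef_pV2 ?posrE ?pmulrn_lgt0 ?exprn_gt0//.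
  by rewrite lerMn2r/= lerXn2r ?nnegrE// ler_nat.
Unshelve. all: by end_near. Qed.

Let cvg_mass d (T : measurableType d) (m : {measure set T -> \bar R}) (X : T -> 'rV[R]_n) (A : set T) :
  measurable_fun setT X -> measurable A ->
  (\int[m]_(t in A) (E j (X t))%:E)%E @[j --> \oo] --> m A.
Proof.
move=> mX mA; have := @cvg_gauss_weight _ _ m _ _ _ mX mA (@measurable_cst _ _ _ _ setT (1 : R)) (fun=> ler01).
have -> : (\int[m]_(t in A) (cst (1 : R) t)%:E = m A)%E by rewrite (integral_cst m mA 1) mul1e.
apply: cvg_trans; apply: near_eq_cvg; apply: nearW => j.
by apply: eq_integral => t _; rewrite /cst mul1r.
Qed.

(* The characteristic function identifies a measure whose weighting by every
   centered Gaussian is that Gaussian law; letting the variance grow removes the weight. *)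
Lemma gauss_pushforward d (T : measurableType d) (m : {sigma_finite_measure set T -> \bar R})
    (X : T -> 'rV[R]_n) (c : R) :
  measurable_fun setT X -> 0 <= c ->
  (forall s : R, 0 < s -> m.-integrable setT (EFin \o (fun t => c * gauss_rV s (X t)))) ->
  (forall (s : R) b, 0 < s -> \int[m]_t (c * gauss_rV s (X t) * cos (dotrV b (X t))) =
     expR (- (s ^+ 2 * dotrV b b / 2))) ->
  (forall (s : R) b, 0 < s -> \int[m]_t (c * gauss_rV s (X t) * sin (dotrV b (X t))) = 0) ->
  forall B, measurable B -> (c%:E * m (X @^-1` B) = lebesgue_rV n B)%E.
Proof.
move=> mX c0 ci cC cS B mB.
have mXB : measurable (X @^-1` B) by rewrite -[_ @^-1` _]setTI; exact: mX.
have EE j x : (E j x)%:E = ((normal_peak j.+1%:R ^+ n)^-1%:E * (gauss_rV j.+1%:R x)%:E)%E.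
  by rewrite gauss_rVE// -EFinM mulKf// gt_eqF// exprn_gt0// normal_peak_gt0.
have h j : (c%:E * \int[m]_(t in X @^-1` B) (E j (X t))%:E = \int[lebesgue_rV n]_(x in B) (E j x)%:E)%E.
  have s0 : 0 < j.+1%:R :> R by [].
  have := @cf_unique R n _ T m _ _ (lebesgue_rV n) X (fun t => c * gauss_rV j.+1%:R (X t)) id (gauss_rV j.+1%:R) mX (@measurable_id _ _ _) (ci _ s0) (integrable_gauss_rV n _).
  move=> /(_ _ _ B mB) U.
  have mg d' (T' : measurableType d') (Y : T' -> 'rV[R]_n) (A : set T') : measurable_fun setT Y -> measurable_fun A (fun t => (gauss_rV j.+1%:R (Y t))%:E).
    move=> mY; apply: measurable_funTS; apply/measurable_EFinP.
    by apply: measurableT_comp => //; exact: measurable_gauss_rV.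
  have pk0 : (0 <= (normal_peak j.+1%:R ^+ n)^-1%:E :> \bar R)%E.
    by rewrite lee_fin invr_ge0 exprn_ge0// normal_peak_ge0.
  under eq_integral do rewrite EE.
  rewrite ge0_integralZl//; last 2 first.
  - exact: mg.
  - by move=> t _; rewrite lee_fin gauss_rV_ge0.
  rewrite muleCA -ge0_integralZl//; last 2 first.
  - exact: mg.
  - by move=> t _; rewrite lee_fin gauss_rV_ge0.
  under [RHS]eq_integral do rewrite EE.
  rewrite [RHS]ge0_integralZl//; last 2 first.
  - exact: (mg _ _ id).
  - by move=> t _; rewrite lee_fin gauss_rV_ge0.
  congr (_ * _)%E; rewrite -[RHS]U//.
  - by move=> b; rewrite cC// (gauss_rV_cf b (lt0r_neq0 s0)).1.
  - by move=> b; rewrite cS// (gauss_rV_cf b (lt0r_neq0 s0)).2.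
have c1 := @cvg_mass _ _ (lebesgue_rV n) id B (@measurable_id _ _ _) mB.
have c2 := @cvg_mass _ _ m X (X @^-1` B) mX mXB.
have c3 : (c%:E * \int[m]_(t in X @^-1` B) (E j (X t))%:E)%E @[j --> \oo] --> (c%:E * m (X @^-1` B))%E.
  by apply: cvgeZl.
move: c3; under eq_fun do rewrite h.
by move=> c3; rewrite -(cvg_lim _ c3)// (cvg_lim _ c1).
Qed.

End gauss_pushforward.

Section eq_pushforward.
Context {R : realType} d1 d2 (T1 : measurableType d1) (T2 : measurableType d2).
Context (m1 : {measure set T1 -> \bar R}) (m2 : {measure set T2 -> \bar R}) (X : T1 -> T2).
Hypothesis mX : measurable_fun setT X.
Hypothesis m12 : forall B, measurable B -> m1 (X @^-1` B) = m2 B.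

Lemma ge0_integral_eq_pushforward (f : T2 -> \bar R) : measurable_fun setT f ->
  (forall x, 0 <= f x)%E -> (\int[m2]_x f x = \int[m1]_t f (X t))%E.
Proof.
move=> mf f0.
have E := ge0_integral_pushforward mX m1 measurableT mf (fun y _ => f0 y).
rewrite preimage_setT in E; rewrite -[RHS]E.
apply: eq_measure_integral => B mB _.
exact: esym (m12 mB).
Qed.

Lemma integrable_eq_pushforward (f : T2 -> R) : m2.-integrable setT (EFin \o f) ->
  m1.-integrable setT (EFin \o (f \o X)).
Proof.
move=> fi.
have mf : measurable_fun setT f by apply/measurable_EFinP; exact: measurable_int fi.
apply/integrableP; split; first by apply/measurable_EFinP; exact: measurableT_comp.
have /integrableP[_] := fi; rewrite ge0_integral_eq_pushforward//.
by apply: measurableT_comp => //; exact/measurable_EFinP.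
Qed.

Lemma Rintegral_eq_pushforward (f : T2 -> R) : measurable_fun setT f ->
  \int[m2]_x f x = \int[m1]_t f (X t).
Proof.
move=> mf; rewrite /Rintegral (integralE m2) (integralE m1); congr (fine (_ - _)%E).
  rewrite ge0_integral_eq_pushforward//.
    by apply: eq_integral => z _; rewrite !funeposE.
  by apply: measurable_funepos; exact/measurable_EFinP.
rewrite ge0_integral_eq_pushforward//.
  by apply: eq_integral => z _; rewrite !funenegE.
by apply: measurable_funeneg; exact/measurable_EFinP.
Qed.

End eq_pushforward.

Section product_sigma_finite.
Context {R : realType} d1 d2 (T1 : measurableType d1) (T2 : measurableType d2).
Context (m1 : {sigma_finite_measure set T1 -> \bar R}) (m2 : {sigma_finite_measure set T2 -> \bar R}).

Lemma product_measure_sigma_finite : sigma_finite setT (m1 \x m2)%E.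
Proof.
have /sigma_finiteP[F [FT ndF Foo]] := sigma_finiteT m1.
have /sigma_finiteP[G [GT ndG Goo]] := sigma_finiteT m2.
exists (fun i => F i `*` G i).
  rewrite -setXTT FT GT; apply/seteqP; split => [[x y] /= [[i _ Fx] [j _ Gy]]|[x y] [i _ [/= Fx Gy]]].
    by exists (maxn i j) => //; split => /=; [move: x Fx|move: y Gy]; apply/subsetPset;
      [exact/ndF/leq_maxl|exact/ndG/leq_maxr].
  by split; exists i.
move=> i; have [mF Fi] := Foo i; have [mG Gi] := Goo i; split; first exact: measurableX.
by rewrite product_measure1E// lte_mul_pinfty// ge0_fin_numE.
Qed.

(* The library's own instance on [m1 \x m2] is not found by unification. *)
Definition product_sf : {sigma_finite_measure set (T1 * T2)%type -> \bar R} :=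
  HB.pack_for {sigma_finite_measure set (T1 * T2)%type -> \bar R} (m1 \x m2)%E
    (Measure_isSigmaFinite.Build _ _ _ (m1 \x m2)%E product_measure_sigma_finite).

End product_sigma_finite.

(** * Lebesgue measure in orthonormal coordinates *)

Section isometry.
Context {R : realType} (k p n : nat) (A : 'M[R]_(k, n)) (K : 'M[R]_(p, n)).
Hypothesis kpn : (k + p = n)%N.
Hypothesis AA : A *m A^T = 1%:M.
Hypothesis KK : K *m K^T = 1%:M.
Hypothesis AK : A *m K^T = 0.
Hypothesis AKn : A^T *m A + K^T *m K = 1%:M.

(** The rows of [A] and [K] together form an orthonormal basis; this is the inverse of the
    coordinate map [x |-> (x *m A^T, x *m K^T)]. *)
Definition recombine (z : 'rV[R]_k * 'rV[R]_p) : 'rV[R]_n := z.1 *m A + z.2 *m K.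

Lemma measurable_recombine : measurable_fun setT recombine.
Proof.
apply: measurable_addrV.
  exact: (measurableT_comp (measurable_mulmx_rV A) measurable_fst).
exact: (measurableT_comp (measurable_mulmx_rV K) measurable_snd).
Qed.

Lemma recombine_proj1 z : recombine z *m A^T = z.1.
Proof.
rewrite /recombine mulmxDl -!mulmxA AA mulmx1.
have -> : K *m A^T = 0 by rewrite -[LHS]trmxK trmx_mul trmxK AK trmx0.
by rewrite mulmx0 addr0.
Qed.

Lemma recombine_proj2 z : recombine z *m K^T = z.2.
Proof. by rewrite /recombine mulmxDl -!mulmxA AK KK mulmx1 mulmx0 add0r. Qed.

Lemma recombineK (x : 'rV[R]_n) : recombine (x *m A^T, x *m K^T) = x.
Proof. by rewrite /recombine /= -!mulmxA -mulmxDr AKn mulmx1. Qed.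

Lemma dotrV_recombine (b : 'rV[R]_n) z :
  dotrV b (recombine z) = dotrV (b *m A^T) z.1 + dotrV (b *m K^T) z.2.
Proof. by rewrite dotrVDr !dotrV_mulmx. Qed.

Lemma dotrV_split (x y : 'rV[R]_n) :
  dotrV x y = dotrV (x *m A^T) (y *m A^T) + dotrV (x *m K^T) (y *m K^T).
Proof. by rewrite -{1}(recombineK y) dotrV_recombine. Qed.

Lemma gauss_rV_recombine (s : R) z : s != 0 ->
  gauss_rV s (recombine z) = gauss_rV s z.1 * gauss_rV s z.2.
Proof.
move=> s0; rewrite !gauss_rVE// dotrV_split recombine_proj1 recombine_proj2.
rewrite -kpn exprD mulrACA -expRD; congr (_ * expR _).
by rewrite mulrDl opprD.
Qed.

(** The radial Gaussian factorises in the new coordinates, so the product measure weighted by it has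
    the Gaussian characteristic function and [gauss_pushforward] applies with constant 1. *)
Lemma lebesgue_rV_recombine (B : set 'rV[R]_n) : measurable B ->
  (lebesgue_rV k \x lebesgue_rV p)%E (recombine @^-1` B) = lebesgue_rV n B.
Proof.
have ic (f : R -> R) q (b : 'rV[R]_q) s : continuous f -> (forall x, `|f x| <= 1) ->
    (lebesgue_rV q).-integrable setT (EFin \o (fun x => gauss_rV s x * f (dotrV b x))).
  move=> cf f1; apply: integrable_mul_bounded => //; first exact: integrable_gauss_rV.
  by apply: measurableT_comp; [exact: continuous_measurable_fun|exact: measurable_dotrV].
have mixB (a q u v x y : R) : a * q * (u * v - x * y) = a * u * (q * v) - a * x * (q * y) by ring.
have mixD (a q u v x y : R) : a * q * (u * v + x * y) = a * u * (q * v) + a * x * (q * y) by ring.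
have C q (b : 'rV[R]_q) s := ic _ _ b s (@continuous_cos R) (@normr_cos_le1 R).
have S q (b : 'rV[R]_q) s := ic _ _ b s (@continuous_sin R) (@normr_sin_le1 R).
have H := @gauss_pushforward R n _ _ (product_sf (lebesgue_rV k) (lebesgue_rV p)) recombine 1 measurable_recombine ler01.
move=> mB; rewrite -[LHS]mul1e; apply: (H _ _ _ B mB).
- move=> s s0; under eq_fun do rewrite mul1r gauss_rV_recombine ?lt0r_neq0//.
  by apply: integrable_prod; exact: integrable_gauss_rV.
- move=> s b s0; have s1 := lt0r_neq0 s0.
  under eq_Rintegral do rewrite mul1r gauss_rV_recombine// dotrV_recombine cosD mixB.
  rewrite RintegralB//; last 2 first.
  - exact: (integrable_prod (C _ (b *m A^T) s) (C _ (b *m K^T) s)).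
  - exact: (integrable_prod (S _ (b *m A^T) s) (S _ (b *m K^T) s)).
  rewrite (Rintegral_prod (C _ (b *m A^T) s) (C _ (b *m K^T) s)) (Rintegral_prod (S _ (b *m A^T) s) (S _ (b *m K^T) s)).
  rewrite !(gauss_rV_cf _ s1).1 !(gauss_rV_cf _ s1).2 mul0r subr0 -expRD; congr expR.
  by rewrite (dotrV_split b b); field.
- move=> s b s0; have s1 := lt0r_neq0 s0.
  under eq_Rintegral do rewrite mul1r gauss_rV_recombine// dotrV_recombine sinD mixD.
  rewrite RintegralD//; last 2 first.
  - exact: (integrable_prod (S _ (b *m A^T) s) (C _ (b *m K^T) s)).
  - exact: (integrable_prod (C _ (b *m A^T) s) (S _ (b *m K^T) s)).
  rewrite (Rintegral_prod (S _ (b *m A^T) s) (C _ (b *m K^T) s)) (Rintegral_prod (C _ (b *m A^T) s) (S _ (b *m K^T) s)).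
  by rewrite !(gauss_rV_cf _ s1).2 mul0r mulr0 addr0.
Qed.

End isometry.

Section scaling.
Context {R : realType} (n : nat) (r : R).
Hypothesis r0 : 0 < r.

Lemma gauss_rV_scale (s : R) (x : 'rV[R]_n) : s != 0 ->
  r ^+ n * gauss_rV s (r *: x) = gauss_rV (s / r) x.
Proof.
move=> s0; have sr0 : s / r != 0 by rewrite mulf_neq0// invr_neq0// gt_eqF.
rewrite !gauss_rVE// normal_peak_scale// exprMn mulrA; congr (_ * expR (- _)).
by rewrite dotrVZr dotrVZl; field; rewrite s0 gt_eqF.
Qed.

(** A dilated Gaussian, multiplied by [r ^+ n], is the Gaussian of deviation [s / r];
    [gauss_pushforward] applies with constant [r ^+ n]. *)
Lemma lebesgue_rV_scale (B : set 'rV[R]_n) : measurable B ->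
  ((r ^+ n)%:E * lebesgue_rV n ((fun x => r *: x) @^-1` B) = lebesgue_rV n B)%E.
Proof.
move=> mB.
have dotr (b x : 'rV[R]_n) : dotrV b (r *: x) = dotrV (r *: b) x by rewrite dotrVZr dotrVZl.
apply: (gauss_pushforward (measurable_scalerV r) (exprn_ge0 n (ltW r0)) _ _ _ mB).
- move=> s s0; under eq_fun do rewrite gauss_rV_scale ?lt0r_neq0//.
  exact: integrable_gauss_rV.
- move=> s b s0; have s1 : s / r != 0 by rewrite mulf_neq0 ?invr_eq0 ?lt0r_neq0.
  under eq_Rintegral do rewrite gauss_rV_scale ?lt0r_neq0// dotr.
  rewrite (gauss_rV_cf _ s1).1; congr expR; rewrite dotrVZr dotrVZl; field.
  by rewrite gt_eqF.
- move=> s b s0; have s1 : s / r != 0 by rewrite mulf_neq0 ?invr_eq0 ?lt0r_neq0.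
  under eq_Rintegral do rewrite gauss_rV_scale ?lt0r_neq0// dotr.
  by rewrite (gauss_rV_cf _ s1).2.
Qed.

Lemma ge0_integral_rV_scale (f : 'rV[R]_n -> \bar R) : measurable_fun setT f ->
  (forall x, 0 <= f x)%E ->
  (\int[lebesgue_rV n]_x f x = (r ^+ n)%:E * \int[lebesgue_rV n]_x f (r *: x))%E.
Proof.
move=> mf f0.
have r0' := exprn_ge0 n (ltW r0).
transitivity (\int[mscale (NngNum r0') (lebesgue_rV n)]_x f (r *: x))%E.
  apply: ge0_integral_eq_pushforward => //; first exact: measurable_scalerV.
  by move=> B mB; rewrite -[RHS]lebesgue_rV_scale.
rewrite ge0_integral_mscale//.
by apply: measurableT_comp => //; exact: measurable_scalerV.
Qed.

End scaling.

(** * Orthonormal completion and rapid decay *)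

Section orthonormal.
Context {R : realType}.

(** One row at a time: the vectors orthogonal to the rows found so far form a kernel, nonzero by a
    rank count, and any nonzero element of it is normalised. *)
Lemma orthonormal_extend k n p (A : 'M[R]_(k, n)) : (k + p <= n)%N ->
  exists K : 'M[R]_(p, n), K *m K^T = 1%:M /\ A *m K^T = 0.
Proof.
elim: p => [|p IH] kpn.
  by exists 0; split; [apply/matrixP => -[]|rewrite trmx0 mulmx0].
have [K [KK AK]] := IH (leq_trans (leq_add (leqnn k) (leqnSn p)) kpn).
pose M := (col_mx A K)^T.
have : kermx M != 0.
  rewrite -mxrank_eq0 mxrank_ker -lt0n subn_gt0.
  by apply: leq_ltn_trans (rank_leq_col _) _; rewrite -addnS.
move=> /rowV0Pn[v /sub_kermxP vM v0].
have := vM; rewrite /M tr_col_mx mul_mx_row -[RHS]row_mx0 => /eq_row_mx[vA vK].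
have d0 : 0 < dotrV v v.
  rewrite lt_neqAle dotrV_ge0 andbT eq_sym; apply: contra_neq v0 => d0.
  apply/rowP => i; rewrite mxE; apply/eqP; rewrite -sqrf_eq0 expr2.
  by apply/eqP; move/psumr_eq0P: d0; apply => // j _; rewrite -expr2 sqr_ge0.
pose w := (enorm v)^-1 *: v.
have wA : w *m A^T = 0 by rewrite -scalemxAl vA scaler0.
have wK : w *m K^T = 0 by rewrite -scalemxAl vK scaler0.
have ww : w *m w^T = 1%:M.
  apply/matrixP => i j; rewrite !ord1 -dotrV_mx dotrVZl dotrVZr -sqr_enorm mxE eqxx.
  by rewrite mulrA -expr2 -exprMn mulVf ?expr1n// gt_eqF// sqrtr_gt0.
have KK' : @col_mx R 1 p n w K *m (col_mx w K)^T = 1%:M.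
  rewrite tr_col_mx mul_col_row ww KK wK -[K *m w^T]trmxK trmx_mul trmxK wK trmx0.
  by rewrite -scalar_mx_block.
have AK' : A *m (@col_mx R 1 p n w K)^T = 0.
  rewrite tr_col_mx mul_mx_row AK -[A *m w^T]trmxK trmx_mul trmxK wA trmx0.
  exact: row_mx0.
by exists (@col_mx R 1 p n w K).
Qed.

(** When [k + p = n] the stacked matrix is square, so its right inverse is a left inverse; this is
    the third identity. *)
Lemma orthonormal_completion k p n (A : 'M[R]_(k, n)) : (k + p = n)%N -> A *m A^T = 1%:M ->
  exists K : 'M[R]_(p, n),
    [/\ K *m K^T = 1%:M, A *m K^T = 0 & A^T *m A + K^T *m K = 1%:M].
Proof.
move=> kpn; case: n / kpn A => A AA.
have [K [KK AK]] := orthonormal_extend A (leqnn (k + p)).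
exists K; split => //.
rewrite -mul_row_col -tr_col_mx; apply: mulmx1C.
by rewrite tr_col_mx mul_col_row AA KK AK -[K *m A^T]trmxK trmx_mul trmxK AK trmx0 -scalar_mx_block.
Qed.

(** Polarisation, evaluated on pairs of basis vectors. *)
Lemma isometry_mx k n (A : 'M[R]_(k, n)) : (forall x : 'rV[R]_k, enorm (x *m A) = enorm x) ->
  A *m A^T = 1%:M.
Proof.
move=> iso.
have sq x : dotrV (x *m A) (x *m A) = dotrV x x by rewrite -!sqr_enorm iso.
have dot x y : dotrV (x *m A) (y *m A) = dotrV x y.
  have := sq (x + y); rewrite mulmxDl !dotrVDr !dotrVDl !sq (dotrVC (y *m A)) (dotrVC y).
  by lra.
have dl m (i : 'I_m) (y : 'rV[R]_m) : dotrV (delta_mx 0 i) y = y 0 i.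
  rewrite /dotrV (bigD1 i)//= mxE !eqxx mul1r big1 ?addr0// => j ji.
  by rewrite mxE (negPf ji) andbF mul0r.
apply/matrixP => i j; have := dot (delta_mx 0 i) (delta_mx 0 j).
rewrite dl -!rowE dotrV_mx => e; rewrite [RHS]mxE.
transitivity ((delta_mx 0 j : 'rV[R]_k) 0 i); last by rewrite mxE eqxx eq_sym.
by rewrite -e !mxE; apply: eq_bigr => l _; rewrite !mxE.
Qed.

End orthonormal.

Section decay.
Context {R : realType}.

Definition rapid n (f : 'rV[R]_n -> R) :=
  forall N, exists M, forall x, (1 + enorm x) ^+ N * `|f x| <= M.

Lemma sqr_coord_le n (x : 'rV[R]_n) i : x 0 i ^+ 2 <= dotrV x x.
Proof.
rewrite /dotrV (bigD1 i)//= -expr2 lerDl; apply: sumr_ge0 => j _.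
by rewrite -expr2 sqr_ge0.
Qed.

Lemma normr_coord_le n (x : 'rV[R]_n) i : `|x 0 i| <= enorm x.
Proof. by rewrite -sqrtr_sqr ler_wsqrtr// sqr_coord_le. Qed.

Lemma prod_oneDsqr_le n (x : 'rV[R]_n) :
  \prod_(i < n) (1 + x 0 i ^+ 2) <= (1 + enorm x) ^+ (2 * n).
Proof.
rewrite exprM; set X := _ ^+ 2.
have -> : X ^+ n = \prod_(i < n) X by rewrite prodr_const card_ord.
apply: ler_prod => i _; rewrite addr_ge0 ?sqr_ge0//= /X.
have := sqr_coord_le x i; rewrite -sqr_enorm => h; have := enorm_ge0 x; nra.
Qed.

Lemma integrable_oneDsqrV : (@lebesgue_measure R).-integrable setT (EFin \o (fun x : R => (1 + x ^+ 2)^-1)).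
Proof.
have c : continuous (fun x : R => (1 + x ^+ 2)^-1) by exact: continuous_oneDsqrV.
have g0 (x : R) : 0 <= (1 + x ^+ 2)^-1 by rewrite invr_ge0 addr_ge0 ?sqr_ge0.
apply/integrableP; split; first by apply/measurable_EFinP; exact: continuous_measurable_fun.
under eq_integral do rewrite /= ger0_norm//.
rewrite (ge0_symfun_integralT g0 c); last by move=> x /=; rewrite sqrrN.
rewrite -set_itvcy (@ge0_continuous_FTC2y R _ atan 0 (pi / 2)) ?lte_mul_pinfty// ?ltry//.
- exact: continuous_subspaceT.
- exact: cvgy_atan.
- by apply: cvg_at_right_filter; exact: continuous_atan.
- by move=> x _; rewrite derive1E; apply: derive_val.
Qed.

(** Comparison with the product of the functions [(1 + x_i^2)^-1], whose integral factorises. Each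
    factor costs two powers of [1 + enorm x], hence the exponent [2 * n]. *)
Lemma rapid_integrable n (f : 'rV[R]_n -> R) : measurable_fun setT f -> rapid f ->
  (lebesgue_rV n).-integrable setT (EFin \o f).
Proof.
move=> mf rf; have [M fM] := rf (2 * n)%N.
have pos (x : 'rV[R]_n) : 0 < \prod_(i < n) (1 + x 0 i ^+ 2).
  by apply: prodr_gt0 => i _; rewrite ltr_pwDl ?sqr_ge0.
have M0 : 0 <= M by apply: le_trans (fM 0); rewrite mulr_ge0// exprn_ge0// addr_ge0 ?enorm_ge0.
have mw : measurable_fun setT (fun x : 'rV[R]_n => \prod_(i < n) (1 + x 0 i ^+ 2)^-1).
  apply: measurable_prod => i _.
  apply: (measurableT_comp (f := fun y : R => (1 + y ^+ 2)^-1)); last exact: measurable_rV_coord.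
  exact: continuous_measurable_fun (@continuous_oneDsqrV R).
have w0 (x : 'rV[R]_n) : 0 <= \prod_(i < n) (1 + x 0 i ^+ 2)^-1.
  by apply: prodr_ge0 => i _; rewrite invr_ge0 addr_ge0 ?sqr_ge0.
have iw : (lebesgue_rV n).-integrable setT (EFin \o (fun x : 'rV[R]_n => M * \prod_(i < n) (1 + x 0 i ^+ 2)^-1)).
  apply: integrableZl_EFin => //; apply/integrableP; split; first exact/measurable_EFinP.
  under eq_integral do rewrite /= ger0_norm//.
  rewrite (@ge0_integral_rV_prod R n (fun _ y => (1 + y ^+ 2)^-1)).
  - have /integrableP[_] := integrable_oneDsqrV.
    under eq_integral do rewrite /= ger0_norm ?invr_ge0 ?addr_ge0 ?sqr_ge0//.
    set I := (\int[_]_x _)%E => Iy.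
    rewrite big_const card_ord; elim: n {f mf rf fM pos mw w0} => [|n IH]; first by rewrite /= ltry.
    rewrite iterS lte_mul_pinfty//.
      by apply: integral_ge0 => x _; rewrite lee_fin invr_ge0 addr_ge0 ?sqr_ge0.
    by rewrite ge0_fin_numE//; apply: integral_ge0 => x _; rewrite lee_fin invr_ge0 addr_ge0 ?sqr_ge0.
  - by move=> _; exact: continuous_measurable_fun (@continuous_oneDsqrV R).
  - by move=> _ y; rewrite invr_ge0 addr_ge0 ?sqr_ge0.
apply: le_integrable iw => //; first exact/measurable_EFinP.
move=> x _; rewrite /= lee_fin [leRHS]normrM (ger0_norm M0) (ger0_norm (w0 x)) prodfV.
rewrite ler_pdivlMr// mulrC; apply: le_trans (fM x).
by rewrite ler_wpM2r// prod_oneDsqr_le.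
Qed.

Definition polybound n (p : 'rV[R]_n -> R) :=
  exists q C, forall x, `|p x| <= C * (1 + enorm x) ^+ q.

Lemma oneDenorm_ge1 n (x : 'rV[R]_n) : 1 <= 1 + enorm x.
Proof. by rewrite lerDl enorm_ge0. Qed.

Lemma rapidM n (p f : 'rV[R]_n -> R) : polybound p -> rapid f -> rapid (fun x => p x * f x).
Proof.
move=> [q [C pC]] rf N; have [M fM] := rf (N + q)%N.
exists (C * M) => x; rewrite normrM mulrA.
have C0 : 0 <= C.
  have := le_trans (normr_ge0 _) (pC x); rewrite pmulr_lge0// exprn_gt0//.
  by apply: lt_le_trans (oneDenorm_ge1 x).
apply: le_trans (_ : C * ((1 + enorm x) ^+ (N + q) * `|f x|) <= _); last by rewrite ler_wpM2l.
rewrite mulrA ler_wpM2r// exprD mulrCA ler_wpM2l//.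
by rewrite exprn_ge0// (le_trans ler01 (oneDenorm_ge1 x)).
Qed.

Lemma polybound_cst n (c : R) : polybound (fun _ : 'rV[R]_n => c).
Proof. by exists 0%N, `|c| => x; rewrite expr0 mulr1. Qed.

Lemma polybound_coord n (i : 'I_n) : polybound (fun x : 'rV[R]_n => x 0 i).
Proof.
exists 1%N, 1 => x; rewrite mul1r expr1; apply: le_trans (normr_coord_le x i) _.
by rewrite lerDr.
Qed.

Lemma polyboundM n (p q : 'rV[R]_n -> R) : polybound p -> polybound q ->
  polybound (fun x => p x * q x).
Proof.
move=> [a [C pC]] [b [D qD]]; exists (a + b)%N, (C * D) => x.
by rewrite normrM exprD mulrACA ler_pM.
Qed.

Lemma polyboundD n (p q : 'rV[R]_n -> R) : polybound p -> polybound q ->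
  polybound (fun x => p x + q x).
Proof.
move=> [a [C pC]] [b [D qD]]; exists (a + b)%N, (C + D) => x.
apply: le_trans (ler_normD _ _) _; rewrite mulrDl.
have X1 := oneDenorm_ge1 x.
have aux u v c (y : R) : y <= c * (1 + enorm x) ^+ u -> 0 <= y -> y <= c * (1 + enorm x) ^+ (u + v).
  move=> h y0; apply: (le_trans h); rewrite exprD mulrA ler_peMr ?exprn_ege1//.
  exact: le_trans h.
by apply: lerD; [|rewrite addnC]; exact: aux.
Qed.

Lemma rapid_sum n (f g : 'rV[R]_n -> R) : rapid f -> rapid g -> rapid (fun x => f x + g x).
Proof.
move=> rf rg N; have [M fM] := rf N; have [L gL] := rg N.
exists (M + L) => x; apply: le_trans (_ : (1 + enorm x) ^+ N * (`|f x| + `|g x|) <= _).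
  by rewrite ler_wpM2l ?ler_normD// exprn_ge0// (le_trans ler01 (oneDenorm_ge1 x)).
by rewrite mulrDr lerD.
Qed.

End decay.

Section calculus.
Context {R : realType}.

Lemma differentiable_mulmx k n (A : 'M[R]_(k, n)) (x : 'rV[R]_k) :
  differentiable (fun x : 'rV[R]_k => x *m A) x.
Proof.
rewrite (_ : (fun x => _) = \sum_(i < k) (fun x : 'rV[R]_k => x 0 i *: row i A)).
  apply: differentiable_sum => i; apply: differentiableZl.
  exact: differentiable_coord.
apply/funext => y; rewrite fct_sumE mulmx_sum_row.
by [].
Qed.

Lemma differentiable_comp_mulmx k n (A : 'M[R]_(n, k)) (f : 'rV[R]_k -> R) :
  (forall y, differentiable f y) -> forall x, differentiable (fun x : 'rV[R]_n => f (x *m A)) x.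
Proof.
move=> df x; apply: (differentiable_comp (f := fun x : 'rV[R]_n => x *m A)); last exact: df.
exact: differentiable_mulmx.
Qed.

Lemma derive_sum_coord n (f : 'rV[R]_n -> R) (x v : 'rV[R]_n) : differentiable f x ->
  'D_v f x = \sum_(i < n) v 0 i * 'D_(delta_mx 0 i) f x.
Proof.
move=> df; rewrite deriveE// {1}(row_sum_delta v) linear_sum; apply: eq_bigr => i _.
by rewrite linearZ deriveE.
Qed.

Lemma derive_comp_mulmx k n (A : 'M[R]_(n, k)) (f : 'rV[R]_k -> R) (x : 'rV[R]_n) (i : 'I_n) :
  (forall y, differentiable f y) ->
  'D_(delta_mx 0 i) (fun x : 'rV[R]_n => f (x *m A)) x =
  \sum_(j < k) A i j * 'D_(delta_mx 0 j) f (x *m A).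
Proof.
move=> df; transitivity ('D_(row i A) f (x *m A)).
  rewrite /derive; apply: (congr1 (fun g : R -> R => lim (g @ 0^'))); apply/funext => h /=.
  by rewrite mulmxDl -scalemxAl -rowE.
by rewrite derive_sum_coord//; apply: eq_bigr => j _; rewrite mxE.
Qed.

End calculus.

(** * Schwartz functions *)

Section schwartz_facts.
Context {R : realType} {n : nat}.
Implicit Types (f g : 'rV[R]_n -> R).

(** A closure principle that spares iterated derivatives: it is enough to find a class of
    differentiable, rapidly decreasing functions stable under each first partial derivative. *)
Lemma schwartz_class (C : ('rV[R]_n -> R) -> Prop) :
  (forall f, C f -> forall x, differentiable f x) ->
  (forall f i, C f -> C (fun x => 'D_(delta_mx 0 i) f x)) ->
  (forall f, C f -> rapid f) ->
  forall f, C f -> schwartz f.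
Proof.
move=> Cd CD Cr f Cf.
have Cp s : C (partial s f) by elim: s => [|i s IH] //=; exact: CD.
by split => [s x|N s]; [exact: Cd|exact: (Cr _ (Cp s) N)].
Qed.

Lemma schwartz_differentiable f : schwartz f -> forall x, differentiable f x.
Proof. by move=> [sf _] x; exact: (sf [::]). Qed.

Lemma schwartz_rapid f : schwartz f -> rapid f.
Proof. by move=> [_ rf] N; exact: (rf N [::]). Qed.

Lemma schwartz_derive f i : schwartz f -> schwartz (fun x => 'D_(delta_mx 0 i) f x).
Proof.
have E s : partial s (fun x => 'D_(delta_mx 0 i) f x) = partial (rcons s i) f.
  by rewrite /partial foldr_rcons.
by move=> [sf rf]; split => [s x|N s]; rewrite E; [exact: sf|exact: rf].
Qed.

Lemma schwartz_continuous f : schwartz f -> continuous f.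
Proof. by move=> sf x; apply: differentiable_continuous; exact: schwartz_differentiable. Qed.

Lemma schwartz_measurable f : schwartz f -> measurable_fun setT f.
Proof. by move=> sf; apply: continuous_measurable_rV; exact: schwartz_continuous. Qed.

Lemma schwartz_integrable f : schwartz f -> (lebesgue_rV n).-integrable setT (EFin \o f).
Proof.
by move=> sf; apply: rapid_integrable; [exact: schwartz_measurable|exact: schwartz_rapid].
Qed.

Lemma rapid_bounded f : rapid f -> exists M, forall x, `|f x| <= M.
Proof. by move=> /(_ 0%N)[M fM]; exists M => x; have := fM x; rewrite expr0 mul1r. Qed.

Lemma schwartz_lin (a : R) f g : schwartz f -> schwartz g -> schwartz (fun x => a * f x + g x).
Proof.
move=> sf sg.
apply: (@schwartz_class (fun h => exists f g, [/\ schwartz f, schwartz g & h = fun x => a * f x + g x])).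
- move=> _ [f' [g' [sf' sg' ->]]] x.
  apply: differentiableD; last exact: schwartz_differentiable.
  by apply: differentiableZ; exact: schwartz_differentiable.
- move=> _ i [f' [g' [sf' sg' ->]]].
  exists (fun x => 'D_(delta_mx 0 i) f' x), (fun x => 'D_(delta_mx 0 i) g' x).
  split; [exact: schwartz_derive|exact: schwartz_derive|apply/funext => x].
  have df' : derivable f' x (delta_mx 0 i) by exact/diff_derivable/schwartz_differentiable.
  have dg' : derivable g' x (delta_mx 0 i) by exact/diff_derivable/schwartz_differentiable.
  rewrite -deriveMl// -deriveD//.
  exact: derivableZ.
- move=> _ [f' [g' [sf' sg' ->]]]; apply: rapid_sum; last exact: schwartz_rapid.
  by apply: rapidM; [exact: polybound_cst|exact: schwartz_rapid].
- by exists f, g.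
Qed.

Lemma schwartz0 : schwartz (fun _ : 'rV[R]_n => 0).
Proof.
apply: (@schwartz_class (fun h => h = fun=> 0)) => //.
- by move=> _ -> x; exact: differentiable_cst.
- by move=> _ i ->; apply/funext => x; rewrite derive_cst.
- by move=> _ -> N; exists 0 => x; rewrite normr0 mulr0.
Qed.

Lemma schwartzZ (a : R) f : schwartz f -> schwartz (fun x => a * f x).
Proof.
move=> sf; rewrite (_ : (fun x => _) = fun x => a * f x + 0).
  exact: schwartz_lin sf schwartz0.
by apply/funext => x; rewrite addr0.
Qed.

Lemma polybound_monomial (b : 'I_n -> nat) : polybound (@monomial R n b).
Proof.
rewrite /monomial; elim: (index_enum _) => [|i s IH].
  by under eq_fun do rewrite big_nil; exact: polybound_cst.
under eq_fun do rewrite big_cons; apply: polyboundM => //.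
elim: (b i) => [|k IHk]; first by under eq_fun do rewrite expr0; exact: polybound_cst.
under eq_fun do rewrite exprS; apply: polyboundM => //; exact: polybound_coord.
Qed.

Lemma measurable_monomial (b : 'I_n -> nat) : measurable_fun setT (@monomial R n b).
Proof. by apply: measurable_prod => i _; apply: measurable_funX; exact: measurable_rV_coord. Qed.

Lemma integrable_polybound_schwartz p f : measurable_fun setT p -> polybound p -> schwartz f ->
  (lebesgue_rV n).-integrable setT (EFin \o (fun x => p x * f x)).
Proof.
move=> mp pp sf; apply: rapid_integrable; last by apply: rapidM => //; exact: schwartz_rapid.
by apply: measurable_funM => //; exact: schwartz_measurable.
Qed.

Lemma schwartz_mom_lin (r a : R) f g : schwartz_mom r f -> schwartz_mom r g ->
  schwartz_mom r (fun x => a * f x + g x).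
Proof.
move=> [sf mf] [sg mg]; split; first exact: schwartz_lin.
move=> b br.
have I (h : 'rV[R]_n -> R) := integrable_polybound_schwartz (measurable_monomial b) (polybound_monomial b) (f := h).
under eq_Rintegral do rewrite mulrDr mulrCA.
rewrite RintegralD//; [|exact: integrableZl_EFin (I _ sf)|exact: I].
by rewrite RintegralZl ?mf ?mg ?mulr0 ?addr0//; exact: I.
Qed.

Lemma schwartz_mom0 (r : R) : schwartz_mom r (fun _ : 'rV[R]_n => 0).
Proof.
split; first exact: schwartz0.
by move=> b _; under eq_Rintegral do rewrite mulr0; rewrite /Rintegral integral0.
Qed.

Lemma schwartz_mom_sum (r : R) m (a : 'I_m -> R) (F : 'I_m -> 'rV[R]_n -> R) :
  (forall i, schwartz_mom r (F i)) -> schwartz_mom r (fun x => \sum_(i < m) a i * F i x).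
Proof.
move=> sF; elim: (index_enum _) => [|i s IH].
  by under eq_fun do rewrite big_nil; exact: schwartz_mom0.
under eq_fun do rewrite big_cons; exact: schwartz_mom_lin.
Qed.

Lemma schwartz_mom_neg (r : R) f : r < 0 -> schwartz f -> schwartz_mom r f.
Proof.
move=> r0 sf; split => // b br; have := le_lt_trans br r0.
by rewrite ltrn0.
Qed.

End schwartz_facts.

Section schwartz_prod.
Context {R : realType} (n k p : nat) (A : 'M[R]_(n, k)) (B : 'M[R]_(n, p)).
Hypothesis AB : forall x : 'rV[R]_n, 1 + enorm x <= (1 + enorm (x *m A)) * (1 + enorm (x *m B)).

(** Finite sums of such products: by the Leibniz and chain rules, a partial derivative of one
    product is a combination of several, so a class of single products would not be stable. *)
Inductive prod_class : ('rV[R]_n -> R) -> Prop :=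
| prod_class0 : prod_class (fun=> 0)
| prod_class_add (a : R) f g h : schwartz f -> schwartz g -> prod_class h ->
    prod_class (fun x => a * (f (x *m A) * g (x *m B)) + h x).

Let prod_classD h1 h2 : prod_class h1 -> prod_class h2 -> prod_class (fun x => h1 x + h2 x).
Proof.
move=> c1 c2; elim: c1 => [|a f g h sf sg ch IH].
  by under eq_fun do rewrite add0r.
by under eq_fun do rewrite -addrA; exact: prod_class_add.
Qed.

Let prod_class_sum (I : Type) (s : seq I) (F : I -> 'rV[R]_n -> R) :
  (forall i, prod_class (F i)) -> prod_class (fun x => \sum_(i <- s) F i x).
Proof.
move=> sF; elim: s => [|i s IH].
  by under eq_fun do rewrite big_nil; exact: prod_class0.
by under eq_fun do rewrite big_cons; exact: prod_classD.
Qed.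

Let prod_class1 a f g : schwartz f -> schwartz g -> prod_class (fun x => a * (f (x *m A) * g (x *m B))).
Proof.
by move=> sf sg; under eq_fun do rewrite -[_ * _]addr0; exact: prod_class_add prod_class0.
Qed.

Let diff1 f g : schwartz f -> schwartz g -> forall x, differentiable (fun x => f (x *m A) * g (x *m B)) x.
Proof.
move=> sf sg x; apply: differentiableM.
  by apply: differentiable_comp_mulmx; exact: schwartz_differentiable.
by apply: differentiable_comp_mulmx; exact: schwartz_differentiable.
Qed.

Let prod_class_diff h : prod_class h -> forall x, differentiable h x.
Proof.
move=> ch x; elim: ch => [|a f g h' sf sg _ IH]; first exact: differentiable_cst.
apply: differentiableD => //; apply: differentiableZ; exact: diff1.
Qed.

Let prod_class_derive h i : prod_class h -> prod_class (fun x => 'D_(delta_mx 0 i) h x).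
Proof.
elim=> [|a f g h' sf sg ch IH].
  by under eq_fun do rewrite derive_cst; exact: prod_class0.
have df := schwartz_differentiable sf; have dg := schwartz_differentiable sg.
rewrite (_ : (fun x => _) = fun x =>
   ((\sum_(j < k) (a * A i j) * ('D_(delta_mx 0 j) f (x *m A) * g (x *m B))) +
   \sum_(j < p) (a * B i j) * (f (x *m A) * 'D_(delta_mx 0 j) g (x *m B))) + 'D_(delta_mx 0 i) h' x).
  apply: prod_classD => //; apply: prod_classD; apply: prod_class_sum => j.
    exact: (prod_class1 (a * A i j) (schwartz_derive j sf) sg).
  exact: (prod_class1 (a * B i j) sf (schwartz_derive j sg)).
apply/funext => x.
have dfA : derivable (fun x : 'rV[R]_n => f (x *m A)) x (delta_mx 0 i).
  by apply: diff_derivable; exact: differentiable_comp_mulmx.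
have dgB : derivable (fun x : 'rV[R]_n => g (x *m B)) x (delta_mx 0 i).
  by apply: diff_derivable; exact: differentiable_comp_mulmx.
have dfg : derivable (fun x : 'rV[R]_n => f (x *m A) * g (x *m B)) x (delta_mx 0 i) by exact: derivableM.
rewrite deriveD; [|exact: derivableZ|exact/diff_derivable/prod_class_diff].
congr (_ + _); rewrite deriveMl//.
rewrite (deriveM dfA dgB) !derive_comp_mulmx// /GRing.scale/= mulrDr addrC; congr (_ + _).
  rewrite mulr_sumr mulr_sumr; apply: eq_bigr => j _; ring.
rewrite mulr_sumr mulr_sumr; apply: eq_bigr => j _; ring.
Qed.

Let prod_class_rapid h : prod_class h -> rapid h.
Proof.
elim=> [|a f g h' sf sg ch IH]; first by move=> N; exists 0 => x; rewrite normr0 mulr0.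
apply: rapid_sum => //; apply: rapidM; first exact: polybound_cst.
move=> N; have [M fM] := schwartz_rapid sf N; have [L gL] := schwartz_rapid sg N.
exists (M * L) => x.
apply: le_trans (_ : ((1 + enorm (x *m A)) * (1 + enorm (x *m B))) ^+ N * `|f (x *m A) * g (x *m B)| <= _).
  by rewrite ler_wpM2r// lerXn2r ?nnegrE// ?mulr_ge0 ?(le_trans ler01 (oneDenorm_ge1 _)).
rewrite normrM exprMn mulrACA ler_pM// mulr_ge0// exprn_ge0//.
  exact: le_trans ler01 (oneDenorm_ge1 _).
exact: le_trans ler01 (oneDenorm_ge1 _).
Qed.

Lemma schwartz_prod f g : schwartz f -> schwartz g ->
  schwartz (fun x => f (x *m A) * g (x *m B)).
Proof.
move=> sf sg; apply: (schwartz_class prod_class_diff prod_class_derive prod_class_rapid).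
rewrite (_ : (fun x => _) = fun x => 1 * (f (x *m A) * g (x *m B))); first exact: prod_class1.
by apply/funext => x; rewrite mul1r.
Qed.

End schwartz_prod.

(** * Gaussians times polynomials and trigonometric functions *)

Section gauss_trig.
Context {R : realType} (n : nat).
Implicit Types (p q : 'rV[R]_n -> R).

Inductive polynomial_fun : ('rV[R]_n -> R) -> Prop :=
| polynomial_fun_cst c : polynomial_fun (fun=> c)
| polynomial_fun_coord i : polynomial_fun (fun x => x 0 i)
| polynomial_funD p q : polynomial_fun p -> polynomial_fun q -> polynomial_fun (fun x => p x + q x)
| polynomial_funM p q : polynomial_fun p -> polynomial_fun q -> polynomial_fun (fun x => p x * q x).

Lemma polynomial_fun_polybound p : polynomial_fun p -> polybound p.
Proof.
elim=> *; [exact: polybound_cst|exact: polybound_coord|exact: polyboundD|exact: polyboundM].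
Qed.

Lemma polynomial_fun_differentiable p : polynomial_fun p -> forall x, differentiable p x.
Proof.
move=> pp x; elim: pp => [c|i|{}p q _ IHp _ IHq|{}p q _ IHp _ IHq].
- exact: differentiable_cst.
- exact: differentiable_coord.
- exact: differentiableD.
- exact: differentiableM.
Qed.

Lemma derive_comp1 (f : 'rV[R]_n -> R) (g : R -> R) (x v : 'rV[R]_n) (dg : R) :
  differentiable f x -> is_derive (f x) 1 g dg -> 'D_v (g \o f) x = dg * 'D_v f x.
Proof.
move=> df dgx; have dg1 : differentiable g (f x) by exact/derivable1_diffP/ex_derive.
have dgf : differentiable (g \o f) x by exact: differentiable_comp.
rewrite (deriveE _ dgf) (deriveE _ df) (diff_comp df dg1) [LHS]/=.
set y := 'd f x v; have -> : y = y *: (1 : R^o) by rewrite /GRing.scale/= mulr1.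
rewrite linearZ -(deriveE _ dg1) derive_val.
by rewrite /GRing.scale/= mulr1 mulrC.
Qed.

Lemma polynomial_fun_derive p i : polynomial_fun p -> polynomial_fun (fun x => 'D_(delta_mx 0 i) p x).
Proof.
elim=> [c|j|{}p q pp IHp pq IHq|{}p q pp IHp pq IHq].
- by under eq_fun do rewrite derive_cst; exact: polynomial_fun_cst.
- rewrite (_ : (fun x => _) = fun=> (i == j)%:R); first exact: polynomial_fun_cst.
  apply/funext => x; rewrite /derive; apply: cvg_lim => //.
  apply: (@cvg_trans _ ((fun=> (i == j)%:R : R) @ 0^')); last exact: cvg_cst.
  apply: near_eq_cvg; near=> h.
  have h0 : h != 0 by near: h; exact: nbhs_dnbhs_neq.
  rewrite /= !mxE eqxx andTb addrK eq_sym /GRing.scale/= mulKf// eq_sym.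
- have e x : 'D_(delta_mx 0 i) (fun x => p x + q x) x = 'D_(delta_mx 0 i) p x + 'D_(delta_mx 0 i) q x.
    by rewrite deriveD//; apply: diff_derivable; exact: polynomial_fun_differentiable.
  by under eq_fun do rewrite e; exact: polynomial_funD.
- have e x : 'D_(delta_mx 0 i) (fun x => p x * q x) x = p x * 'D_(delta_mx 0 i) q x + q x * 'D_(delta_mx 0 i) p x.
    by rewrite deriveM//; apply: diff_derivable; exact: polynomial_fun_differentiable.
  by under eq_fun do rewrite e; apply: polynomial_funD; exact: polynomial_funM.
Unshelve. all: by end_near. Qed.

Lemma polynomial_fun_sum (I : Type) (s : seq I) (F : I -> 'rV[R]_n -> R) :
  (forall i, polynomial_fun (F i)) -> polynomial_fun (fun x => \sum_(i <- s) F i x).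
Proof.
move=> pF; elim: s => [|i s IH].
  by under eq_fun do rewrite big_nil; exact: polynomial_fun_cst.
by under eq_fun do rewrite big_cons; exact: polynomial_funD.
Qed.

Lemma polynomial_fun_dotrV (b : 'rV[R]_n) : polynomial_fun (dotrV b).
Proof.
apply: (polynomial_fun_sum _ (F := fun i x => b 0 i * x 0 i)) => i.
by apply: polynomial_funM; [exact: polynomial_fun_cst|exact: polynomial_fun_coord].
Qed.

Variables (c : R) (a b : 'rV[R]_n).
Hypothesis c0 : 0 < c.

Let Q x := dotrV a x - c * dotrV x x.

Let polyQ : polynomial_fun Q.
Proof.
rewrite /Q; under eq_fun do rewrite -mulNr.
apply: polynomial_funD; first exact: polynomial_fun_dotrV.
apply: polynomial_funM; first exact: polynomial_fun_cst.
apply: (polynomial_fun_sum _ (F := fun i x => x 0 i * x 0 i)) => i.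
by apply: polynomial_funM; exact: polynomial_fun_coord.
Qed.

Let E x := expR (Q x).

Let rapidE : rapid E.
Proof.
move=> N; pose al := \sum_(i < n) `|a 0 i|.
(* With [(1 + t)^N <= expR (N t)] and [dotrV a x <= al * t], the exponent is at most
   [(N + al) t - c t^2], whose maximum over [t] appears here. *)
exists (expR ((N%:R + al) ^+ 2 / (4 * c))) => x.
have t0 := enorm_ge0 x; set t := enorm x in t0 *.
rewrite (ger0_norm (expR_ge0 _)).
apply: le_trans (_ : expR (t *+ N) * expR (Q x) <= _).
  rewrite ler_wpM2r ?expR_ge0// -[t *+ N]mulr_natl expRM_natl; apply: lerXn2r; rewrite ?nnegrE ?expR_ge0 ?addr_ge0//.
  exact: expR_ge1Dx.
rewrite -expRD ler_expR /Q -sqr_enorm -/t -mulr_natl.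
have ax : dotrV a x <= al * t.
  rewrite /dotrV /al mulr_suml; apply: ler_sum => i _.
  apply: le_trans (ler_norm _) _; rewrite normrM ler_wpM2l//; exact: normr_coord_le.
apply: le_trans (_ : (N%:R + al) * t - c * t ^+ 2 <= _); first by lra.
set u := N%:R + al; rewrite ler_pdivlMr ?mulr_gt0//.
by rewrite -subr_ge0 (_ : _ - _ = (u - 2 * c * t) ^+ 2) ?sqr_ge0// /u mulr1; ring.
Qed.

Let D_E i x : 'D_(delta_mx 0 i) E x = 'D_(delta_mx 0 i) Q x * E x.
Proof.
have dQ : differentiable Q x by exact: polynomial_fun_differentiable.
by rewrite mulrC; exact: (derive_comp1 _ dQ (is_derive_expR (Q x))).
Qed.

Let dE x : differentiable E x.
Proof.
apply: (differentiable_comp (f := Q) (g := expR)); first exact: polynomial_fun_differentiable.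
exact/derivable1_diffP/derivable_expR.
Qed.

Let L := dotrV b.

Let dL x : differentiable L x.
Proof. by apply: polynomial_fun_differentiable; exact: polynomial_fun_dotrV. Qed.

Let dC x : differentiable (cos \o L) x.
Proof. by apply: differentiable_comp => //; exact/derivable1_diffP/ex_derive. Qed.

Let dS x : differentiable (sin \o L) x.
Proof. by apply: differentiable_comp => //; exact/derivable1_diffP/ex_derive. Qed.

(** Cosine and sine come with separate polynomial coefficients because differentiation exchanges
    them. *)
Let cls f := exists p q, [/\ polynomial_fun p, polynomial_fun q &
  f = fun x => E x * (p x * (cos \o L) x + q x * (sin \o L) x)].

Let cls_schwartz f : cls f -> schwartz f.
Proof.
apply: (@schwartz_class _ _ cls).
- move=> _ [p [q [pp pq ->]]] x.
  have dp := polynomial_fun_differentiable pp x; have dq := polynomial_fun_differentiable pq x.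
  apply: differentiableM => //; apply: differentiableD; exact: differentiableM.
- move=> _ i [p [q [pp pq ->]]].
  pose D (f : 'rV[R]_n -> R) (x : 'rV[R]_n) : R := 'D_(delta_mx 0 i) f x.
  exists (fun x => (D p x + D Q x * p x) + D L x * q x),
         (fun x => (D q x + D Q x * q x) + D L x * (-1 * p x)).
  have pQ : polynomial_fun (D Q) by exact: polynomial_fun_derive.
  have pL : polynomial_fun (D L) by apply: polynomial_fun_derive; exact: polynomial_fun_dotrV.
  have pDp : polynomial_fun (D p) by exact: polynomial_fun_derive.
  have pDq : polynomial_fun (D q) by exact: polynomial_fun_derive.
  split.
  + by apply: polynomial_funD; [apply: polynomial_funD => //|]; exact: polynomial_funM.
  + apply: polynomial_funD; [apply: polynomial_funD => //|]; apply: polynomial_funM => //.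
    by apply: polynomial_funM => //; exact: polynomial_fun_cst.
  apply/funext => x.
  have dp := polynomial_fun_differentiable pp x; have dq := polynomial_fun_differentiable pq x.
  have pC := differentiableM dp (dC x); have qS := differentiableM dq (dS x).
  have pqCS := differentiableD pC qS.
  have DM (u v : 'rV[R]_n -> R) : differentiable u x -> differentiable v x ->
      'D_(delta_mx 0 i) (u * v) x = u x * 'D_(delta_mx 0 i) v x + v x * 'D_(delta_mx 0 i) u x.
    by move=> df dg; rewrite deriveM//; exact: diff_derivable.
  have DD : 'D_(delta_mx 0 i) (p * (cos \o L) + q * (sin \o L)) x =
      'D_(delta_mx 0 i) (p * (cos \o L)) x + 'D_(delta_mx 0 i) (q * (sin \o L)) x.
    by rewrite deriveD//; exact: diff_derivable.
  rewrite [LHS](DM _ _ (dE x) pqCS) DD (DM _ _ dp (dC x)) (DM _ _ dq (dS x)).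
  rewrite D_E (derive_comp1 _ (dL x) (is_derive_cos (L x))) (derive_comp1 _ (dL x) (is_derive_sin (L x))).
  have -> : (p * (cos \o L) + q * (sin \o L)) x = p x * cos (L x) + q x * sin (L x) by [].
  rewrite /GRing.scale/= /D.
  ring.
- move=> _ [p [q [pp pq ->]]].
  rewrite (_ : (fun x => _) = fun x => (p x * (cos \o L) x + q x * (sin \o L) x) * E x); last first.
    by apply/funext => x; rewrite mulrC.
  apply: rapidM => //; apply: polyboundD; apply: polyboundM; do ?exact: polynomial_fun_polybound.
    by exists 0%N, 1 => x; rewrite mul1r expr0 normr_cos_le1.
  by exists 0%N, 1 => x; rewrite mul1r expr0 normr_sin_le1.
Qed.

Lemma schwartz_gauss_cos : schwartz (fun x => expR (dotrV a x - c * dotrV x x) * cos (dotrV b x)).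
Proof.
apply: cls_schwartz; exists (fun=> 1), (fun=> 0); split; try exact: polynomial_fun_cst.
by apply/funext => x; rewrite mul1r mul0r addr0.
Qed.

Lemma schwartz_gauss_sin : schwartz (fun x => expR (dotrV a x - c * dotrV x x) * sin (dotrV b x)).
Proof.
apply: cls_schwartz; exists (fun=> 0), (fun=> 1); split; try exact: polynomial_fun_cst.
by apply/funext => x; rewrite mul1r mul0r add0r.
Qed.

End gauss_trig.

Lemma schwartz_gauss {R : realType} n (s : R) : 0 < s -> schwartz (@gauss_rV R n s).
Proof.
move=> s0; have c0 : 0 < (s ^+ 2 *+ 2)^-1 by rewrite invr_gt0 pmulrn_lgt0// exprn_gt0.
rewrite (_ : gauss_rV s = fun x => normal_peak s ^+ n *
    (expR (dotrV 0 x - (s ^+ 2 *+ 2)^-1 * dotrV x x) * cos (dotrV (0 : 'rV[R]_n) x))).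
  by apply: schwartzZ; exact: schwartz_gauss_cos.
apply/funext => x.
rewrite gauss_rVE ?gt_eqF//; congr (_ * _).
have -> : dotrV 0 x = 0 by rewrite /dotrV big1// => i _; rewrite mxE mul0r.
by rewrite cos0 mulr1 sub0r mulrC.
Qed.

(** * Fourier transforms *)

Section fourier_facts.
Context {R : realType} {n : nat}.
Implicit Types (f g : 'rV[R]_n -> R).

Definition fconst : R := (2 * pi) `^ (- (n%:R / 2)).

(** The proof works with these two real integrals, so that no complex-valued function is ever
    integrated. *)
Definition cosT f (xi : 'rV[R]_n) : R := \int[lebesgue_rV n]_x (f x * cos (dotrV xi x)).
Definition sinT f (xi : 'rV[R]_n) : R := \int[lebesgue_rV n]_x (f x * sin (dotrV xi x)).

Lemma Re_fourier f xi : complex.Re (fourier f xi) = fconst * cosT f xi.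
Proof. by rewrite /fourier /= mul0r subr0. Qed.

Lemma Im_fourier f xi : complex.Im (fourier f xi) = - (fconst * sinT f xi).
Proof. by rewrite /fourier /= mul0r addr0 mulrN. Qed.

Lemma sqnormC_fourier f xi : sqnormC (fourier f xi) = fconst ^+ 2 * (cosT f xi ^+ 2 + sinT f xi ^+ 2).
Proof. by rewrite /sqnormC Re_fourier Im_fourier; ring. Qed.

Let mdot : measurable_fun setT (fun z : 'rV[R]_n * 'rV[R]_n => dotrV z.1 z.2).
Proof. by apply: measurable_dotrV2; [exact: measurable_fst|exact: measurable_snd]. Qed.

Lemma measurable_cosT f : measurable_fun setT f -> measurable_fun setT (cosT f).
Proof.
move=> mf; apply: (@measurable_Rintegral _ _ _ _ _ (lebesgue_rV n) (fun z => f z.2 * cos (dotrV z.1 z.2))).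
apply: measurable_funM; first exact: measurableT_comp.
exact: measurableT_comp (measurable_cos) mdot.
Qed.

Lemma measurable_sinT f : measurable_fun setT f -> measurable_fun setT (sinT f).
Proof.
move=> mf; apply: (@measurable_Rintegral _ _ _ _ _ (lebesgue_rV n) (fun z => f z.2 * sin (dotrV z.1 z.2))).
apply: measurable_funM; first exact: measurableT_comp.
exact: measurableT_comp (measurable_sin) mdot.
Qed.

Lemma integrable_mul_cos f xi : (lebesgue_rV n).-integrable setT (EFin \o f) ->
  (lebesgue_rV n).-integrable setT (EFin \o (fun x => f x * cos (dotrV xi x))).
Proof.
move=> fi; apply: integrable_mul_bounded => //; last by move=> x; exact: normr_cos_le1.
exact: measurableT_comp (measurable_cos) (measurable_dotrV xi).
Qed.

Lemma integrable_mul_sin f xi : (lebesgue_rV n).-integrable setT (EFin \o f) ->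
  (lebesgue_rV n).-integrable setT (EFin \o (fun x => f x * sin (dotrV xi x))).
Proof.
move=> fi; apply: integrable_mul_bounded => //; last by move=> x; exact: normr_sin_le1.
exact: measurableT_comp (measurable_sin) (measurable_dotrV xi).
Qed.

Lemma cosT_lin a f g xi : (lebesgue_rV n).-integrable setT (EFin \o f) ->
  (lebesgue_rV n).-integrable setT (EFin \o g) ->
  cosT (fun x => a * f x + g x) xi = a * cosT f xi + cosT g xi.
Proof.
move=> fi gi; rewrite /cosT; under eq_Rintegral do rewrite mulrDl -mulrA.
have If := integrable_mul_cos xi fi; have Ig := integrable_mul_cos xi gi.
by rewrite RintegralD//; [rewrite RintegralZl|exact: integrableZl_EFin].
Qed.

Lemma sinT_lin a f g xi : (lebesgue_rV n).-integrable setT (EFin \o f) ->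
  (lebesgue_rV n).-integrable setT (EFin \o g) ->
  sinT (fun x => a * f x + g x) xi = a * sinT f xi + sinT g xi.
Proof.
move=> fi gi; rewrite /sinT; under eq_Rintegral do rewrite mulrDl -mulrA.
have If := integrable_mul_sin xi fi; have Ig := integrable_mul_sin xi gi.
by rewrite RintegralD//; [rewrite RintegralZl|exact: integrableZl_EFin].
Qed.

Lemma sqnormC_ge0 (z : R[i]) : 0 <= sqnormC z.
Proof. by rewrite /sqnormC addr_ge0// sqr_ge0. Qed.

Lemma measurable_fourier_Re f : measurable_fun setT f ->
  measurable_fun setT (fun xi => complex.Re (fourier f xi) : measurableTypeR R).
Proof.
move=> mf; rewrite (_ : (fun xi => _) = fun xi => fconst * cosT f xi); last first.
  by apply/funext => xi; rewrite Re_fourier.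
by apply: measurable_funM => //; exact: measurable_cosT.
Qed.

Lemma measurable_fourier_Im f : measurable_fun setT f ->
  measurable_fun setT (fun xi => complex.Im (fourier f xi) : measurableTypeR R).
Proof.
move=> mf; rewrite (_ : (fun xi => _) = fun xi => - (fconst * sinT f xi)); last first.
  by apply/funext => xi; rewrite Im_fourier.
by apply: measurable_funN; apply: measurable_funM => //; exact: measurable_sinT.
Qed.

Definition measurable_complex (g : 'rV[R]_n -> R[i]) :=
  measurable_fun setT (fun xi => complex.Re (g xi) : measurableTypeR R) /\
  measurable_fun setT (fun xi => complex.Im (g xi) : measurableTypeR R).

Lemma measurable_sqnormC (g : 'rV[R]_n -> R[i]) : measurable_complex g ->
  measurable_fun setT (fun xi => sqnormC (g xi) : R).
Proof.
by move=> [mr mi]; apply: measurable_funD; apply: measurable_funX.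
Qed.

Lemma measurable_complexB (g g' : 'rV[R]_n -> R[i]) : measurable_complex g -> measurable_complex g' ->
  measurable_complex (fun xi => g xi - g' xi).
Proof.
have re (z w : R[i]) : complex.Re (z - w) = complex.Re z - complex.Re w by case: z w => a b [].
have im (z w : R[i]) : complex.Im (z - w) = complex.Im z - complex.Im w by case: z w => a b [].
move=> [gr gi] [gr' gi']; split.
  rewrite (_ : (fun xi => _) = fun xi => complex.Re (g xi) - complex.Re (g' xi)); first exact: measurable_funB.
  by apply/funext => xi; rewrite re.
rewrite (_ : (fun xi => _) = fun xi => complex.Im (g xi) - complex.Im (g' xi)); first exact: measurable_funB.
by apply/funext => xi; rewrite im.
Qed.

Lemma measurable_enorm_pow (r : R) : measurable_fun setT (fun xi : 'rV[R]_n => enorm xi `^ r).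
Proof.
apply: (measurableT_comp (measurable_powR r)); exact: measurable_enorm.
Qed.

End fourier_facts.
Arguments fconst {R} n.

Section adjoint.
Context {R : realType} {k n : nat} (A : 'M[R]_(k, n)).
Context (phi : 'rV[R]_k -> R) (psi : 'rV[R]_n -> R).
Hypothesis phi_int : (lebesgue_rV k).-integrable setT (EFin \o phi).
Hypothesis psi_int : (lebesgue_rV n).-integrable setT (EFin \o psi).

Let mdot : measurable_fun setT (fun z : 'rV[R]_k * 'rV[R]_n => dotrV (z.1 *m A) z.2).
Proof.
apply: measurable_dotrV2; last exact: measurable_snd.
exact: (measurableT_comp (measurable_mulmx_rV A) measurable_fst).
Qed.

(** Fubini for the bounded kernel [c (dotrV (x *m A) xi)], read once in [xi] and once in [x]. It
    moves the Fourier transform from the test function [psi] onto the lift, whose transform is thus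
    seen to depend only on [xi *m A^T]. *)
Let adjoint (c : R -> R) : measurable_fun setT c -> (forall x, `|c x| <= 1) ->
  \int[lebesgue_rV k]_x (\int[lebesgue_rV n]_xi (psi xi * c (dotrV (x *m A) xi)) * phi x) =
  \int[lebesgue_rV n]_xi (\int[lebesgue_rV k]_x (phi x * c (dotrV (xi *m A^T) x)) * psi xi).
Proof.
move=> mc c1.
pose F (z : 'rV[R]_k * 'rV[R]_n) := (phi z.1 * psi z.2) * c (dotrV (z.1 *m A) z.2).
have FI : (lebesgue_rV k \x lebesgue_rV n)%E.-integrable setT (EFin \o F).
  by apply: integrable_mul_bounded; [exact: integrable_prod|exact: measurableT_comp mc mdot|].
transitivity (\int[lebesgue_rV k]_x \int[lebesgue_rV n]_xi F (x, xi)).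
  apply: eq_Rintegral => x _; rewrite -RintegralZr//.
    by apply: eq_Rintegral => xi _; rewrite /F/=; ring.
  apply: integrable_mul_bounded => //; apply: measurableT_comp mc _; exact: measurable_dotrV.
rewrite (Rintegral_fubini1 FI) -(Rintegral_fubini2 FI); apply: eq_Rintegral => xi _.
rewrite -RintegralZr//.
  by apply: eq_Rintegral => x _; rewrite /F/= dotrVC dotrV_mulmx; ring.
apply: integrable_mul_bounded => //; apply: measurableT_comp mc _; exact: measurable_dotrV.
Qed.

Lemma cosT_adjoint : \int[lebesgue_rV k]_x (cosT psi (x *m A) * phi x) =
  \int[lebesgue_rV n]_xi (cosT phi (xi *m A^T) * psi xi).
Proof. by apply: adjoint => [|x]; [exact: measurable_cos|exact: normr_cos_le1]. Qed.

Lemma sinT_adjoint : \int[lebesgue_rV k]_x (sinT psi (x *m A) * phi x) =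
  \int[lebesgue_rV n]_xi (sinT phi (xi *m A^T) * psi xi).
Proof. by apply: adjoint => [|x]; [exact: measurable_sin|exact: normr_sin_le1]. Qed.

End adjoint.

Section gauss_fatou.
Context {R : realType} {n : nat}.

(** Integrals not yet known to be finite are bounded with a Gaussian weight, which makes them
    finite; a bound uniform in the weight survives its removal. *)
Lemma gauss_fatou (F : 'rV[R]_n -> R) (V : \bar R) : measurable_fun setT F -> (forall x, 0 <= F x) ->
  (forall s : R, 0 < s -> (\int[lebesgue_rV n]_x (F x * expR (- (dotrV x x / (s ^+ 2 *+ 2))))%:E <= V)%E) ->
  (\int[lebesgue_rV n]_x (F x)%:E <= V)%E.
Proof.
move=> mF F0 FV.
have := @cvg_gauss_weight R n _ _ (lebesgue_rV n) id setT F (@measurable_id _ _ _) measurableT mF F0.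
by move=> c; apply: (cvge_le _ c); apply: nearW => j; exact: FV.
Qed.

End gauss_fatou.

(** * Integration along fibres *)

Section gaussian_integrals.
Context {R : realType} {n : nat}.

Lemma integral_expR_dotrV (s : R) : 0 < s ->
  (\int[lebesgue_rV n]_x (expR (- (dotrV x x / (s ^+ 2 *+ 2))))%:E = ((normal_peak s ^+ n)^-1)%:E)%E.
Proof.
move=> s0; have pk : 0 < normal_peak s ^+ n by rewrite exprn_gt0// normal_peak_gt0 ?gt_eqF.
have -> : (fun x : 'rV[R]_n => (expR (- (dotrV x x / (s ^+ 2 *+ 2))))%:E) =
    (fun x => (normal_peak s ^+ n)^-1%:E * (gauss_rV s x)%:E)%E.
  by apply/funext => x; rewrite gauss_rVE ?gt_eqF// -EFinM mulKf ?gt_eqF.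
rewrite ge0_integralZl ?integral_gauss_rV ?mule1//.
- by apply/measurable_EFinP; exact: measurable_gauss_rV.
- by move=> x _; rewrite lee_fin gauss_rV_ge0.
- by rewrite lee_fin invr_ge0 ltW.
Qed.

Lemma measurable_expR_dotrV (r : R) : measurable_fun setT (fun x : 'rV[R]_n => expR (- (dotrV x x / r))).
Proof.
apply: (measurableT_comp (f := fun y : R => expR (- (y / r)))) => //; last first.
  by apply: measurable_dotrV2; exact: measurable_id.
apply: measurableT_comp => //; apply: (measurable_funN (f := fun y : R => y / r)).
exact: measurable_funM.
Qed.

Lemma integral_expR_shift (s : R) (y : 'rV[R]_n) : 0 < s ->
  (\int[lebesgue_rV n]_x (expR (- (s ^+ 2 * dotrV (y - x) (y - x) / 2)))%:E = ((normal_peak s^-1 ^+ n)^-1)%:E)%E.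
Proof.
move=> s0; have s1 : s^-1 != 0 by rewrite invr_eq0 gt_eqF.
have pk : 0 < normal_peak s^-1 by rewrite normal_peak_gt0.
have -> : (fun x : 'rV[R]_n => (expR (- (s ^+ 2 * dotrV (y - x) (y - x) / 2)))%:E) =
    (fun x => (normal_peak s^-1 ^+ n)^-1%:E * (\prod_(i < n) normal_pdf (y 0 i) s^-1 (x 0 i))%:E)%E.
  apply/funext => x; rewrite -EFinM; congr EFin.
  under eq_bigr do rewrite normal_pdfE// /normal_fun.
  rewrite big_split/= prodr_const card_ord mulKf ?gt_eqF ?exprn_gt0// -expR_sum.
  congr expR; rewrite /dotrV mulr_sumr mulr_suml -sumrN; apply: eq_bigr => i _.
  rewrite !mxE; field; exact: lt0r_neq0.
rewrite ge0_integralZl.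
- rewrite (@ge0_integral_rV_prod R n (fun i x => normal_pdf (y 0 i) s^-1 x)).
  + by rewrite big1 ?mule1// => i _; exact: integral_normal_pdf.
  + by move=> i; exact: measurable_normal_pdf.
  + by move=> i x; exact: normal_pdf_ge0.
- by [].
- apply/measurable_EFinP; apply: measurable_prod => i _; apply: measurableT_comp => //.
    exact: measurable_normal_pdf.
  exact: measurable_rV_coord.
- by move=> x _; rewrite lee_fin; apply: prodr_ge0 => i _; exact: normal_pdf_ge0.
- by rewrite lee_fin invr_ge0 exprn_ge0// ltW.
Qed.

(** [normal_peak s] is a constant over [s]. This cancellation makes the bound in [plancherel_bound]
    independent of the weight. *)
Lemma normal_peak_inv (s : R) : 0 < s -> normal_peak s * normal_peak s^-1 = normal_peak (1 : R) ^+ 2.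
Proof.
move=> s0; rewrite -(div1r s) normal_peak_scale// -{1}(invrK s) -div1r normal_peak_scale ?invr_gt0//.
by rewrite mulrACA mulVf ?gt_eqF// mul1r expr2.
Qed.

End gaussian_integrals.

Lemma integrable_mul_bounded_by d (T : measurableType d) (R : realType) (m : {measure set T -> \bar R}) (f g : T -> R) B :
  m.-integrable setT (EFin \o f) -> measurable_fun setT g -> (forall x, `|g x| <= B) ->
  m.-integrable setT (EFin \o (fun x => f x * g x)).
Proof.
move=> fi mg gB.
have mf : measurable_fun setT f by apply/measurable_EFinP; exact: measurable_int fi.
apply: le_integrable (integrableZl_EFin measurableT B fi) => //.
  by apply/measurable_EFinP; exact: measurable_funM.
move=> x _; rewrite /= lee_fin !normrM mulrC ler_wpM2r//.
exact: le_trans (gB x) (ler_norm _).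
Qed.

Lemma le_normr_Rintegral_mul d (T : measurableType d) (R : realType) (m : {measure set T -> \bar R}) (f g : T -> R) B :
  m.-integrable setT (EFin \o f) -> measurable_fun setT g -> (forall x, `|g x| <= B) ->
  `|\int[m]_x (f x * g x)| <= B * \int[m]_x `|f x|.
Proof.
move=> fi mg gB; have fgi := integrable_mul_bounded_by fi mg gB.
apply: le_trans (le_normr_Rintegral measurableT fgi) _.
have nf : m.-integrable setT (EFin \o (fun x => `|f x|)) by exact: integrable_norm.
rewrite -RintegralZl//; apply: le_Rintegral => //.
- exact: integrable_norm.
- exact: integrableZl_EFin.
- by move=> x _; rewrite normrM mulrC ler_wpM2r.
Qed.

(** * Square integrability of Fourier transforms *)

Section plancherel_bound.
Context {R : realType} {n : nat} (psi : 'rV[R]_n -> R) (M : R).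
Hypothesis psi_int : (lebesgue_rV n).-integrable setT (EFin \o psi).
Hypothesis psi_bnd : forall x, `|psi x| <= M.

Let L := \int[lebesgue_rV n]_x `|psi x|.

Let mpsi : measurable_fun setT psi.
Proof. by apply/measurable_EFinP; exact: measurable_int psi_int. Qed.

Lemma normr_cosT_le xi : `|cosT psi xi| <= L.
Proof.
rewrite -[leRHS]mul1r; apply: le_normr_Rintegral_mul => //; last by move=> x; exact: normr_cos_le1.
exact: measurableT_comp (measurable_cos) (measurable_dotrV xi).
Qed.

Lemma normr_sinT_le xi : `|sinT psi xi| <= L.
Proof.
rewrite -[leRHS]mul1r; apply: le_normr_Rintegral_mul => //; last by move=> x; exact: normr_sin_le1.
exact: measurableT_comp (measurable_sin) (measurable_dotrV xi).
Qed.

Let F b := cosT psi b ^+ 2 + sinT psi b ^+ 2.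

Let mF : measurable_fun setT F.
Proof.
by apply: measurable_funD; apply: measurable_funX; [exact: measurable_cosT|exact: measurable_sinT].
Qed.

(** One factor of each square is expanded as an integral over [y]; what remains is the right-hand
    side of [gauss_smoothing] at [y]. *)
Let gaussF (s : R) : 0 < s -> \int[lebesgue_rV n]_b (gauss_rV s b * F b) =
  \int[lebesgue_rV n]_y (psi y * \int[lebesgue_rV n]_x (psi x * expR (- (s ^+ 2 * dotrV (y - x) (y - x) / 2)))).
Proof.
move=> s0.
pose G (z : 'rV[R]_n * 'rV[R]_n) := (psi z.1 * gauss_rV s z.2) *
  (cos (dotrV z.2 z.1) * cosT psi z.2 + sin (dotrV z.2 z.1) * sinT psi z.2).
have mdot : measurable_fun setT (fun z : 'rV[R]_n * 'rV[R]_n => dotrV z.2 z.1).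
  by apply: measurable_dotrV2; [exact: measurable_snd|exact: measurable_fst].
have GI : (lebesgue_rV n \x lebesgue_rV n)%E.-integrable setT (EFin \o G).
  apply: (@integrable_mul_bounded_by _ _ _ _ _ _ (L + L)).
  - by apply: integrable_prod => //; exact: integrable_gauss_rV.
  - apply: measurable_funD; apply: measurable_funM.
    + exact: measurableT_comp (measurable_cos) mdot.
    + by apply: (measurableT_comp (f := cosT psi)) => //; exact: measurable_cosT.
    + exact: measurableT_comp (measurable_sin) mdot.
    + by apply: (measurableT_comp (f := sinT psi)) => //; exact: measurable_sinT.
  - move=> z; apply: le_trans (ler_normD _ _) _; apply: lerD; rewrite normrM -[leRHS]mul1r.
      by apply: ler_pM => //; [exact: normr_cos_le1|exact: normr_cosT_le].
    by apply: ler_pM => //; [exact: normr_sin_le1|exact: normr_sinT_le].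
transitivity (\int[lebesgue_rV n]_b \int[lebesgue_rV n]_y G (y, b)).
  apply: eq_Rintegral => b _; rewrite /F mulrDr.
  have Ic := integrable_mul_cos b psi_int; have Is := integrable_mul_sin b psi_int.
  transitivity (\int[lebesgue_rV n]_y ((gauss_rV s b * cosT psi b) * (psi y * cos (dotrV b y)) +
                                      (gauss_rV s b * sinT psi b) * (psi y * sin (dotrV b y)))).
    rewrite RintegralD//; [|exact: integrableZl_EFin|exact: integrableZl_EFin].
    by rewrite !RintegralZl// -/(cosT psi b) -/(sinT psi b); ring.
  by apply: eq_Rintegral => y _; rewrite /G/=; ring.
rewrite (Rintegral_fubini2 GI) -(Rintegral_fubini1 GI); apply: eq_Rintegral => y _.
rewrite (@gauss_smoothing _ _ _ (lebesgue_rV n) n id psi (@measurable_id _ _ _) psi_int s y (lt0r_neq0 s0)).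
rewrite -RintegralZl//; last first.
  apply: (@integrable_mul_bounded_by _ _ _ _ _ _ (L + L)); first exact: integrable_gauss_rV.
    apply: measurable_funD; apply: measurable_funM.
    + by apply: measurableT_comp (measurable_cos) _; apply: measurable_dotrV2.
    + exact: measurable_cosT.
    + by apply: measurableT_comp (measurable_sin) _; apply: measurable_dotrV2.
    + exact: measurable_sinT.
  move=> b; apply: le_trans (ler_normD _ _) _; apply: lerD; rewrite normrM -[leRHS]mul1r.
    by apply: ler_pM => //; [exact: normr_cos_le1|exact: normr_cosT_le].
  by apply: ler_pM => //; [exact: normr_sin_le1|exact: normr_sinT_le].
by apply: eq_Rintegral => b _; rewrite /G/= -mulrA.
Qed.

Let inner_le (s : R) (y : 'rV[R]_n) : 0 < s ->
  `|\int[lebesgue_rV n]_x (psi x * expR (- (s ^+ 2 * dotrV (y - x) (y - x) / 2)))| <=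
  M * (normal_peak s^-1 ^+ n)^-1.
Proof.
move=> s0.
have mk : measurable_fun setT (fun x : 'rV[R]_n => dotrV (y - x) (y - x)).
  have E x : dotrV (y - x) (y - x) = dotrV (y - x) y - dotrV (y - x) x.
    by rewrite dotrVC dotrVBl !(dotrVC (y - x)).
  under eq_fun do rewrite E !dotrVBl.
  apply: measurable_funB; apply: measurable_funB; apply: measurable_dotrV2 => //; exact: measurable_cst.
pose e (x : 'rV[R]_n) := expR (- (s ^+ 2 * dotrV (y - x) (y - x) / 2)).
have me : measurable_fun setT e.
  apply: (measurableT_comp (f := fun u : R => expR (- (s ^+ 2 * u / 2)))) => //.
  apply: measurableT_comp => //; apply: (measurable_funN (f := fun u : R => s ^+ 2 * u / 2)).
  by apply: measurable_funM => //; exact: measurable_funM.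
have ei : (lebesgue_rV n).-integrable setT (EFin \o e).
  apply/integrableP; split; first exact/measurable_EFinP.
  under eq_integral do rewrite /= ger0_norm ?expR_ge0//.
  by rewrite integral_expR_shift// ltry.
have := le_normr_Rintegral_mul ei mpsi psi_bnd.
under eq_Rintegral do rewrite mulrC; move=> h; apply: (le_trans h).
rewrite le_eqVlt; apply/orP; left; apply/eqP; congr (_ * _).
under eq_Rintegral do rewrite ger0_norm ?expR_ge0//.
by rewrite /Rintegral integral_expR_shift.
Qed.

(** Only finiteness is needed. By [gaussF] the weighted integral is [psi] paired with its
    convolution by a narrow Gaussian kernel, hence at most [M * L] times the mass of the kernel,
    which the normalisation of the weight cancels up to a constant. *)
Lemma plancherel_bound :
  (\int[lebesgue_rV n]_xi (cosT psi xi ^+ 2 + sinT psi xi ^+ 2)%:E < +oo)%E.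
Proof.
apply: (@le_lt_trans _ _ (M * L * (normal_peak (1 : R) ^+ (2 * n))^-1)%:E); last exact: ltry.
have F0 b : 0 <= F b by rewrite addr_ge0 ?sqr_ge0.
apply: gauss_fatou => // s s0.
have pk : 0 < normal_peak s ^+ n by rewrite exprn_gt0// normal_peak_gt0 ?gt_eqF.
have gFi : (lebesgue_rV n).-integrable setT (EFin \o (fun b => gauss_rV s b * F b)).
  apply: (@integrable_mul_bounded_by _ _ _ _ _ _ (L ^+ 2 + L ^+ 2)) => //; first exact: integrable_gauss_rV.
  move=> b; rewrite ger0_norm// /F -(real_normK (num_real (cosT _ _))) -(real_normK (num_real (sinT _ _))).
  apply: lerD; apply: lerXn2r; rewrite ?nnegrE ?normr_cosT_le ?normr_sinT_le//;
    exact: le_trans (normr_cosT_le 0).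
under eq_integral do rewrite -/(F _).
have -> : (\int[lebesgue_rV n]_x (F x * expR (- (dotrV x x / (s ^+ 2 *+ 2))))%:E =
    ((normal_peak s ^+ n)^-1 * \int[lebesgue_rV n]_b (gauss_rV s b * F b))%:E)%E.
  rewrite EFinM -Rintegral_EFin// -integralZl//.
  by apply: eq_integral => x _; rewrite -EFinM gauss_rVE ?gt_eqF// -mulrA mulKf ?gt_eqF// mulrC.
rewrite lee_fin gaussF// (mulnC 2 n) exprM exprAC -(normal_peak_inv s0) exprMn invfM mulrCA.
apply: ler_wpM2l; first by rewrite invr_ge0 ltW.
apply: le_trans (ler_norm _) _.
have mi : measurable_fun setT (fun y : 'rV[R]_n =>
    \int[lebesgue_rV n]_x (psi x * expR (- (s ^+ 2 * dotrV (y - x) (y - x) / 2)))).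
  have mI : measurable_fun setT (fun z : 'rV[R]_n * 'rV[R]_n =>
      psi z.2 * expR (- (s ^+ 2 * dotrV (z.1 - z.2) (z.1 - z.2) / 2))).
    apply: measurable_funM; first exact: measurableT_comp.
    apply: (measurableT_comp (f := fun u : R => expR (- (s ^+ 2 * u / 2)))).
      apply: measurableT_comp => //; apply: (measurable_funN (f := fun u : R => s ^+ 2 * u / 2)).
      by apply: measurable_funM => //; exact: measurable_funM.
    have E (z : 'rV[R]_n * 'rV[R]_n) : dotrV (z.1 - z.2) (z.1 - z.2) =
        (dotrV z.1 z.1 - dotrV z.2 z.1) - (dotrV z.1 z.2 - dotrV z.2 z.2).
      by rewrite dotrVBl (dotrVC z.1) (dotrVC z.2) !dotrVBl.
    under eq_fun do rewrite E.
    by apply: measurable_funB; apply: measurable_funB; apply: measurable_dotrV2;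
      do ?[exact: measurable_fst|exact: measurable_snd].
  exact: (@measurable_Rintegral _ _ _ _ _ (lebesgue_rV n) _ mI).
apply: le_trans (le_normr_Rintegral_mul psi_int mi (fun y => inner_le y s0)) _.
by rewrite mulrAC.
Qed.

End plancherel_bound.

Section point_null.
Context {R : realType} {k : nat}.

Lemma lebesgue_rV_set1 (x : 'rV[R]_k) : (0 < k)%N -> lebesgue_rV k [set x] = 0%E.
Proof.
move=> k0.
transitivity (lebesgue_rV k [set y | forall i, [set (x 0 i : measurableTypeR R)] (y 0 i)]).
  congr (lebesgue_rV k _); apply/seteqP; split => y /=; first by move=> ->.
  by move=> yx; apply/rowP => i; exact: yx.
have -> := @lebesgue_rV_box R k (fun i => [set (x 0 i : measurableTypeR R)]) (fun i => measurable_set1 _).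
by case: k k0 x => [//|k'] _ x; rewrite big_ord_recl lebesgue_measure_set1 mul0e.
Qed.

Lemma measurable_rV_set1 (x : 'rV[R]_k) : measurable [set x].
Proof.
have cx : closed [set x] by apply: accessible_closed_set1; apply: hausdorff_accessible; exact: norm_hausdorff.
have mC : measurable (~` [set x]) by apply: open_measurable_rV; rewrite openC.
by have := measurableC mC; rewrite setCK.
Qed.

Lemma enorm_gt0 (x : 'rV[R]_k) : x != 0 -> 0 < enorm x.
Proof.
move=> x0; rewrite lt_neqAle enorm_ge0 andbT eq_sym; apply: contra_neq x0 => e0.
have := sqr_enorm x; rewrite e0 expr0n/= => d0.
apply/rowP => i; rewrite mxE; apply/eqP; rewrite -sqrf_eq0 expr2.
by apply/eqP; move/esym/psumr_eq0P: d0; apply => // j _; rewrite -expr2 sqr_ge0.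
Qed.

End point_null.

Section fibre.
Context {R : realType} (k p n : nat) (A : 'M[R]_(k, n)) (K : 'M[R]_(p, n)) (s : R).
Hypothesis kpn : (k + p = n)%N.
Hypothesis k0 : (0 < k)%N.
Hypothesis AA : A *m A^T = 1%:M.
Hypothesis KK : K *m K^T = 1%:M.
Hypothesis AK : A *m K^T = 0.
Hypothesis AKn : A^T *m A + K^T *m K = 1%:M.
Hypothesis s0 : 0 <= s.

(** This is [(1 + |z|^2)^(-s)], in the form that [enorm_recombine_scale] produces. *)
Definition fibre_weight (z : 'rV[R]_p) : R := Num.sqrt (1 + dotrV z z) `^ (2 * - s).

Lemma measurable_fibre_weight : measurable_fun setT fibre_weight.
Proof.
apply: (measurableT_comp (measurable_powR (2 * - s))).
apply: (measurableT_comp (continuous_measurable_fun (@sqrt_continuous R))).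
by apply: measurable_funD => //; apply: measurable_dotrV2; exact: measurable_id.
Qed.

Lemma enorm_recombine_scale (eta : 'rV[R]_k) (z : 'rV[R]_p) :
  enorm (recombine A K (eta, enorm eta *: z)) = enorm eta * Num.sqrt (1 + dotrV z z).
Proof.
rewrite {1}/enorm (dotrV_split AKn) (recombine_proj1 AA AK) (recombine_proj2 KK AK)/=.
rewrite dotrVZl dotrVZr -sqr_enorm.
rewrite (_ : enorm eta ^+ 2 + _ = enorm eta ^+ 2 * (1 + dotrV z z)); last by rewrite mulrA -expr2 mulrDr mulr1.
by rewrite sqrtrM ?sqr_ge0// sqrtr_sqr ger0_norm// enorm_ge0.
Qed.

(** The Jacobian [|eta|^p] of the dilation joins [|eta|^(- 2 s)]. The extra factor [G] accommodates
    the transverse damping in the norm of a mollified function. *)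
Lemma fibre_integral (eta : 'rV[R]_k) (G : 'rV[R]_p -> R) : 0 < enorm eta ->
  measurable_fun setT G -> (forall z, 0 <= G z) ->
  (\int[lebesgue_rV p]_z (enorm (recombine A K (eta, z)) `^ (2 * - s) * G z)%:E =
   (enorm eta `^ (2 * - (s - p%:R / 2)))%:E *
   \int[lebesgue_rV p]_z (fibre_weight z * G (enorm eta *: z))%:E)%E.
Proof.
move=> e0 mG G0.
have mrec : measurable_fun setT (fun z : 'rV[R]_p => recombine A K (eta, z)).
  apply: (measurableT_comp (measurable_recombine A K)).
  by apply: measurable_fun_pair => //; exact: measurable_cst.
rewrite (ge0_integral_rV_scale e0); last 2 first.
- apply/measurable_EFinP; apply: measurable_funM => //.
  by apply: (measurableT_comp (measurable_enorm_pow _)).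
- by move=> z; rewrite lee_fin mulr_ge0// powR_ge0.
under eq_integral do rewrite enorm_recombine_scale powRM ?enorm_ge0 ?sqrtr_ge0// -mulrA EFinM.
rewrite ge0_integralZl//; last 3 first.
- apply/measurable_EFinP; apply: measurable_funM; first exact: measurable_fibre_weight.
  by apply: measurableT_comp => //; exact: measurable_scalerV.
- by move=> z _; rewrite lee_fin mulr_ge0// powR_ge0.
- by rewrite lee_fin powR_ge0.
rewrite muleA -EFinM -powR_mulrn ?enorm_ge0// -powRD ?(gt_eqF e0) ?implybT//.
by congr ((_ `^ _)%:E * _)%E; field.
Qed.

Lemma measurable_fibre_int (G : 'rV[R]_p -> R) : measurable_fun setT G -> (forall z, 0 <= G z) ->
  measurable_fun setT (fun eta : 'rV[R]_k => \int[lebesgue_rV p]_z (fibre_weight z * G (enorm eta *: z))%:E)%E.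
Proof.
move=> mG G0.
pose Psi (z : 'rV[R]_k * 'rV[R]_p) := (fibre_weight z.2 * G (enorm z.1 *: z.2))%:E.
have mPsi : measurable_fun setT Psi.
  apply/measurable_EFinP; apply: measurable_funM.
    exact: (measurableT_comp measurable_fibre_weight measurable_snd).
  apply: measurableT_comp => //; apply: measurable_fun_rV => i.
  rewrite (_ : _ \o _ = fun z : 'rV[R]_k * 'rV[R]_p => enorm z.1 * z.2 0 i); last by apply/funext => z /=; rewrite /rV_coord mxE.
  apply: measurable_funM.
    exact: (measurableT_comp (@measurable_enorm R k) measurable_fst).
  exact: (measurableT_comp (measurable_rV_coord i) measurable_snd).
have Psi0 z : (0 <= Psi z)%E by rewrite lee_fin mulr_ge0// powR_ge0.
exact: (@measurable_fun_fubini_tonelli_F _ _ _ _ _ (lebesgue_rV p) _ mPsi Psi0).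
Qed.

Lemma integral_fibre (F : 'rV[R]_k -> R) (G : 'rV[R]_p -> R) :
  measurable_fun setT F -> (forall x, 0 <= F x) ->
  measurable_fun setT G -> (forall z, 0 <= G z) ->
  (\int[lebesgue_rV n]_xi (enorm xi `^ (2 * - s) * (F (xi *m A^T) * G (xi *m K^T)))%:E =
   \int[lebesgue_rV k]_eta ((enorm eta `^ (2 * - (s - p%:R / 2)) * F eta)%:E *
     \int[lebesgue_rV p]_z (fibre_weight z * G (enorm eta *: z))%:E))%E.
Proof.
move=> mF F0 mG G0.
pose Phi xi := (enorm xi `^ (2 * - s) * (F (xi *m A^T) * G (xi *m K^T)))%:E.
have mPhi : measurable_fun setT Phi.
  apply/measurable_EFinP; apply: measurable_funM; first exact: measurable_enorm_pow.
  by apply: measurable_funM; apply: measurableT_comp => //; exact: measurable_mulmx_rV.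
have Phi0 xi : (0 <= Phi xi)%E by rewrite lee_fin !mulr_ge0// powR_ge0.
have mrec := measurable_recombine A K.
rewrite (ge0_integral_eq_pushforward mrec (lebesgue_rV_recombine kpn AA KK AK AKn) mPhi Phi0).
have mPr : measurable_fun setT (Phi \o recombine A K) by apply: measurableT_comp mPhi mrec.
rewrite fubini_tonelli1//.
apply: ae_eq_integral => //.
- exact: (@measurable_fun_fubini_tonelli_F _ _ _ _ _ (lebesgue_rV p) _ mPr (fun z => Phi0 _)).
- apply: emeasurable_funM.
    apply/measurable_EFinP; apply: measurable_funM => //; exact: measurable_enorm_pow.
  exact: measurable_fibre_int.
(* At [eta = 0] the dilation degenerates; the origin is a null set because [0 < k]. *)
exists [set 0]; split; [exact: measurable_rV_set1|exact: lebesgue_rV_set1|].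
move=> eta /= /not_implyP[_ h]; apply: contrapT => /eqP eta0; apply: h.
rewrite EFinM [X in (X * _)%E]muleC -muleA -fibre_integral//; last exact: enorm_gt0.
rewrite /fubini_F -ge0_integralZl//; last first.
- by rewrite lee_fin.
- by move=> z _; rewrite lee_fin mulr_ge0// powR_ge0.
- apply/measurable_EFinP; apply: measurable_funM => //.
  apply: (measurableT_comp (measurable_enorm_pow _)); apply: (measurableT_comp mrec).
  by apply: measurable_fun_pair => //; exact: measurable_cst.
apply: eq_integral => z _; rewrite /Phi /= (recombine_proj1 AA AK) (recombine_proj2 KK AK)/= -EFinM.
by congr EFin; rewrite mulrCA.
Qed.

End fibre.

Lemma ge0_integralZl_real d (T : measurableType d) (R : realType) (m : {measure set T -> \bar R}) (r : R) (f : T -> R) :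
  measurable_fun setT f -> (forall x, 0 <= f x) -> 0 <= r ->
  (\int[m]_x (r * f x)%:E = r%:E * \int[m]_x (f x)%:E)%E.
Proof.
move=> mf f0 r0; under eq_integral do rewrite EFinM.
by rewrite ge0_integralZl//; [exact/measurable_EFinP|move=> x _; rewrite lee_fin].
Qed.

(** * Finiteness and positivity of the fibre integral *)

Section fibre_const.
Context {R : realType} (p : nat) (s : R).
Hypothesis ps : p%:R < 2 * s.

Let s0 : 0 < s. Proof. by have := le_lt_trans (ler0n R p) ps; rewrite pmulr_rgt0. Qed.

(** A majorant of [fibre_weight] that is exactly homogeneous outside the unit ball, as the halving
    argument requires. *)
Let f (z : 'rV[R]_p) : R := Num.max 1 (enorm z) `^ (2 * - s).
Let E (t : R) (z : 'rV[R]_p) : R := expR (- (dotrV z z / (t ^+ 2 *+ 2))).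

Let mf : measurable_fun setT f.
Proof.
apply: (measurableT_comp (measurable_powR (2 * - s))).
by apply: measurable_maxr => //; exact: measurable_enorm.
Qed.

Let f0 z : 0 <= f z. Proof. exact: powR_ge0. Qed.

Let max1 (z : 'rV[R]_p) : 1 <= Num.max 1 (enorm z). Proof. by rewrite le_max lexx. Qed.

Let powN_anti (a b : R) : 0 < a -> a <= b -> b `^ (2 * - s) <= a `^ (2 * - s).
Proof.
move=> a0 ab; rewrite mulrN !powRN lef_pV2 ?posrE ?powR_gt0 ?(lt_le_trans a0)//.
apply: ge0_ler_powR => //; rewrite ?nnegrE; [by rewrite mulr_ge0// ltW|exact: ltW|exact: le_trans (ltW a0) ab].
Qed.

Let f1 z : f z <= 1.
Proof.
have := powN_anti ltr01 (max1 z); rewrite powR1; exact.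
Qed.

(** Inside the ball of radius 2, [f] is at most 1 and [E 1 z] at least [expR (- 2)]; outside,
    homogeneity relates [z] to its half. *)
Let fsplit z : f z <= expR 2 * E 1 z + 2 `^ (2 * - s) * f (2^-1 *: z).
Proof.
have [z2|z2] := leP (enorm z) 2.
  apply: le_trans (f1 z) _; apply: ler_wpDr; first by rewrite mulr_ge0// powR_ge0.
  rewrite /E -expRD -[leLHS]expR0 ler_expR -sqr_enorm expr1n; have := enorm_ge0 z; nra.
apply: ler_wpDl; first by rewrite mulr_ge0 ?expR_ge0.
have e : enorm z = 2 * enorm (2^-1 *: z).
  by rewrite /enorm dotrVZl dotrVZr mulrA -expr2 sqrtrM ?sqr_ge0// sqrtr_sqr ger0_norm ?invr_ge0// mulVKf.
have e1 : 1 < enorm (2^-1 *: z) by move: z2; rewrite e; lra.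
have e2 : 1 < enorm z by apply: lt_trans z2; rewrite ltr1n.
rewrite /f !max_r ?(ltW e1) ?(ltW e2)//.
by rewrite {1}e powRM ?enorm_ge0.
Qed.

Let Ehalf (t : R) z : 0 < t -> E t z <= E t (2^-1 *: z).
Proof.
move=> t0; rewrite /E ler_expR lerN2 ler_wpM2r ?invr_ge0 ?mulrn_wge0 ?sqr_ge0//.
by rewrite dotrVZl dotrVZr; have := dotrV_ge0 z; lra.
Qed.

Let mE t : measurable_fun setT (E t). Proof. exact: measurable_expR_dotrV. Qed.

Let E0 t z : 0 <= E t z. Proof. exact: expR_ge0. Qed.

Let E1 t z : 0 < t -> E t z <= 1.
Proof.
by move=> t0; rewrite -expR0 ler_expR oppr_le0 mulr_ge0 ?dotrV_ge0// invr_ge0 mulrn_wge0 ?sqr_ge0.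
Qed.

(** The homogeneity factor [2^(- 2 s)] times the Jacobian [2^p]. That it is below 1 is the
    hypothesis [ps]. *)
Let q : R := 2 `^ (p%:R - 2 * s).

Let q1 : q < 1.
Proof.
have l2 : 0 < ln (2 : R) by rewrite ln_gt0 ?ltr1n.
by rewrite /q /powR gt_eqF// expR_lt1 pmulr_llt0 ?subr_lt0.
Qed.

Let V : R := expR 2 * (normal_peak (1 : R) ^+ p)^-1.

Let step (t : R) : 0 < t ->
  (\int[lebesgue_rV p]_z (f z * E t z)%:E <= V%:E + q%:E * \int[lebesgue_rV p]_z (f z * E t z)%:E)%E.
Proof.
move=> t0.
have mfE r r' : measurable_fun setT (fun z : 'rV[R]_p => f (r *: z) * E t (r' *: z)).
  apply: measurable_funM.
    by apply: (measurableT_comp mf); exact: measurable_scalerV.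
  by apply: (measurableT_comp (mE t)); exact: measurable_scalerV.
have mfE1 : measurable_fun setT (fun z : 'rV[R]_p => f z * E t z) by exact: measurable_funM.
have qE : 2 `^ (2 * - s) * 2 ^+ p = q.
  rewrite -powR_mulrn// -powRD; last by rewrite pnatr_eq0 implybT.
  by rewrite /q; congr (_ `^ _); ring.
apply: (@le_trans _ _ (\int[lebesgue_rV p]_z ((expR 2 * E 1 z)%:E +
   (2 `^ (2 * - s))%:E * (f (2^-1 *: z) * E t (2^-1 *: z))%:E))%E).
  apply: ge0_le_integral => //.
  - by move=> z _; rewrite lee_fin mulr_ge0.
  - exact/measurable_EFinP.
  - apply: emeasurable_funD; first by apply/measurable_EFinP; exact: measurable_funM.
    by apply: emeasurable_funM => //; exact/measurable_EFinP.
  move=> z _; rewrite -EFinM -EFinD lee_fin.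
  apply: le_trans (ler_wpM2r (E0 t z) (fsplit z)) _; rewrite mulrDl; apply: lerD.
    by rewrite ler_piMr ?mulr_ge0 ?expR_ge0 ?E1.
  by rewrite -mulrA ler_wpM2l ?powR_ge0// ler_wpM2l// Ehalf.
rewrite ge0_integralD//; first last.
- by apply: emeasurable_funM => //; exact/measurable_EFinP.
- by move=> z _; rewrite mule_ge0 ?lee_fin ?powR_ge0 ?mulr_ge0.
- by apply/measurable_EFinP; exact: measurable_funM.
- by move=> z _; rewrite lee_fin mulr_ge0 ?expR_ge0.
apply: leeD.
  under eq_integral do rewrite EFinM.
  rewrite ge0_integralZl//; first last.
  - by move=> z _; rewrite lee_fin.
  - exact/measurable_EFinP.
  by rewrite integral_expR_dotrV// -EFinM.
under eq_integral do rewrite -EFinM.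
rewrite ge0_integralZl_real ?powR_ge0//; last by move=> z; rewrite mulr_ge0.
have h2 : 0 < (2 : R) by [].
have -> := @ge0_integral_rV_scale R p 2 h2 (fun z => (f (2^-1 *: z) * E t (2^-1 *: z))%:E).
- rewrite muleA -EFinM qE.
  by under eq_integral do rewrite scalerA mulVf// scale1r.
- exact/measurable_EFinP.
- by move=> z; rewrite lee_fin mulr_ge0.
Qed.

(** A replacement for polar coordinates: [step] reads [I <= V + q I] with [q < 1], whence
    [I <= V / (1 - q)]. The subtraction requires [I] finite, which is why [I] carries a Gaussian
    weight until [gauss_fatou] removes it. *)
Lemma fibre_weight_fin : (\int[lebesgue_rV p]_z (fibre_weight s z)%:E < +oo)%E.
Proof.
apply: (@le_lt_trans _ _ (V / (1 - q))%:E); last exact: ltry.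
apply: (@le_trans _ _ (\int[lebesgue_rV p]_z (f z)%:E)%E).
  apply: ge0_le_integral => //.
  - by move=> z _; rewrite lee_fin powR_ge0.
  - by apply/measurable_EFinP; exact: measurable_fibre_weight.
  - exact/measurable_EFinP.
  move=> z _; rewrite lee_fin; apply: powN_anti; first exact: lt_le_trans ltr01 (max1 z).
  rewrite ge_max -{1}sqrtr1 !ler_wsqrtr ?lerDl ?lerDr ?dotrV_ge0//.
apply: gauss_fatou => // t t0; have := step t0.
set I := (\int[_]_z _)%E.
have I0 : (0 <= I)%E by apply: integral_ge0 => z _; rewrite lee_fin mulr_ge0.
have : (I < +oo)%E.
  apply: (@le_lt_trans _ _ (\int[lebesgue_rV p]_z (E t z)%:E)%E).
    apply: ge0_le_integral => //.
    - by move=> z _; rewrite lee_fin mulr_ge0.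
    - by apply/measurable_EFinP; exact: measurable_funM.
    - exact/measurable_EFinP.
    - by move=> z _; rewrite lee_fin ler_piMl.
  by rewrite integral_expR_dotrV// ltry.
move: I I0 => [r| |]//; rewrite lee_fin => r0 _; rewrite -EFinM -EFinD !lee_fin => h.
have aux (a b c : R) : a <= b + c * a -> a * (1 - c) <= b by lra.
have := aux _ _ _ h; rewrite -ler_pdivlMr ?subr_gt0//.
Qed.

(** A positive integrand with integral zero would make the whole space null, against the unit mass
    of the Gaussian. *)
Lemma fibre_weight_pos (G : 'rV[R]_p -> R) : measurable_fun setT G -> (forall z, 0 < G z) ->
  (0 < \int[lebesgue_rV p]_z (fibre_weight s z * G z)%:E)%E.
Proof.
move=> mG G0; rewrite lt0e.
have W0 z : 0 < fibre_weight s z * G z.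
  by rewrite mulr_gt0// powR_gt0// sqrtr_gt0 ltr_pwDl ?dotrV_ge0.
apply/andP; split; last by apply: integral_ge0 => z _; rewrite lee_fin ltW.
apply/eqP => I0.
have : ae_eq (lebesgue_rV p) setT (fun z => (fibre_weight s z * G z)%:E) (cst 0%E).
  apply/ae_eq_integral_abs => //.
    apply/measurable_EFinP; apply: measurable_funM => //; exact: measurable_fibre_weight.
  by under eq_integral do rewrite gee0_abs ?lee_fin ?ltW//.
move=> [N [mN N0 NT]].
have NTT : N = setT.
  apply/seteqP; split => // z _; apply: NT => /= /(_ I) [] e; have := W0 z.
  by rewrite e ltxx.
have := @integral_gauss_rV R p 1.
have mg : measurable_fun setT (fun z : 'rV[R]_p => (gauss_rV 1 z)%:E).
  by apply/measurable_EFinP; exact: measurable_gauss_rV.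
rewrite null_set_integral//; first by move/esym/eqP; rewrite onee_eq0.
by rewrite -NTT.
Qed.

End fibre_const.

(** * Mollified lifts *)

Section vanishing_moments.
Context {R : realType} (k : nat) (H : R) (phi : 'rV[R]_k -> R).
Hypothesis phi_mom : schwartz_mom H phi.

(** [q] stands for a polynomial of degree at most [N], which uses up [N] of the moment order [H];
    the monomial [c] is the part still to be spent. *)
Let vanish (N : nat) (q : 'rV[R]_k -> R) := [/\ measurable_fun setT q, polybound q &
  forall c : 'I_k -> nat, (\sum_(i < k) c i + N)%:R <= H ->
    \int[lebesgue_rV k]_x (monomial c x * (q x * phi x)) = 0].

Let vanish1 : vanish 0 (fun=> 1).
Proof.
split; [exact: measurable_cst|exact: polybound_cst|move=> c].
by rewrite addn0 => cH; under eq_Rintegral do rewrite mul1r; exact: (phi_mom.2 c cH).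
Qed.

Let monomial_incr (c : 'I_k -> nat) (j : 'I_k) (x : 'rV[R]_k) :
  monomial (fun i => c i + (i == j))%N x = x 0 j * monomial c x.
Proof.
rewrite /monomial (bigD1 j)//= eqxx addn1 exprS -mulrA; congr (_ * _).
rewrite [RHS](bigD1 j)//=; congr (_ * _); apply: eq_bigr => i ij.
by rewrite (negPf ij) addn0.
Qed.

Let vanish_affine N q (a : 'rV[R]_k) (t : R) : vanish N q -> vanish N.+1 (fun x => (dotrV a x + t) * q x).
Proof.
move=> [mq pq vq]; have sphi := phi_mom.1.
have ma : measurable_fun setT (fun x => dotrV a x + t).
  by apply: measurable_funD => //; exact: measurable_dotrV.
have pa : polybound (fun x => dotrV a x + t).
  apply: polyboundD; last exact: polybound_cst.
  by apply: polynomial_fun_polybound; exact: polynomial_fun_dotrV.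
split; [exact: measurable_funM|exact: polyboundM|move=> c cH].
have cH' : (\sum_(i < k) c i + N)%:R <= H by apply: le_trans cH; rewrite ler_nat addnS.
have Iq (c' : 'I_k -> nat) : (lebesgue_rV k).-integrable setT (EFin \o (fun x => monomial c' x * (q x * phi x))).
  rewrite (_ : EFin \o _ = EFin \o (fun x => (monomial c' x * q x) * phi x)); last first.
    by apply/funext => x /=; rewrite mulrA.
  apply: integrable_polybound_schwartz => //; first by apply: measurable_funM => //; exact: measurable_monomial.
  by apply: polyboundM => //; exact: polybound_monomial.
have split_int (l : seq 'I_k) :
    (lebesgue_rV k).-integrable setT (EFin \o (fun x : 'rV[R]_k => (\sum_(j <- l) a 0 j * x 0 j) * (monomial c x * (q x * phi x)))) /\
    \int[lebesgue_rV k]_x ((\sum_(j <- l) a 0 j * x 0 j) * (monomial c x * (q x * phi x))) = 0.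
  elim: l => [|j l [IHi IH]].
    rewrite (_ : (fun x => _) = fun=> 0); last by apply/funext => x; rewrite big_nil mul0r.
    by split; [exact: integrable0|rewrite /Rintegral integral0].
  rewrite (_ : (fun x => _) = fun x => a 0 j * (monomial (fun i => c i + (i == j))%N x * (q x * phi x)) +
     (\sum_(j <- l) a 0 j * x 0 j) * (monomial c x * (q x * phi x))); last first.
    by apply/funext => x; rewrite big_cons mulrDl monomial_incr -!mulrA.
  split; first by apply: integrableD_EFin => //; apply: integrableZl_EFin => //; exact: Iq.
  rewrite RintegralD//; last by apply: integrableZl_EFin => //; exact: Iq.
  have J := Iq (fun i => c i + (i == j))%N.
  rewrite IH addr0 RintegralZl//.
  rewrite vq ?mulr0//; apply: le_trans cH; rewrite ler_nat big_split/= addnS -addSn leq_add2r.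
  rewrite -addn1 leq_add2l (bigD1 j)//= eqxx big1 ?addn0// => i ij.
  by rewrite (negPf ij).
have [Ii I0] := split_int (index_enum _).
transitivity (\int[lebesgue_rV k]_x ((\sum_(j < k) a 0 j * x 0 j) * (monomial c x * (q x * phi x)) +
    t * (monomial c x * (q x * phi x)))).
  by apply: eq_Rintegral => x _; rewrite /dotrV; ring.
rewrite RintegralD//; last by apply: integrableZl_EFin => //; exact: Iq.
by rewrite I0 add0r RintegralZl ?vq ?mulr0//; exact: Iq.
Qed.

Let vanish_pow N q a t m : vanish N q -> vanish (m + N) (fun x => (dotrV a x + t) ^+ m * q x).
Proof.
elim: m => [|m IH] vq; first by under eq_fun do rewrite expr0 mul1r.
by rewrite addSn; under eq_fun do rewrite exprS -mulrA; exact: (vanish_affine a t (IH vq)).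
Qed.

(** A monomial on [R^n] restricted to a translate of the subspace is a product of affine forms in
    its [k] coordinates, of no larger degree; such products are still orthogonal to [phi]. *)
Lemma vanishing_affine_moments n (a : 'I_n -> 'rV[R]_k) (t : 'I_n -> R) (b : 'I_n -> nat) :
  (\sum_(i < n) b i)%:R <= H ->
  (lebesgue_rV k).-integrable setT (EFin \o (fun x => \prod_(i < n) (dotrV (a i) x + t i) ^+ b i * phi x)) /\
  \int[lebesgue_rV k]_x (\prod_(i < n) (dotrV (a i) x + t i) ^+ b i * phi x) = 0.
Proof.
move=> bH.
have V (l : seq 'I_n) : vanish (\sum_(i <- l) b i) (fun x => \prod_(i <- l) (dotrV (a i) x + t i) ^+ b i).
  elim: l => [|i l IH].
    by rewrite big_nil (_ : (fun x => _) = fun=> 1)//; apply/funext => x; rewrite big_nil.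
  rewrite big_cons (_ : (fun x => _) = fun x => (dotrV (a i) x + t i) ^+ b i * \prod_(i <- l) (dotrV (a i) x + t i) ^+ b i).
    exact: vanish_pow.
  by apply/funext => x; rewrite big_cons.
have [mq pq /(_ (fun=> 0%N)) H0] := V (index_enum _).
split; first exact: integrable_polybound_schwartz mq pq phi_mom.1.
move: H0; rewrite big1// add0n => /(_ bH) <-; apply: eq_Rintegral => x _.
have -> : @monomial R k (fun=> 0%N) x = 1 by rewrite /monomial big1.
by rewrite mul1r.
Qed.

End vanishing_moments.

Section mollify.
Context {R : realType} (k p n : nat) (A : 'M[R]_(k, n)) (K : 'M[R]_(p, n)).
Hypothesis kpn : (k + p = n)%N.
Hypothesis AA : A *m A^T = 1%:M.
Hypothesis KK : K *m K^T = 1%:M.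
Hypothesis AK : A *m K^T = 0.
Hypothesis AKn : A^T *m A + K^T *m K = 1%:M.

Definition mollify (e : R) (phi : 'rV[R]_k -> R) (x : 'rV[R]_n) : R :=
  phi (x *m A^T) * gauss_rV e (x *m K^T).

Let LR := lebesgue_rV_recombine kpn AA KK AK AKn.
Let mrec := measurable_recombine A K.

Lemma oneDenorm_split (x : 'rV[R]_n) :
  1 + enorm x <= (1 + enorm (x *m A^T)) * (1 + enorm (x *m K^T)).
Proof.
have h : enorm x ^+ 2 = enorm (x *m A^T) ^+ 2 + enorm (x *m K^T) ^+ 2.
  by rewrite !sqr_enorm (dotrV_split AKn).
have x0 := enorm_ge0 x; have a0 := enorm_ge0 (x *m A^T); have b0 := enorm_ge0 (x *m K^T).
move: h x0 a0 b0; set u := enorm x; set a := enorm _; set b := enorm _ => h u0 a0 b0.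
have : u <= a + b by rewrite -(@ler_pXn2r _ 2)// ?nnegrE ?addr_ge0//; nra.
have := mulr_ge0 a0 b0; nra.
Qed.

Lemma schwartz_mollify e phi : 0 < e -> schwartz phi -> schwartz (mollify e phi).
Proof.
move=> e0 sphi; apply: (schwartz_prod oneDenorm_split) => //; exact: schwartz_gauss.
Qed.

Lemma mollify_recombine e phi z : mollify e phi (recombine A K z) = phi z.1 * gauss_rV e z.2.
Proof. by rewrite /mollify (recombine_proj1 AA AK) (recombine_proj2 KK AK). Qed.

(** With the transverse variable integrated last, the moment already vanishes on each slice by
    [vanishing_affine_moments]. *)
Lemma schwartz_mom_mollify (H e : R) phi : 0 < e -> schwartz_mom H phi -> schwartz_mom H (mollify e phi).
Proof.
move=> e0 mphi; have sphi := mphi.1; have sm := schwartz_mollify e0 sphi.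
split => // b bH.
have I := integrable_polybound_schwartz (measurable_monomial b) (polybound_monomial b) sm.
have mI : measurable_fun setT (fun x => monomial b x * mollify e phi x).
  by apply/measurable_EFinP; exact: measurable_int I.
rewrite (Rintegral_eq_pushforward mrec LR mI).
have Ir := integrable_eq_pushforward mrec LR I.
rewrite -(Rintegral_fubini2 Ir).
under eq_Rintegral => z _.
  rewrite (_ : \int[_]_x _ = 0); first over.
  transitivity (gauss_rV e z * \int[lebesgue_rV k]_x
     (\prod_(i < n) (dotrV (\row_j A j i) x + (z *m K) 0 i) ^+ b i * phi x)); last first.
    by rewrite (vanishing_affine_moments mphi _ _ bH).2 mulr0.
  rewrite -RintegralZl//; last exact: (vanishing_affine_moments mphi _ _ bH).1.
  apply: eq_Rintegral => x _ /=; rewrite mollify_recombine/=.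
  have -> : monomial b (recombine A K (x, z)) = \prod_(i < n) (dotrV (\row_j A j i) x + (z *m K) 0 i) ^+ b i.
    apply: eq_bigr => i _; rewrite /recombine !mxE; congr ((_ + _) ^+ _).
    by apply: eq_bigr => j _; rewrite !mxE mulrC.
  ring.
by rewrite /Rintegral integral0.
Qed.

Definition moll_const : R := (2 * pi) `^ (- (p%:R / 2)).

Lemma moll_const_gt0 : 0 < moll_const.
Proof. by rewrite powR_gt0// mulr_gt0// pi_gt0. Qed.

Lemma fconst_split : fconst n = fconst k * moll_const :> R.
Proof.
rewrite /fconst /moll_const -powRD; last by rewrite [X in _ ==> ~~ X]gt_eqF ?implybT// mulr_gt0// pi_gt0.
by congr (_ `^ _); rewrite -kpn natrD; field.
Qed.

(** The characteristic function of [gauss_rV e]: what mollification does to the lift on the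
    frequency side. *)
Definition gauss_damp (e : R) (z : 'rV[R]_p) : R := expR (- (e ^+ 2 * dotrV z z / 2)).

Let cf_mollify e phi (xi : 'rV[R]_n) : 0 < e -> (lebesgue_rV k).-integrable setT (EFin \o phi) ->
  cosT (mollify e phi) xi = cosT phi (xi *m A^T) * gauss_damp e (xi *m K^T) /\
  sinT (mollify e phi) xi = sinT phi (xi *m A^T) * gauss_damp e (xi *m K^T).
Proof.
move=> e0 phii; have e1 := lt0r_neq0 e0.
have mphi : measurable_fun setT phi by apply/measurable_EFinP; exact: measurable_int phii.
have mm : measurable_fun setT (mollify e phi).
  apply: measurable_funM; first by apply: measurableT_comp => //; exact: measurable_mulmx_rV.
  by apply: measurableT_comp; [exact: measurable_gauss_rV|exact: measurable_mulmx_rV].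
set eta := xi *m A^T; set zeta := xi *m K^T.
have Ic := integrable_mul_cos eta phii; have Is := integrable_mul_sin eta phii.
have gi := integrable_gauss_rV p e.
have Gc := integrable_mul_cos zeta gi; have Gs := integrable_mul_sin zeta gi.
have [gc gs] := gauss_rV_cf zeta e1.
have mI c : measurable_fun setT c -> measurable_fun setT (fun x => mollify e phi x * c (dotrV xi x)).
  by move=> mc; apply: measurable_funM => //; apply: measurableT_comp => //; exact: measurable_dotrV.
have cE : cosT (mollify e phi) xi = \int[(lebesgue_rV k \x lebesgue_rV p)%E]_z
   ((phi z.1 * cos (dotrV eta z.1)) * (gauss_rV e z.2 * cos (dotrV zeta z.2)) -
    (phi z.1 * sin (dotrV eta z.1)) * (gauss_rV e z.2 * sin (dotrV zeta z.2))).
  rewrite /cosT (Rintegral_eq_pushforward mrec LR (mI _ measurable_cos)).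
  apply: eq_Rintegral => z _; rewrite mollify_recombine dotrV_recombine cosD.
  by rewrite mulrBr; congr (_ - _); rewrite mulrACA.
have sE : sinT (mollify e phi) xi = \int[(lebesgue_rV k \x lebesgue_rV p)%E]_z
   ((phi z.1 * sin (dotrV eta z.1)) * (gauss_rV e z.2 * cos (dotrV zeta z.2)) +
    (phi z.1 * cos (dotrV eta z.1)) * (gauss_rV e z.2 * sin (dotrV zeta z.2))).
  rewrite /sinT (Rintegral_eq_pushforward mrec LR (mI _ measurable_sin)).
  apply: eq_Rintegral => z _; rewrite mollify_recombine dotrV_recombine sinD.
  by rewrite mulrDr; congr (_ + _); rewrite mulrACA.
split.
  rewrite cE RintegralB//; [|exact: (integrable_prod Ic Gc)|exact: (integrable_prod Is Gs)].
  by rewrite (Rintegral_prod Ic Gc) (Rintegral_prod Is Gs) gc gs mulr0 subr0.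
rewrite sE RintegralD//; [|exact: (integrable_prod Is Gc)|exact: (integrable_prod Ic Gs)].
by rewrite (Rintegral_prod Is Gc) (Rintegral_prod Ic Gs) gc gs mulr0 addr0.
Qed.

(** The candidate for the Fourier transform of the lift; [hdot_lift_test] confirms it. *)
Definition lift_fourier (phi : 'rV[R]_k -> R) (xi : 'rV[R]_n) : R[i] :=
  (moll_const%:C * fourier phi (xi *m A^T))%C.

Lemma Re_lift_fourier phi xi : complex.Re (lift_fourier phi xi) = fconst n * cosT phi (xi *m A^T).
Proof.
rewrite /lift_fourier; have := Re_fourier phi (xi *m A^T); case: (fourier _ _) => u v /= ->.
by rewrite mul0r subr0 fconst_split; ring.
Qed.

Lemma Im_lift_fourier phi xi : complex.Im (lift_fourier phi xi) = - (fconst n * sinT phi (xi *m A^T)).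
Proof.
rewrite /lift_fourier; have := Im_fourier phi (xi *m A^T); case: (fourier _ _) => u v /= ->.
by rewrite mul0r addr0 fconst_split; ring.
Qed.

Lemma sqnormC_lift_fourier phi xi :
  sqnormC (lift_fourier phi xi) = moll_const ^+ 2 * sqnormC (fourier phi (xi *m A^T)).
Proof.
rewrite {1}/sqnormC Re_lift_fourier Im_lift_fourier sqnormC_fourier fconst_split; ring.
Qed.

Lemma measurable_lift_fourier phi : measurable_fun setT phi -> measurable_complex (lift_fourier phi).
Proof.
move=> mphi; split.
  rewrite (_ : (fun xi => _) = fun xi => fconst n * cosT phi (xi *m A^T)).
    by apply: measurable_funM => //; apply: measurableT_comp; [exact: measurable_cosT|exact: measurable_mulmx_rV].
  by apply/funext => xi; rewrite Re_lift_fourier.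
rewrite (_ : (fun xi => _) = fun xi => - (fconst n * sinT phi (xi *m A^T))).
  apply: measurable_funN; apply: measurable_funM => //.
  by apply: measurableT_comp; [exact: measurable_sinT|exact: measurable_mulmx_rV].
by apply/funext => xi; rewrite Im_lift_fourier.
Qed.

Lemma sqnormC_fourier_mollify e phi xi : 0 < e -> (lebesgue_rV k).-integrable setT (EFin \o phi) ->
  sqnormC (fourier (mollify e phi) xi) = sqnormC (lift_fourier phi xi) * gauss_damp e (xi *m K^T) ^+ 2.
Proof.
move=> e0 phii; have [cE sE] := cf_mollify xi e0 phii.
rewrite sqnormC_fourier cE sE {1}/sqnormC Re_lift_fourier Im_lift_fourier; ring.
Qed.

Lemma sqnormC_fourier_mollifyB e phi xi : 0 < e -> (lebesgue_rV k).-integrable setT (EFin \o phi) ->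
  sqnormC (fourier (mollify e phi) xi - lift_fourier phi xi) =
  sqnormC (lift_fourier phi xi) * (1 - gauss_damp e (xi *m K^T)) ^+ 2.
Proof.
move=> e0 phii; have [cE sE] := cf_mollify xi e0 phii.
have Rf := Re_fourier (mollify e phi) xi; have If := Im_fourier (mollify e phi) xi.
have Rl := Re_lift_fourier phi xi; have Il := Im_lift_fourier phi xi.
rewrite {2}/sqnormC Rl Il.
move: Rf If Rl Il; case: (fourier _ _) => u v; case: (lift_fourier _ _) => u' v' /=.
rewrite cE sE => -> -> -> ->; rewrite /sqnormC/=; ring.
Qed.

End mollify.

(** * The Sobolev norm of a lifted test function *)

Section lift.
Context {R : realType} (k p n : nat) (A : 'M[R]_(k, n)) (K : 'M[R]_(p, n)) (s : R).
Hypothesis kpn : (k + p = n)%N.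
Hypothesis k0 : (0 < k)%N.
Hypothesis AA : A *m A^T = 1%:M.
Hypothesis KK : K *m K^T = 1%:M.
Hypothesis AK : A *m K^T = 0.
Hypothesis AKn : A^T *m A + K^T *m K = 1%:M.
Hypothesis ps : p%:R < 2 * s.
Implicit Types (phi : 'rV[R]_k -> R).

Local Notation moll e := (mollify A K e).
Local Notation lf := (lift_fourier p A).

Let s' := s - p%:R / 2.

Let s'0 : 0 < s'.
Proof. by rewrite subr_gt0 ltr_pdivrMr// mulrC. Qed.

Definition fibre_const : R := fine (\int[lebesgue_rV p]_z (fibre_weight s z)%:E).

Let W0 (z : 'rV[R]_p) : 0 <= fibre_weight s z. Proof. exact: powR_ge0. Qed.
Let mW : measurable_fun setT (@fibre_weight R p s). Proof. exact: measurable_fibre_weight. Qed.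

Lemma fibre_constE : (\int[lebesgue_rV p]_z (fibre_weight s z)%:E = fibre_const%:E)%E.
Proof.
rewrite /fibre_const fineK// ge0_fin_numE ?fibre_weight_fin//.
by apply: integral_ge0 => z _; rewrite lee_fin.
Qed.

Lemma fibre_const_gt0 : 0 < fibre_const.
Proof.
have := @fibre_weight_pos R p s (fun=> 1) (@measurable_cst _ _ _ _ _ _) (fun=> ltr01).
by under eq_integral do rewrite mulr1; rewrite fibre_constE lte_fin.
Qed.

(** [integral_fibre] with [G = 1]. The identity holds in the extended reals, so it may be used
    before either side is known to be finite. *)
Lemma wL2norm2_lift_fourier phi : measurable_fun setT phi ->
  wL2norm2 (- s) (lf phi) = ((moll_const p ^+ 2 * fibre_const)%:E * hdot_norm2 (- s') phi)%E.
Proof.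
move=> mphi.
have mF : measurable_fun setT (fun eta => sqnormC (fourier phi eta) : R).
  by apply: measurable_sqnormC; split; [exact: measurable_fourier_Re|exact: measurable_fourier_Im].
rewrite /wL2norm2; under eq_integral do rewrite (sqnormC_lift_fourier A kpn) mulrCA.
rewrite ge0_integralZl_real ?sqr_ge0//; first last.
- by move=> xi; rewrite mulr_ge0 ?powR_ge0 ?sqnormC_ge0.
- apply: measurable_funM; first exact: measurable_enorm_pow.
  by apply: (measurableT_comp mF); exact: measurable_mulmx_rV.
rewrite (EFinM (moll_const p ^+ 2)) -muleA; congr (_ * _)%E.
have := @integral_fibre R k p n A K s kpn k0 AA KK AK AKn (fun eta => sqnormC (fourier phi eta)) (fun=> 1).
move=> IF; apply: etrans (etrans (IF _ _ _ _) _) => //.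
- by apply: eq_integral => xi _; rewrite mulr1.
- by move=> x; exact: sqnormC_ge0.
under eq_integral.
  move=> eta _; under eq_integral do rewrite mulr1.
  rewrite fibre_constE muleC; over.
rewrite ge0_integralZl//.
- by apply/measurable_EFinP; apply: measurable_funM => //; exact: measurable_enorm_pow.
- by move=> x _; rewrite lee_fin mulr_ge0 ?powR_ge0 ?sqnormC_ge0.
- by rewrite lee_fin ltW// fibre_const_gt0.
Qed.

Lemma gauss_damp_le1 e (z : 'rV[R]_p) : gauss_damp e z <= 1.
Proof.
by rewrite /gauss_damp -expR0 ler_expR oppr_le0 mulr_ge0// mulr_ge0 ?sqr_ge0// dotrV_ge0.
Qed.

Lemma gauss_damp_gt0 e (z : 'rV[R]_p) : 0 < gauss_damp e z.
Proof. exact: expR_gt0. Qed.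

Lemma measurable_gauss_damp e : measurable_fun setT (@gauss_damp R p e).
Proof.
apply: (measurableT_comp (f := fun u : R => expR (- (e ^+ 2 * u / 2)))).
  apply: measurableT_comp => //; apply: (measurable_funN (f := fun u : R => e ^+ 2 * u / 2)).
  by apply: measurable_funM => //; exact: measurable_funM.
by apply: measurable_dotrV2; exact: measurable_id.
Qed.

Lemma gauss_damp_scale e r (z : 'rV[R]_p) : 0 <= r <= 1 -> gauss_damp e z <= gauss_damp e (r *: z).
Proof.
move=> /andP[r0 r1]; rewrite /gauss_damp ler_expR lerN2 ler_wpM2r// ler_wpM2l ?sqr_ge0//.
by rewrite dotrVZl dotrVZr mulrA ler_piMl ?dotrV_ge0// mulr_ile1.
Qed.

(* Near the origin, finiteness is read off a mollification of [phi], whose norm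
   weighs [eta] by at least a constant times [|eta| ^ (- 2 s')] when [|eta| <= 1]. *)
Lemma hdot_norm2_fin phi : schwartz phi -> (hdot_norm2 (- s) (moll 1 phi) < +oo)%E ->
  (hdot_norm2 (- s') phi < +oo)%E.
Proof.
move=> sphi.
have phii := schwartz_integrable sphi.
have mphi := schwartz_measurable sphi.
pose F eta := sqnormC (fourier phi eta) : R.
have F0 eta : 0 <= F eta by exact: sqnormC_ge0.
have mF : measurable_fun setT F.
  by apply: measurable_sqnormC; split; [exact: measurable_fourier_Re|exact: measurable_fourier_Im].
pose G (z : 'rV[R]_p) := gauss_damp 1 z ^+ 2.
have G0 z : 0 < G z by rewrite exprn_gt0// gauss_damp_gt0.
have mG : measurable_fun setT G by apply: measurable_funX; exact: measurable_gauss_damp.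
have mGr (r : R) : measurable_fun setT (fun z : 'rV[R]_p => G (r *: z)).
  by apply: measurableT_comp => //; exact: measurable_scalerV.
have c10 := @fibre_weight_pos R p s G mG G0.
(* The damped fibre integral at [|eta| = 1]. It bounds those with [|eta| <= 1] from below, because
   contracting [z] weakens the damping. *)
pose c1 := fine (\int[lebesgue_rV p]_z (fibre_weight s z * G z)%:E).
have c1E : (\int[lebesgue_rV p]_z (fibre_weight s z * G z)%:E = c1%:E)%E.
  rewrite /c1 fineK// ge0_fin_numE ?ltW//; apply: le_lt_trans (fibre_weight_fin ps).
  apply: ge0_le_integral => //.
  - by move=> z _; rewrite lee_fin mulr_ge0// ltW.
  - by apply/measurable_EFinP; exact: measurable_funM.
  - exact/measurable_EFinP.
  - by move=> z _; rewrite lee_fin ler_piMr// exprn_ile1 ?gauss_damp_le1// ltW// gauss_damp_gt0.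
have {}c10 : 0 < c1 by move: c10; rewrite c1E lte_fin.
have -> : hdot_norm2 (- s) (moll 1 phi) = ((moll_const p ^+ 2)%:E *
   \int[lebesgue_rV k]_eta ((enorm eta `^ (2 * - s') * F eta)%:E *
     \int[lebesgue_rV p]_z (fibre_weight s z * G (enorm eta *: z))%:E))%E.
  rewrite -(@integral_fibre R k p n A K s kpn k0 AA KK AK AKn)//; last by move=> z; rewrite ltW.
  rewrite -ge0_integralZl_real ?sqr_ge0//; last 2 first.
  - apply: measurable_funM; first exact: measurable_enorm_pow.
    by apply: measurable_funM; apply: measurableT_comp => //; exact: measurable_mulmx_rV.
  - by move=> xi; rewrite mulr_ge0 ?powR_ge0// mulr_ge0// ltW.
  apply: eq_integral => xi _; congr EFin.
  rewrite (sqnormC_fourier_mollify kpn AA KK AK AKn)// (sqnormC_lift_fourier A kpn) -/(F _) -/(G _).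
  ring.
have mc0 : 0 < moll_const p ^+ 2 :> R by rewrite exprn_gt0// moll_const_gt0.
set I := (\int[_]_eta (_ * _))%E => Ioo.
have {}Ioo : (I < +oo)%E.
  rewrite ltey; apply/eqP => Iy; move: Ioo.
  by rewrite Iy gt0_muley ?lte_fin// ltxx.
have I0 : (0 <= I)%E.
  apply: integral_ge0 => eta _; rewrite mule_ge0 ?lee_fin ?mulr_ge0 ?powR_ge0//.
  by apply: integral_ge0 => z _; rewrite lee_fin mulr_ge0// ltW.
have mI : measurable_fun setT (fun eta : 'rV[R]_k => ((enorm eta `^ (2 * - s') * F eta)%:E *
     \int[lebesgue_rV p]_z (fibre_weight s z * G (enorm eta *: z))%:E)%E).
  apply: emeasurable_funM; first by apply/measurable_EFinP; apply: measurable_funM => //; exact: measurable_enorm_pow.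
  by apply: measurable_fibre_int => // z; rewrite ltW.
(* For [|eta| > 1] the weight [|eta|^(- 2 s')] is at most 1, so square integrability of the
   transform settles the high frequencies. *)
have Foo : (\int[lebesgue_rV k]_eta (F eta)%:E < +oo)%E.
  have [M phiM] := rapid_bounded (schwartz_rapid sphi).
  under eq_integral do rewrite /F sqnormC_fourier.
  rewrite ge0_integralZl_real ?sqr_ge0//; first last.
  - by move=> eta; rewrite addr_ge0 ?sqr_ge0.
  - by apply: measurable_funD; apply: measurable_funX; [exact: measurable_cosT|exact: measurable_sinT].
  by apply: lte_mul_pinfty; rewrite ?lee_fin ?sqr_ge0//; exact: plancherel_bound phii phiM.
have P0 eta : (0 <= c1^-1%:E * ((enorm eta `^ (2 * - s') * F eta)%:E *
    \int[lebesgue_rV p]_z (fibre_weight s z * G (enorm eta *: z))%:E))%E.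
  apply: mule_ge0; first by rewrite lee_fin invr_ge0 ltW.
  apply: mule_ge0; first by rewrite lee_fin mulr_ge0 ?powR_ge0.
  by apply: integral_ge0 => z _; rewrite lee_fin mulr_ge0// ltW.
rewrite /hdot_norm2 /wL2norm2.
(* The sum of the low and high frequency majorants; each is nonnegative everywhere, so no domain has
   to be split. *)
apply: (@le_lt_trans _ _ (\int[lebesgue_rV k]_eta (c1^-1%:E *
   ((enorm eta `^ (2 * - s') * F eta)%:E *
     \int[lebesgue_rV p]_z (fibre_weight s z * G (enorm eta *: z))%:E) + (F eta)%:E))%E).
  apply: ge0_le_integral => //.
  - by move=> eta _; rewrite lee_fin mulr_ge0 ?powR_ge0// F0.
  - by apply/measurable_EFinP; apply: measurable_funM => //; exact: measurable_enorm_pow.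
  - by apply: emeasurable_funD; [exact: emeasurable_funM|exact/measurable_EFinP].
  move=> eta _; have [e1|e1] := leP (enorm eta) 1.
    rewrite -[leLHS]adde0; apply: leeD; last by rewrite lee_fin.
    rewrite muleCA -[leLHS]mule1 lee_wpmul2l ?lee_fin ?mulr_ge0 ?powR_ge0 ?sqnormC_ge0//.
    apply: (@le_trans _ _ (c1^-1%:E * c1%:E)%E); first by rewrite -EFinM mulVf ?gt_eqF.
    apply: lee_wpmul2l; first by rewrite lee_fin invr_ge0 ltW.
    rewrite -c1E; apply: ge0_le_integral => //.
    - by move=> z _; rewrite lee_fin mulr_ge0// ltW.
    - by apply/measurable_EFinP; exact: measurable_funM.
    - by apply/measurable_EFinP; exact: measurable_funM.
    move=> z _; rewrite lee_fin ler_wpM2l// /G; apply: lerXn2r; rewrite ?nnegrE; [exact/ltW/gauss_damp_gt0|exact/ltW/gauss_damp_gt0|].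
    by apply: gauss_damp_scale; rewrite enorm_ge0.
  rewrite -[leLHS]add0e; apply: leeD.
    exact: P0.
  rewrite lee_fin -/(F eta) ler_piMl// mulrN powRN invf_le1 ?powR_gt0 ?(lt_trans ltr01)//.
  by have := ler_powR (ltW e1) (mulr_ge0 (ler0n R 2) (ltW s'0)); rewrite powRr0.
rewrite ge0_integralD//; first last.
- exact/measurable_EFinP.
- by move=> eta _; rewrite lee_fin.
- exact: emeasurable_funM.
rewrite lte_add_pinfty// ge0_integralZl//.
- by rewrite lte_mul_pinfty// lee_fin invr_ge0 ltW.
- move=> eta _; apply: mule_ge0; first by rewrite lee_fin mulr_ge0 ?powR_ge0.
  by apply: integral_ge0 => z _; rewrite lee_fin mulr_ge0// ltW.
- by rewrite lee_fin invr_ge0 ltW.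
Qed.

Let cvg_damp (z : 'rV[R]_p) : gauss_damp (j.+1%:R^-1) z @[j --> \oo] --> (1 : R).
Proof.
rewrite /gauss_damp.
suff h : - ((j.+1%:R^-1 : R) ^+ 2 * dotrV z z / 2) @[j --> \oo] --> (0 : R).
  by have := cvg_comp _ _ h (@continuous_expR R 0); rewrite expR0.
rewrite -oppr0; apply: cvgN.
have -> : (0 : R) = 0 ^+ 2 * dotrV z z / 2 by rewrite expr0n/= !mul0r.
apply: cvgMl; apply: cvgMl; rewrite expr2; under eq_fun do rewrite expr2.
by apply: cvgM; exact: cvg_harmonic.
Qed.

(** Mollification multiplies [lf phi] by a factor in [[0, 1]] tending to 1, so both limits are
    dominated convergence under the integrand of the norm of the lift. *)
Lemma cvg_mollify phi : schwartz phi -> (wL2norm2 (- s) (lf phi) < +oo)%E ->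
  wL2norm2 (- s) (fun xi => fourier (moll j.+1%:R^-1 phi) xi - lf phi xi) @[j --> \oo] --> 0%E /\
  hdot_norm2 (- s) (moll j.+1%:R^-1 phi) @[j --> \oo] --> wL2norm2 (- s) (lf phi).
Proof.
move=> sphi fin.
have phii := schwartz_integrable sphi; have mphi := schwartz_measurable sphi.
pose g xi := enorm xi `^ (2 * - s) * sqnormC (lf phi xi).
have g0 xi : 0 <= g xi by rewrite mulr_ge0 ?powR_ge0 ?sqnormC_ge0.
have mg : measurable_fun setT g.
  apply: measurable_funM; first exact: measurable_enorm_pow.
  by apply: measurable_sqnormC; exact: measurable_lift_fourier.
have ig : (lebesgue_rV n).-integrable setT (EFin \o g).
  apply/integrableP; split; first exact/measurable_EFinP.
  by under eq_integral do rewrite /= ger0_norm//.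
have dom (u : nat -> 'rV[R]_p -> R) (l : R) : (forall j, measurable_fun setT (u j)) ->
    (forall j z, 0 <= u j z <= 1) -> (forall z, u j z @[j --> \oo] --> l) ->
    (\int[lebesgue_rV n]_xi (g xi * u j (xi *m K^T))%:E)%E @[j --> \oo] -->
    (\int[lebesgue_rV n]_xi (g xi * l)%:E)%E.
  move=> mu u01 ul.
  have muK j : measurable_fun setT (fun xi : 'rV[R]_n => u j (xi *m K^T)).
    by apply: (measurableT_comp (mu j)); exact: measurable_mulmx_rV.
  have [] := @dominated_convergence _ _ _ (lebesgue_rV n) setT measurableT
    (fun j xi => (g xi * u j (xi *m K^T))%:E) (fun xi => (g xi * l)%:E) (EFin \o g).
  - by move=> j; apply/measurable_EFinP; exact: measurable_funM.
  - by apply/measurable_EFinP; exact: measurable_funM.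
  - apply: aeW => xi _; apply: cvg_EFin; first exact: nearW.
    by apply: cvgMr; exact: ul.
  - exact: ig.
  - apply: aeW => xi j _; have /andP[u0 u1] := u01 j (xi *m K^T).
    by rewrite /= lee_fin normrM (ger0_norm (g0 _)) (ger0_norm u0) ler_piMr.
  by move=> _ _.
have e0 j : 0 < (j.+1%:R^-1 : R) by rewrite invr_gt0.
have dm (j : nat) := @measurable_gauss_damp (j.+1%:R^-1).
split.
  have -> : (0%E : \bar R) = (\int[lebesgue_rV n]_xi (g xi * 0)%:E)%E.
    by under eq_integral do rewrite mulr0; rewrite integral0.
  have := dom (fun j z => (1 - gauss_damp j.+1%:R^-1 z) ^+ 2) 0.
  rewrite (_ : (fun j => wL2norm2 _ _) = fun j =>
    (\int[lebesgue_rV n]_xi (g xi * (1 - gauss_damp j.+1%:R^-1 (xi *m K^T)) ^+ 2)%:E)%E).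
    apply.
    - by move=> j; apply: measurable_funX; apply: measurable_funB => //; exact: dm.
    - move=> j z; rewrite sqr_ge0 exprn_ile1// ?subr_ge0 ?gauss_damp_le1//.
      by rewrite gerBl ltW// gauss_damp_gt0.
    - move=> z; under eq_fun do rewrite expr2.
      have h : (1 - gauss_damp j.+1%:R^-1 z) * (1 - gauss_damp j.+1%:R^-1 z) @[j --> \oo] --> ((1 - 1) * (1 - 1) : R).
        by apply: cvgM; apply: cvgB; do ?[exact: cvg_cst|exact: cvg_damp].
      by rewrite subrr mul0r in h.
  apply/funext => j; apply: eq_integral => xi _; congr EFin.
  by rewrite (sqnormC_fourier_mollifyB kpn AA KK AK AKn)// mulrA.
have -> : wL2norm2 (- s) (lf phi) = (\int[lebesgue_rV n]_xi (g xi * 1)%:E)%E.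
  by apply: eq_integral => xi _; rewrite mulr1.
have := dom (fun j z => gauss_damp j.+1%:R^-1 z ^+ 2) 1.
rewrite (_ : (fun j => hdot_norm2 _ _) = fun j =>
  (\int[lebesgue_rV n]_xi (g xi * gauss_damp j.+1%:R^-1 (xi *m K^T) ^+ 2)%:E)%E).
  apply.
  - by move=> j; apply: measurable_funX; exact: dm.
  - move=> j z; rewrite sqr_ge0 exprn_ile1// ?gauss_damp_le1//.
    by rewrite ltW// gauss_damp_gt0.
  - move=> z; under eq_fun do rewrite expr2.
    have h : gauss_damp j.+1%:R^-1 z * gauss_damp j.+1%:R^-1 z @[j --> \oo] --> (1 * 1 : R).
      by apply: cvgM; exact: cvg_damp.
    by rewrite mulr1 in h.
apply/funext => j; apply: eq_integral => xi _; congr EFin.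
by rewrite (sqnormC_fourier_mollify kpn AA KK AK AKn)// mulrA.
Qed.

Lemma hdot_lift_test (J : 'Hom('rV[R]_k, 'rV[R]_n)) phi : (forall x, J x = x *m A) -> schwartz phi ->
  (wL2norm2 (- s) (lf phi) < +oo)%E -> hdot (- s) (lift_test J phi) (lf phi).
Proof.
move=> JA sphi fin; have phii := schwartz_integrable sphi; have mphi := schwartz_measurable sphi.
have [mr mi] := measurable_lift_fourier A kpn mphi.
have LI f : schwartz f -> (lebesgue_rV k).-integrable setT (EFin \o (fun x => f (J x) * phi x)).
  move=> sf; have [M fM] := rapid_bounded (schwartz_rapid sf).
  rewrite (_ : (fun x => _) = fun x => phi x * f (x *m A)); last first.
    by apply/funext => x; rewrite JA mulrC.
  apply: (@integrable_mul_bounded_by _ _ _ _ _ _ M) => //.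
  by apply: measurableT_comp; [exact: schwartz_measurable|exact: measurable_mulmx_rV].
split => //.
- split.
    move=> a f g [sf _] [sg _]; rewrite /lift_test.
    under eq_Rintegral do rewrite mulrDl -mulrA.
    have If := LI _ sf; have Ig := LI _ sg.
    by rewrite RintegralD//; [rewrite RintegralZl|exact: integrableZl_EFin].
  (* The lift is already continuous for the sup norm, so no derivatives or decay weights enter. *)
  move=> f [sf _] e e0; exists 0%N.
  pose L := \int[lebesgue_rV k]_x `|phi x|.
  have L0 : 0 <= L by apply: Rintegral_ge0.
  (* The [+ 1] covers [L = 0] and makes the final inequality strict. *)
  exists (e / (L + 1)); first by rewrite divr_gt0// ltr_wpDl.
  move=> g [sg _] /(_ [::] (leqnn _)) cl; rewrite /lift_test -RintegralB//; [|exact: LI|exact: LI].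
  have d (x : 'rV[R]_k) : `|g (x *m A) - f (x *m A)| <= e / (L + 1).
    by have := cl (x *m A); rewrite expr0 mul1r.
  have -> : \int[lebesgue_rV k]_x (g (J x) * phi x - f (J x) * phi x) =
      \int[lebesgue_rV k]_x (phi x * (g (x *m A) - f (x *m A))).
    by apply: eq_Rintegral => x _; rewrite JA; ring.
  apply: le_lt_trans (le_normr_Rintegral_mul phii _ d) _.
    by apply: measurable_funB; apply: measurableT_comp; do ?[exact: schwartz_measurable|exact: measurable_mulmx_rV].
  by rewrite -/L mulrAC ltr_pdivrMr ?ltr_wpDl// ltr_pM2l// ltrDl.
- move=> psi spsi _ _; have psii := schwartz_integrable spsi; have mpsi := schwartz_measurable spsi.
  have mT (f : 'rV[R]_n -> R) : measurable_fun setT f -> measurable_fun setT (fun x : 'rV[R]_k => f (x *m A)).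
    by move=> mf; apply: (measurableT_comp mf); exact: measurable_mulmx_rV.
  have mT' (f : 'rV[R]_k -> R) : measurable_fun setT f -> measurable_fun setT (fun x : 'rV[R]_n => f (x *m A^T)).
    by move=> mf; apply: (measurableT_comp mf); exact: measurable_mulmx_rV.
  split.
    transitivity (\int[lebesgue_rV k]_x (fconst n * (cosT psi (x *m A) * phi x))).
      by apply: eq_Rintegral => x _; rewrite Re_fourier JA mulrA.
    rewrite RintegralZl//; last first.
      under eq_fun do rewrite mulrC.
      apply: (integrable_mul_bounded_by phii); first by apply: mT; exact: measurable_cosT.
      by move=> x; exact: normr_cosT_le.
    rewrite cosT_adjoint// -RintegralZl//; last first.
      under eq_fun do rewrite mulrC.
      apply: (integrable_mul_bounded_by psii); first by apply: mT'; exact: measurable_cosT.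
      by move=> x; exact: normr_cosT_le.
    by apply: eq_Rintegral => xi _; rewrite (Re_lift_fourier A kpn) mulrA.
  transitivity (\int[lebesgue_rV k]_x (- fconst n * (sinT psi (x *m A) * phi x))).
    by apply: eq_Rintegral => x _; rewrite Im_fourier JA !mulNr mulrA.
  rewrite RintegralZl//; last first.
    under eq_fun do rewrite mulrC.
    apply: (integrable_mul_bounded_by phii); first by apply: mT; exact: measurable_sinT.
    by move=> x; exact: normr_sinT_le.
  rewrite sinT_adjoint// -RintegralZl//; last first.
    under eq_fun do rewrite mulrC.
    apply: (integrable_mul_bounded_by psii); first by apply: mT'; exact: measurable_sinT.
    by move=> x; exact: normr_sinT_le.
  by apply: eq_Rintegral => xi _; rewrite (Im_lift_fourier A kpn) !mulNr mulrA.
Qed.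

End lift.

(** * Uniqueness in the dual Sobolev space *)

Section hdot_unique.
Context {R : realType} (n : nat) (s : R).
Hypothesis n0 : (0 < n)%N.
Hypothesis s0 : 0 <= s.
Implicit Types (g : 'rV[R]_n -> R[i]).

Let gau := @gauss_rV R n 1.

Let gauE (x : 'rV[R]_n) : gau x = normal_peak 1 ^+ n * expR (dotrV 0 x - 2^-1 * dotrV x x).
Proof.
rewrite /gau gauss_rVE ?oner_neq0// expr1n mulr2n.
have -> : dotrV 0 x = 0 by rewrite /dotrV big1// => i _; rewrite mxE mul0r.
by rewrite sub0r (mulrC _ (dotrV x x)).
Qed.

Lemma schwartz_gauss_shift (b : 'rV[R]_n) :
  schwartz (fun xi => expR (- (dotrV (xi - b) (xi - b) / 2))).
Proof.
have h : 0 < (2^-1 : R) by rewrite invr_gt0.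
rewrite (_ : (fun xi => _) = fun xi => expR (- (dotrV b b / 2)) *
   (expR (dotrV b xi - 2^-1 * dotrV xi xi) * cos (dotrV 0 xi))).
  by apply: schwartzZ; exact: schwartz_gauss_cos.
apply/funext => xi; have -> : dotrV 0 xi = 0 by rewrite /dotrV big1// => i _; rewrite mxE mul0r.
rewrite cos0 mulr1 -expRD dotrVBl dotrVC (dotrVC b (xi - b)) !dotrVBl (dotrVC xi b).
by congr expR; field.
Qed.

(** Testing a function against [psic b] and [psis b] yields the cosine and sine integrals of its
    product with [gau], the data that [cf_unique] takes. *)
Let psic (b x : 'rV[R]_n) := gau x * cos (dotrV b x).
Let psis (b x : 'rV[R]_n) := gau x * sin (dotrV b x).

Let schwartz_psic b : schwartz (psic b).
Proof.
have h : 0 < (2^-1 : R) by rewrite invr_gt0.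
have := schwartzZ (normal_peak 1 ^+ n) (schwartz_gauss_cos 0 b h).
by congr schwartz; apply/funext => x; rewrite /psic gauE mulrA.
Qed.

Let schwartz_psis b : schwartz (psis b).
Proof.
have h : 0 < (2^-1 : R) by rewrite invr_gt0.
have := schwartzZ (normal_peak 1 ^+ n) (schwartz_gauss_sin 0 b h).
by congr schwartz; apply/funext => x; rewrite /psis gauE mulrA.
Qed.

Let cf b : \int[lebesgue_rV n]_x (gau x * cos (dotrV b x)) = expR (- (dotrV b b / 2)) /\
  \int[lebesgue_rV n]_x (gau x * sin (dotrV b x)) = 0.
Proof.
by have [h1 h2] := @gauss_rV_cf R n 1 b (oner_neq0 R); rewrite h1 h2 expr1n mul1r.
Qed.

Let gi := integrable_gauss_rV n (1 : R).

Let Eb (b xi : 'rV[R]_n) := expR (- (dotrV (xi - b) (xi - b) / 2)).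

Let half (f g : 'rV[R]_n -> R) : (lebesgue_rV n).-integrable setT (EFin \o f) ->
  (lebesgue_rV n).-integrable setT (EFin \o g) ->
  \int[lebesgue_rV n]_x (2^-1 * (f x + g x)) = 2^-1 * (\int[lebesgue_rV n]_x f x + \int[lebesgue_rV n]_x g x) /\
  \int[lebesgue_rV n]_x (2^-1 * (f x - g x)) = 2^-1 * (\int[lebesgue_rV n]_x f x - \int[lebesgue_rV n]_x g x).
Proof.
move=> fi gi'; split.
  by rewrite RintegralZl//; [rewrite RintegralD|exact: integrableD_EFin].
by rewrite RintegralZl//; [rewrite RintegralB|exact: integrableB_EFin].
Qed.

(** By the product-to-sum formulas the transform is a mean of Gaussians centred at [b] and [- b]. An
    explicit form is needed because [hdot] demands that the transforms be Schwartz. *)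
Let psic_hat b xi : cosT (psic b) xi = 2^-1 * (Eb b xi + Eb (- b) xi) /\ sinT (psic b) xi = 0.
Proof.
have Ic c := integrable_mul_cos c gi; have Is c := integrable_mul_sin c gi.
have [c1 s1] := cf (xi - b); have [c2 s2] := cf (xi + b).
split.
  transitivity (\int[lebesgue_rV n]_x (2^-1 * (gau x * cos (dotrV (xi - b) x) + gau x * cos (dotrV (xi + b) x)))).
    by apply: eq_Rintegral => x _; rewrite /psic dotrVBl dotrVDl cosB cosD; field.
  by rewrite (half (Ic (xi - b)) (Ic (xi + b))).1 c1 c2 /Eb opprK.
transitivity (\int[lebesgue_rV n]_x (2^-1 * (gau x * sin (dotrV (xi - b) x) + gau x * sin (dotrV (xi + b) x)))).
  by apply: eq_Rintegral => x _; rewrite /psic dotrVBl dotrVDl sinB sinD; field.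
by rewrite (half (Is (xi - b)) (Is (xi + b))).1 s1 s2 addr0 mulr0.
Qed.

Let psis_hat b xi : cosT (psis b) xi = 0 /\ sinT (psis b) xi = 2^-1 * (Eb b xi - Eb (- b) xi).
Proof.
have Ic c := integrable_mul_cos c gi; have Is c := integrable_mul_sin c gi.
have [c1 s1] := cf (xi - b); have [c2 s2] := cf (xi + b).
split.
  transitivity (\int[lebesgue_rV n]_x (2^-1 * (gau x * sin (dotrV (xi + b) x) - gau x * sin (dotrV (xi - b) x)))).
    by apply: eq_Rintegral => x _; rewrite /psis dotrVBl dotrVDl sinB sinD; field.
  by rewrite (half (Is (xi + b)) (Is (xi - b))).2 s1 s2 subr0 mulr0.
transitivity (\int[lebesgue_rV n]_x (2^-1 * (gau x * cos (dotrV (xi - b) x) - gau x * cos (dotrV (xi + b) x)))).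
  by apply: eq_Rintegral => x _; rewrite /psis dotrVBl dotrVDl cosB cosD; field.
by rewrite (half (Ic (xi - b)) (Ic (xi + b))).2 c1 c2 /Eb opprK.
Qed.

Let schwartz_hat (psi : 'rV[R]_n -> R) (Fc Fs : 'rV[R]_n -> R) :
  (forall xi, cosT psi xi = Fc xi) -> (forall xi, sinT psi xi = Fs xi) -> schwartz Fc -> schwartz Fs ->
  schwartz (fun x => complex.Re (fourier psi x)) /\ schwartz (fun x => complex.Im (fourier psi x)).
Proof.
move=> c1 c2 sc ss; split.
  rewrite (_ : (fun x => _) = fun x => fconst n * Fc x); first exact: schwartzZ.
  by apply/funext => x; rewrite Re_fourier c1.
rewrite (_ : (fun x => _) = fun x => - fconst n * Fs x); first exact: schwartzZ.
by apply/funext => x; rewrite Im_fourier c2 mulNr.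
Qed.

Let hat_psic b : schwartz (fun x => complex.Re (fourier (psic b) x)) /\
  schwartz (fun x => complex.Im (fourier (psic b) x)).
Proof.
apply: (@schwartz_hat _ (fun xi => 2^-1 * (1 * Eb b xi + Eb (- b) xi)) (fun=> 0)).
- by move=> xi; rewrite (psic_hat b xi).1 mul1r.
- by move=> xi; rewrite (psic_hat b xi).2.
- by apply: schwartzZ; apply: schwartz_lin; exact: schwartz_gauss_shift.
- exact: schwartz0.
Qed.

Let hat_psis b : schwartz (fun x => complex.Re (fourier (psis b) x)) /\
  schwartz (fun x => complex.Im (fourier (psis b) x)).
Proof.
apply: (@schwartz_hat _ (fun=> 0) (fun xi => 2^-1 * (-1 * Eb (- b) xi + Eb b xi))).
- by move=> xi; rewrite (psis_hat b xi).1.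
- by move=> xi; rewrite (psis_hat b xi).2 mulN1r addrC.
- exact: schwartz0.
- by apply: schwartzZ; apply: schwartz_lin; exact: schwartz_gauss_shift.
Qed.

(* Cauchy-Schwarz against the weight [|xi| ^ (2 s)]; the origin, where the
   weight degenerates, is a null set. *)
Let integrable_gau (f : 'rV[R]_n -> R) (N : 'rV[R]_n -> R) : measurable_fun setT f ->
  measurable_fun setT N -> (forall xi, f xi ^+ 2 <= N xi) ->
  (\int[lebesgue_rV n]_xi (enorm xi `^ (2 * - s) * N xi)%:E < +oo)%E ->
  (lebesgue_rV n).-integrable setT (EFin \o (fun xi => f xi * gau xi)).
Proof.
move=> mf mN fN Noo.
have CS (v a g : R) : 0 < v -> 0 <= a -> 0 <= g -> a * g <= v^-1 * a ^+ 2 + v * g * g.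
  move=> v0 a0 g0; rewrite -subr_ge0 -(pmulr_rge0 _ v0).
  rewrite (_ : v * (v^-1 * a ^+ 2 + v * g * g - a * g) = (a - v * g) ^+ 2 + v * (a * g)); last by field; exact: lt0r_neq0.
  by rewrite addr_ge0 ?sqr_ge0// mulr_ge0 ?mulr_ge0// ltW.
have gau0 x : 0 <= gau x by exact: gauss_rV_ge0.
have mgau : measurable_fun setT gau by exact: measurable_gauss_rV.
have sgau : schwartz gau by exact: schwartz_gauss.
have [M gauM] := rapid_bounded (schwartz_rapid sgau).
pose w (xi : 'rV[R]_n) := enorm xi `^ (2 * s).
have pw : polybound w.
  have [N0 sN] : exists N0 : nat, 2 * s <= N0%:R.
    by exists (Num.truncn (2 * s)).+1; rewrite ltW// truncnS_gt.
  exists N0, 1 => xi; rewrite mul1r ger0_norm ?powR_ge0//.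
  rewrite -powR_mulrn; last exact: le_trans ler01 (oneDenorm_ge1 xi).
  apply: (@le_trans _ _ ((1 + enorm xi) `^ (2 * s))).
    apply: ge0_ler_powR; rewrite ?nnegrE ?mulr_ge0 ?enorm_ge0 ?lerDr//.
    exact: le_trans ler01 (oneDenorm_ge1 xi).
  by have := ler_powR (oneDenorm_ge1 xi) sN.
have mw : measurable_fun setT w by exact: measurable_enorm_pow.
have wi : (lebesgue_rV n).-integrable setT (EFin \o (fun xi => (w xi * gau xi) * gau xi)).
  apply: integrable_polybound_schwartz => //; first exact: measurable_funM.
  apply: polyboundM => //; exists 0%N, M => x; rewrite expr0 mulr1; exact: gauM.
have N0 xi : 0 <= N xi by exact: le_trans (sqr_ge0 _) (fN xi).
have mNw : measurable_fun setT (fun xi : 'rV[R]_n => enorm xi `^ (2 * - s) * N xi).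
  by apply: measurable_funM => //; exact: measurable_enorm_pow.
have Ni : (lebesgue_rV n).-integrable setT (EFin \o (fun xi => enorm xi `^ (2 * - s) * N xi)).
  apply/integrableP; split; first exact/measurable_EFinP.
  by under eq_integral do rewrite /= ger0_norm ?mulr_ge0 ?powR_ge0//.
have Si := integrableD_EFin measurableT Ni wi.
apply/integrableP; split; first by apply/measurable_EFinP; exact: measurable_funM.
have /integrableP[_] := Si; apply: le_lt_trans; apply: ae_ge0_le_integral => //.
- by apply/measurable_EFinP; apply: measurableT_comp => //; exact: measurable_funM.
- by apply/measurable_EFinP; apply: measurableT_comp => //; apply: measurable_funD => //;
    apply: measurable_funM => //; exact: measurable_funM.
exists [set 0]; split; [exact: measurable_rV_set1|exact: lebesgue_rV_set1|].
move=> xi /= /not_implyP[_ h]; apply: contrapT => /eqP xi0; apply: h.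
have e0 := enorm_gt0 xi0.
have w0 : 0 < w xi by rewrite powR_gt0.
have -> : enorm xi `^ (2 * - s) = (w xi)^-1 by rewrite mulrN powRN.
rewrite lee_fin [leRHS]ger0_norm; last first.
  have w1 := ltW w0; apply: addr_ge0; apply: mulr_ge0; rewrite ?invr_ge0//; exact: mulr_ge0.
rewrite normrM (ger0_norm (gau0 xi)).
apply: (@le_trans _ _ ((w xi)^-1 * f xi ^+ 2 + w xi * gau xi * gau xi)); last first.
  by rewrite lerD2r ler_wpM2l// invr_ge0 ltW.
rewrite -(real_normK (num_real (f xi))); set a := `|f xi|; have a0 : 0 <= a by exact: normr_ge0.
exact: CS.
Qed.

(** [cf_unique] gives equal integrals of [f * gau] and [f' * gau] over every measurable set, hence
    equality almost everywhere, and [gau] has no zero. *)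
Let ae_of_tests (f f' : 'rV[R]_n -> R) :
  (lebesgue_rV n).-integrable setT (EFin \o (fun xi => f xi * gau xi)) ->
  (lebesgue_rV n).-integrable setT (EFin \o (fun xi => f' xi * gau xi)) ->
  (forall b, \int[lebesgue_rV n]_xi (f xi * psic b xi) = \int[lebesgue_rV n]_xi (f' xi * psic b xi)) ->
  (forall b, \int[lebesgue_rV n]_xi (f xi * psis b xi) = \int[lebesgue_rV n]_xi (f' xi * psis b xi)) ->
  ae_eq (lebesgue_rV n) setT f f'.
Proof.
move=> fi fi' ec es.
have e (B : set 'rV[R]_n) : B `<=` setT -> measurable B ->
    (\int[lebesgue_rV n]_(xi in B) (f xi * gau xi)%:E = \int[lebesgue_rV n]_(xi in B) (f' xi * gau xi)%:E)%E.
  move=> _ mB.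
  have := @cf_unique R n _ _ (lebesgue_rV n) _ _ (lebesgue_rV n) id _ id _
    (@measurable_id _ _ _) (@measurable_id _ _ _) fi fi'.
  apply => // b.
  - have := ec b; rewrite /psic; under eq_Rintegral do rewrite mulrA.
    by move=> ->; apply: eq_Rintegral => x _; rewrite mulrA.
  - have := es b; rewrite /psis; under eq_Rintegral do rewrite mulrA.
    by move=> ->; apply: eq_Rintegral => x _; rewrite mulrA.
have := integral_ae_eq measurableT fi (measurable_int _ fi') e.
apply: filterS => xi h _; have /= := h I; move=> [].
by apply: mulIf; rewrite /gau gauss_rVE ?oner_neq0// mulf_neq0 ?expf_neq0 ?gt_eqF ?expR_gt0 ?normal_peak_gt0// oner_neq0.
Qed.

Lemma hdot_unique (u : ('rV[R]_n -> R) -> R) g g' : hdot (- s) u g -> hdot (- s) u g' ->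
  ae_eq (lebesgue_rV n) setT g g'.
Proof.
move=> [_ mr mi fin test] [_ mr' mi' fin' test'].
(* The moment order is negative, so every Schwartz function is an admissible test. *)
have rneg : - s - n%:R / 2 < 0.
  by rewrite -opprD oppr_lt0 ltr_wpDl// divr_gt0// ltr0n.
have Re_le (z : R[i]) : complex.Re z ^+ 2 <= sqnormC z by rewrite lerDl sqr_ge0.
have Im_le (z : R[i]) : complex.Im z ^+ 2 <= sqnormC z by rewrite lerDr sqr_ge0.
have T b : _ := test _ (schwartz_psic b) (schwartz_mom_neg rneg (hat_psic b).1) (schwartz_mom_neg rneg (hat_psic b).2).
have T' b : _ := test' _ (schwartz_psic b) (schwartz_mom_neg rneg (hat_psic b).1) (schwartz_mom_neg rneg (hat_psic b).2).
have S b : _ := test _ (schwartz_psis b) (schwartz_mom_neg rneg (hat_psis b).1) (schwartz_mom_neg rneg (hat_psis b).2).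
have S' b : _ := test' _ (schwartz_psis b) (schwartz_mom_neg rneg (hat_psis b).1) (schwartz_mom_neg rneg (hat_psis b).2).
have mg : measurable_fun setT (fun xi => sqnormC (g xi) : R) by exact: measurable_sqnormC.
have mg' : measurable_fun setT (fun xi => sqnormC (g' xi) : R) by exact: measurable_sqnormC.
have eR : ae_eq (lebesgue_rV n) setT (fun xi => complex.Re (g xi)) (fun xi => complex.Re (g' xi)).
  apply: ae_of_tests.
  - exact: integrable_gau mr mg (fun xi => Re_le (g xi)) fin.
  - exact: integrable_gau mr' mg' (fun xi => Re_le (g' xi)) fin'.
  - by move=> b; rewrite -(T b).1 -(T' b).1.
  - by move=> b; rewrite -(S b).1 -(S' b).1.
have eI : ae_eq (lebesgue_rV n) setT (fun xi => complex.Im (g xi)) (fun xi => complex.Im (g' xi)).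
  apply: ae_of_tests.
  - exact: integrable_gau mi mg (fun xi => Im_le (g xi)) fin.
  - exact: integrable_gau mi' mg' (fun xi => Im_le (g' xi)) fin'.
  - by move=> b; rewrite -(T b).2 -(T' b).2.
  - by move=> b; rewrite -(S b).2 -(S' b).2.
apply: filterS2 eR eI => xi hr hi _; move: (hr I) (hi I).
by case: (g xi) => a b; case: (g' xi) => a' b' /= -> ->.
Qed.

End hdot_unique.

(** * Square-integrable limits *)

Section tends0.
Context {R : realType}.

(** An epsilon form in the extended reals, in which eventual finiteness is implicit and need not be
    carried along. *)
Definition tends0 (u : nat -> \bar R) :=
  forall e : R, 0 < e -> exists N, forall j, (N <= j)%N -> (u j <= e%:E)%E.

Lemma tends0P u : (forall j, 0 <= u j)%E -> (u j @[j --> \oo] --> 0%E) <-> tends0 u.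
Proof.
move=> u0; split.
  move=> /fine_cvgP[ufin /cvgrPdist_le cu] e e0.
  have [N _ h] : \forall j \near \oo, (u j <= e%:E)%E.
    near=> j; have uj : u j \is a fin_num by near: j.
    rewrite -(fineK uj) lee_fin; apply: le_trans (ler_norm _) _.
    rewrite -normrN -sub0r; near: j; exact: cu.
  by exists N => j Nj; exact: h.
move=> tu; apply/fine_cvgP.
have F e : 0 < e -> \forall j \near \oo, (u j <= e%:E)%E.
  by move=> e0; have [N h] := tu e e0; exists N => // j; exact: h.
have fin : \forall j \near \oo, u j \is a fin_num.
  by near=> j; rewrite ge0_fin_numE//; apply: (@le_lt_trans _ _ 1%:E); [near: j; exact: F|exact: ltry].
split => //; apply/cvgrPdist_le => e e0; near=> j.
rewrite sub0r normrN /= ger0_norm ?fine_ge0// -lee_fin fineK; last by near: j.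
by near: j; exact: F.
Unshelve. all: by end_near. Qed.

End tends0.

(** * The Riesz-Fischer theorem *)

Section L2_complete.
Context {R : realType} d (T : measurableType d) (P : probability T R).
Context (Y : nat -> T -> R).
Hypothesis mY : forall j, measurable_fun setT (Y j).
Hypothesis cauchyY : forall e : R, 0 < e -> exists N, forall i j, (N <= i)%N -> (N <= j)%N ->
  (\int[P]_w ((Y i w - Y j w) ^+ 2)%:E <= e%:E)%E.

Let quarter k : 0 < (4 ^ k)%:R^-1 :> R.
Proof. by rewrite invr_gt0 ltr0n expn_gt0. Qed.

Let idx k : nat := sval (cid (cauchyY (quarter k))).

Let idxP k i j : (idx k <= i)%N -> (idx k <= j)%N ->
  (\int[P]_w ((Y i w - Y j w) ^+ 2)%:E <= ((4 ^ k)%:R^-1)%:E)%E.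
Proof. exact: (svalP (cid (cauchyY (quarter k)))). Qed.

(** The sum makes [nk] monotone and at least [idx k]; the summand [k] makes it unbounded. *)
Let nk (k : nat) := (k + \sum_(i < k.+1) idx i)%N.

Let nk_ge k : (idx k <= nk k)%N.
Proof. by rewrite /nk big_ord_recr/= addnA leq_addl. Qed.

Let nkS k : (nk k <= nk k.+1)%N.
Proof. by rewrite /nk leq_add// [leqRHS]big_ord_recr/= leq_addr. Qed.

Let nk_id k : (k <= nk k)%N.
Proof. exact: leq_addr. Qed.

Let Z k := Y (nk k).

Let D k w := Z k.+1 w - Z k w.

Let mD k : measurable_fun setT (D k). Proof. by apply: measurable_funB; exact: mY. Qed.

(** From [|D| <= 2^k D^2 + 2^(-k)], in place of Cauchy-Schwarz: both terms integrate to at most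
    [2^(-k)]. The bound is written in the shape summed by [epsilon_trick0]. *)
Let intD k : (\int[P]_w `|D k w|%:E <= (4 / (2 ^ k.+1)%:R)%:E)%E.
Proof.
have h2 : 0 < (2 ^ k)%:R :> R by rewrite ltr0n expn_gt0.
have h := @idxP k (nk k.+1) (nk k) (leq_trans (nk_ge k) (nkS k)) (nk_ge k).
apply: (@le_trans _ _ (\int[P]_w ((2 ^ k)%:R%:E * (D k w ^+ 2)%:E + ((2 ^ k)%:R^-1)%:E))%E).
  apply: ge0_le_integral => //.
  - by apply/measurable_EFinP; apply: measurableT_comp => //; exact: mD.
  - apply: emeasurable_funD => //; apply: emeasurable_funM => //.
    by apply/measurable_EFinP; exact: measurable_funX.
  move=> w _; rewrite -EFinM -EFinD lee_fin.
  rewrite -(real_normK (num_real (D k w))); set a := `|D k w|.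
  rewrite -subr_ge0 -(pmulr_rge0 _ h2).
  rewrite (_ : _ * (_ - _) = ((2 ^ k)%:R * a - 2^-1) ^+ 2 + (1 - 4^-1)); last by field; exact: lt0r_neq0.
  by rewrite addr_ge0 ?sqr_ge0//; lra.
rewrite ge0_integralD//; first last.
- apply: emeasurable_funM => //.
  by apply/measurable_EFinP; exact: measurable_funX.
- by move=> w _; rewrite -EFinM lee_fin mulr_ge0 ?sqr_ge0// ltW.
have -> : (\int[P]_w ((2 ^ k)%:R^-1)%:E = ((2 ^ k)%:R^-1 : R)%:E)%E.
  by rewrite (integral_cst P measurableT) [X in (_ * X)%E](@probability_setT _ _ _ P) mule1.
rewrite ge0_integralZl//; first last.
- by move=> w _; rewrite lee_fin sqr_ge0.
- by apply/measurable_EFinP; exact: measurable_funX.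
apply: (@le_trans _ _ ((2 ^ k)%:R%:E * ((4 ^ k)%:R^-1)%:E + ((2 ^ k)%:R^-1)%:E)%E).
  by rewrite leeD2r// lee_wpmul2l// lee_fin ltW.
rewrite -EFinM -EFinD lee_fin (_ : 4 ^ k = 2 ^ k * 2 ^ k)%N; last by rewrite -expnMn.
rewrite natrM expnS natrM le_eqVlt; apply/orP; left; apply/eqP; field; exact: lt0r_neq0.
Qed.

Let S w := (\sum_(0 <= k <oo) `|D k w|%:E)%E.

Let S_fin : {ae P, forall w, S w \is a fin_num}.
Proof.
have D0 k w : (0 <= `|D k w|%:E)%E by rewrite lee_fin.
have mDE k : measurable_fun setT (fun w => `|D k w|%:E).
  by apply/measurable_EFinP; apply: measurableT_comp => //; exact: mD.
have mS : measurable_fun setT S by apply: ge0_emeasurable_sum.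
have Si : P.-integrable setT S.
  apply/integrableP; split => //.
  under eq_integral do rewrite gee0_abs ?nneseries_ge0//.
  rewrite integral_nneseries//.
  apply: (@le_lt_trans _ _ (\sum_(0 <= k <oo) (4 / (2 ^ k.+1)%:R)%:E)%E).
    by apply: lee_nneseries => *; [exact: integral_ge0|exact: intD].
  by apply: le_lt_trans (epsilon_trick0 xpredT _) _; rewrite ?ltry.
by have := integrable_ae measurableT Si; apply: filterS => w; exact.
Qed.

Let Z_cvg : {ae P, forall w, cvgn (fun k => Z k w)}.
Proof.
apply: filterS S_fin => w Sw.
have : cvgn [normed series (D^~ w)].
  apply: nondecreasing_is_cvgn.
    by apply: nondecreasing_series => i _; rewrite normr_ge0.
  exists (fine (S w)) => _ [n _ <-].
  rewrite (_ : _ n = \sum_(0 <= k < n) `|D k w|)//.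
  rewrite -lee_fin fineK// -sumEFin; apply: nneseries_lim_ge => k _ _.
  by rewrite lee_fin.
move=> /normed_cvg; have -> : series (D^~ w) = fun n => Z n w - Z 0 w.
  by have := telescopeK (Z^~ w).
move=> c; have -> : (fun k => Z k w) = fun k => (Z k w - Z 0 w) + Z 0 w.
  by apply/funext => k; rewrite subrK.
by apply: is_cvgD => //; exact: is_cvg_cst.
Qed.

(** The upper limit is measurable everywhere and equals the limit wherever the subsequence
    converges, that is almost everywhere; [fine] provides a real value elsewhere. *)
Definition L2_limit (w : T) : R := fine (limn_esup (fun k => (Z k w)%:E)).

Lemma measurable_L2_limit : measurable_fun setT L2_limit.
Proof.
apply: (measurableT_comp (@fine_measurable _ _ _)) => //.
by apply: measurable_fun_limn_esup => k; apply/measurable_EFinP; exact: mY.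
Qed.

(** Fatou's lemma along the almost surely convergent subsequence, then the Cauchy bound; the whole
    sequence converges, not only the subsequence. *)
Lemma L2_complete (e : R) : 0 < e ->
  exists N, forall j, (N <= j)%N -> (\int[P]_w ((Y j w - L2_limit w) ^+ 2)%:E <= e%:E)%E.
Proof.
move=> e0; have [N HN] := cauchyY e0; exists N => j Nj.
pose f k w := ((Y j w - Z k w) ^+ 2)%:E.
have mf k : measurable_fun setT (f k).
  by apply/measurable_EFinP; apply: measurable_funX; apply: measurable_funB => //; exact: mY.
have f0 k w : (0 <= f k w)%E by rewrite lee_fin sqr_ge0.
apply: (@le_trans _ _ (\int[P]_w limn_einf (f^~ w))%E).
  rewrite le_eqVlt; apply/orP; left; apply/eqP; apply: ae_eq_integral => //.
  - apply/measurable_EFinP; apply: measurable_funX; apply: measurable_funB => //.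
    exact: measurable_L2_limit.
  - rewrite (_ : (fun w => _) = fun w => (- limn_esup (-%E \o (f^~ w)))%E); last first.
      by apply/funext => w; rewrite limn_esupN oppeK.
    apply: measurableT_comp => //; apply: (@measurable_fun_limn_esup _ _ _ setT (fun k w => (- f k w)%E)) => //.
    by move=> k; exact: measurableT_comp.
  apply: filterS Z_cvg => w /cvg_ex[l Zl] _.
  have Xl : L2_limit w = l.
    rewrite /L2_limit (_ : limn_esup _ = l%:E)//.
    by apply: (cvg_limn_einf_sup (u := fun k => (Z k w)%:E) _).2; apply: cvg_EFin => //; exact: nearW.
  rewrite Xl; apply/esym; apply: (cvg_limn_einf_sup (u := f^~ w) _).1.
  apply: cvg_EFin; first exact: nearW.
  apply: (@cvg_trans _ ((fun k => (Y j w - Z k w) * (Y j w - Z k w)) @ \oo)).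
    by apply: near_eq_cvg; apply: nearW => k; rewrite /f /= expr2.
  rewrite expr2.
  by apply: cvgM; apply: cvgB => //; exact: cvg_cst.
apply: le_trans (fatou _ _ _ _) _ => //.
rewrite limn_einf_lim; apply: lime_le; first exact: is_cvg_einfs.
apply: nearW => n; rewrite /einfs/=.
(* An index that lies in the tail and is also beyond the Cauchy threshold [N]. *)
apply: (@le_trans _ _ (\int[P]_w f (maxn n N) w)%E).
  by apply: ereal_inf_lbound; exists (maxn n N) => //=; exact: leq_maxl.
apply: HN => //; exact: leq_trans (leq_maxr _ _) (nk_id _).
Qed.

End L2_complete.

(** * Gaussian laws *)

Section normal_law.
Context {R : realType}.
Notation mu := (@lebesgue_measure R).

Local Open Scope charge_scope.

(** Change of variables through the Radon-Nikodym derivative, which agrees almost everywhere with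
    the density because their integrals over measurable sets do. *)
Lemma integral_normal_prob (s : R) (f : R -> \bar R) :
  (normal_prob 0 s).-integrable setT f ->
  (\int[normal_prob (0 : R) s]_x f x = \int[mu]_x (f x * (normal_pdf 0 s x)%:E))%E.
Proof.
move=> fi; have dom := @normal_prob_dominates R 0 s.
rewrite -(Radon_Nikodym_change_of_variables dom measurableT fi).
have mpdf : measurable_fun setT (fun x => (normal_pdf 0 s x)%:E).
  by apply/measurable_EFinP; exact: measurable_normal_pdf.
have RN : ae_eq mu setT ('d (charge_of_finite_measure (normal_prob 0 s)) '/d mu) (fun x => (normal_pdf 0 s x)%:E).
  have RNi := @Radon_Nikodym_integrable _ _ _ (charge_of_finite_measure (normal_prob 0 s)) mu dom.
  apply: integral_ae_eq => // E _ mE.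
  by rewrite -Radon_Nikodym_integral.
have mf := measurable_int _ fi.
apply: ae_eq_integral => //.
- exact: emeasurable_funM.
- exact: emeasurable_funM.
- by apply: filterS RN => x h _; rewrite h.
Qed.

End normal_law.

Section normal_moments.
Context {R : realType}.
Notation mu := (@lebesgue_measure R).

Let bounded_integrable (s : R) (f : R -> R) M : measurable_fun setT f -> (forall x, `|f x| <= M) ->
  (normal_prob (0 : R) s).-integrable setT (EFin \o f).
Proof.
move=> mf fM; apply/integrableP; split; first exact/measurable_EFinP.
apply: (@le_lt_trans _ _ (\int[normal_prob (0 : R) s]_x (cst M%:E x))%E).
  apply: ge0_le_integral => //.
  - by apply/measurable_EFinP; exact: measurableT_comp.
  - by move=> x _; rewrite /= lee_fin.
by rewrite (integral_cst (normal_prob 0 s) measurableT) [X in (_ * X)%E]probability_setT mule1 ltry.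
Qed.

Lemma normal_prob_cf (s b : R) : s != 0 ->
  \int[normal_prob (0 : R) s]_x cos (b * x) = expR (- (s ^+ 2 * b ^+ 2 / 2)) /\
  \int[normal_prob (0 : R) s]_x sin (b * x) = 0.
Proof.
move=> s0; have [c1 c2] := normal_pdf_cf b s0.
have mb : measurable_fun setT (fun x : R => b * x) by exact: measurable_funM.
split.
  rewrite -c1 /Rintegral integral_normal_prob; last first.
    apply: (@bounded_integrable _ (fun x => cos (b * x)) 1); last by move=> x; exact: normr_cos_le1.
    exact: measurableT_comp measurable_cos mb.
  by congr fine; apply: eq_integral => x _; rewrite -EFinM mulrC.
apply: etrans _ c2; rewrite /Rintegral integral_normal_prob; last first.
  apply: (@bounded_integrable _ (fun x => sin (b * x)) 1); last by move=> x; exact: normr_sin_le1.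
  exact: measurableT_comp measurable_sin mb.
by congr fine; apply: eq_integral => x _; rewrite -EFinM mulrC.
Qed.

Lemma normal_prob_moment2 (s : R) : s != 0 ->
  (\int[normal_prob (0 : R) s]_x (x ^+ 2)%:E = (s ^+ 2)%:E)%E.
Proof.
move=> s0.
(* [integral_normal_prob] asks for integrability, not yet known for the square; truncations are
   bounded, and monotone convergence on both sides removes them. *)
pose f (j : nat) (x : R) := Num.min (x ^+ 2) j%:R.
have f0 j x : 0 <= f j x by rewrite le_min sqr_ge0 ler0n.
have mf j : measurable_fun setT (f j) by apply: measurable_minr => //; exact: measurable_funX.
have fnd x i j : (i <= j)%N -> f i x <= f j x.
  by move=> ij; rewrite /f le_min ge_min lexx/= ge_min ler_nat ij orbT.
have fcvg x : f j x @[j --> \oo] --> x ^+ 2.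
  apply: (@cvg_trans _ ((fun=> x ^+ 2) @ \oo)); last exact: cvg_cst.
  apply: near_eq_cvg; near=> j; rewrite /f min_l//.
  apply: le_trans (_ : (Num.truncn (x ^+ 2)).+1%:R <= _).
    by rewrite ltW// truncnS_gt.
  by rewrite ler_nat; near: j; exact: nbhs_infty_gt.
have h1 : (\int[normal_prob (0 : R) s]_x (f j x)%:E)%E @[j --> \oo] --> (\int[normal_prob (0 : R) s]_x (x ^+ 2)%:E)%E.
  rewrite (_ : (\int[normal_prob (0 : R) s]_x (x ^+ 2)%:E)%E = (\int[normal_prob (0 : R) s]_x limn (fun j => (f j x)%:E))%E); last first.
    by apply: eq_integral => x _; apply/esym/cvg_lim => //; apply: cvg_EFin; [exact: nearW|exact: fcvg].
  apply: cvg_monotone_convergence => //.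
  - by move=> j; apply/measurable_EFinP; exact: mf.
  - by move=> j x _; rewrite lee_fin.
  - by move=> x _ i j ij; rewrite lee_fin fnd.
have h2 : (\int[normal_prob (0 : R) s]_x (f j x)%:E)%E @[j --> \oo] --> (\int[mu]_x (x ^+ 2 * normal_pdf 0 s x)%:E)%E.
  rewrite (_ : (\int[mu]_x _)%E = (\int[mu]_x limn (fun j => (f j x * normal_pdf 0 s x)%:E))%E); last first.
    apply: eq_integral => x _; apply/esym/cvg_lim => //; apply: cvg_EFin; first exact: nearW.
    by apply: cvgMl; exact: fcvg.
  rewrite (_ : (fun j => _) = fun j => (\int[mu]_x (f j x * normal_pdf 0 s x)%:E)%E).
    apply: cvg_monotone_convergence => //.
    - by move=> j; apply/measurable_EFinP; apply: measurable_funM; [exact: mf|exact: measurable_normal_pdf].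
    - by move=> j x _; rewrite lee_fin mulr_ge0// normal_pdf_ge0.
    - by move=> x _ i j ij; rewrite lee_fin ler_wpM2r ?normal_pdf_ge0// fnd.
  apply/funext => j; rewrite integral_normal_prob//.
  by apply: (@bounded_integrable _ (f j) j%:R) => // x; rewrite ger0_norm// /f ge_min lexx orbT.
rewrite -(cvg_lim _ h1)// (cvg_lim _ h2)//.
by rewrite (Rintegral_EFin measurableT (integrable_sqr_normal_pdf s0)) normal_pdf_moment2.
Unshelve. all: by end_near. Qed.

End normal_moments.

Section gaussian_law.
Notation mu := (@lebesgue_measure _).
Context {R : realType} d (T : measurableType d) (P : probability T R).
Implicit Types X : T -> R.

Lemma centered_gaussian_fin X v : centered_gaussian P X v -> (v < +oo)%E.
Proof. by move=> [_ [s [_ <- _]]]; rewrite ltry. Qed.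

Lemma centered_gaussian_moment2 X v : centered_gaussian P X v -> (\int[P]_w (X w ^+ 2)%:E)%E = v.
Proof.
move=> [mX [s [s0 <- law]]].
have mf : measurable_fun setT (fun x : measurableTypeR R => (x ^+ 2)%:E : \bar R).
  by apply/measurable_EFinP; exact: measurable_funX.
have f0 (x : measurableTypeR R) : (0 <= (x ^+ 2)%:E :> \bar R)%E by rewrite lee_fin sqr_ge0.
have [s1|s1] := eqVneq s 0.
  have m12 B : measurable B -> P (X @^-1` B) = \d_(0 : measurableTypeR R) B.
    by move=> mB; rewrite law// s1 eqxx.
  rewrite -(ge0_integral_eq_pushforward mX m12 mf f0) integral_dirac//.
  by rewrite diracT mul1e s1.
have m12 B : measurable B -> P (X @^-1` B) = normal_prob 0 s B.
  by move=> mB; rewrite law// (negPf s1).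
by rewrite -(ge0_integral_eq_pushforward mX m12 mf f0) normal_prob_moment2.
Qed.

Lemma centered_gaussian_cf X v (b : R) : centered_gaussian P X v ->
  \int[P]_w cos (b * X w) = expR (- (fine v * b ^+ 2 / 2)) /\ \int[P]_w sin (b * X w) = 0.
Proof.
move=> [mX [s [s0 <- law]]].
have mb : measurable_fun setT (fun x : measurableTypeR R => b * x : R) by exact: measurable_funM.
have mc : measurable_fun setT (fun x : measurableTypeR R => cos (b * x)) by exact: measurableT_comp measurable_cos mb.
have ms : measurable_fun setT (fun x : measurableTypeR R => sin (b * x)) by exact: measurableT_comp measurable_sin mb.
have [s1|s1] := eqVneq s 0.
  have m12 B : measurable B -> P (X @^-1` B) = \d_(0 : measurableTypeR R) B.
    by move=> mB; rewrite law// s1 eqxx.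
  rewrite -(Rintegral_eq_pushforward mX m12 mc) -(Rintegral_eq_pushforward mX m12 ms).
  rewrite /Rintegral !integral_dirac//; [|exact/measurable_EFinP|exact/measurable_EFinP].
  by rewrite !diracT !mul1e/= mulr0 cos0 sin0 s1 expr0n/= !mul0r oppr0 expR0.
have m12 B : measurable B -> P (X @^-1` B) = normal_prob 0 s B.
  by move=> mB; rewrite law// (negPf s1).
rewrite -(Rintegral_eq_pushforward mX m12 mc) -(Rintegral_eq_pushforward mX m12 ms) /=.
exact: normal_prob_cf.
Qed.

(** Real random variables are brought under [cf_unique] as row vectors of length one. *)
Let rV1 (x : R) : 'rV[R]_1 := \row_(i < 1) x.

Let measurable_rV1 d' (T' : measurableType d') (X : T' -> R) : measurable_fun setT X ->
  measurable_fun setT (fun w => rV1 (X w)).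
Proof.
move=> mX; apply: measurable_fun_rV => i.
by rewrite (_ : _ \o _ = X)//; apply/funext => w; rewrite /= /rV_coord mxE.
Qed.

Let dot1 (b : 'rV[R]_1) x : dotrV b (rV1 x) = b 0 0 * x.
Proof. by rewrite /dotrV big_ord1 mxE. Qed.

Let P1 : P.-integrable setT (EFin \o (fun=> 1 : R)).
Proof.
exact: finite_measure_integrable_cst.
Qed.

(** [cf_unique] compares [P] with the Dirac mass when [s = 0], and with Lebesgue measure carrying
    the density [normal_pdf 0 s] otherwise. *)
Lemma gaussian_of_cf X (s : R) : measurable_fun setT (X : T -> measurableTypeR R) -> 0 <= s ->
  (forall b, \int[P]_w cos (b * X w) = expR (- (s ^+ 2 * b ^+ 2 / 2))) ->
  (forall b, \int[P]_w sin (b * X w) = 0) -> centered_gaussian P X (s ^+ 2)%:E.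
Proof.
move=> mX s0 cX sX; split => //; exists s; split => // A mA.
pose B : set 'rV[R]_1 := [set x | A (x 0 0)].
have mB : measurable B.
  by have := measurable_rV_coord (0 : 'I_1) measurableT mA; rewrite setTI.
have LHS : (\int[P]_(w in (fun w => rV1 (X w)) @^-1` B) (1 : R)%:E = P (X @^-1` A))%E.
  have -> : (fun w => rV1 (X w)) @^-1` B = X @^-1` A.
    by apply/seteqP; split => w /=; rewrite /B/= mxE.
  rewrite (integral_cst P) ?mul1e//; by have := mX measurableT A mA; rewrite setTI.
have PB := @cf_unique R 1 _ T P.
rewrite -LHS; have [s1|s1] := eqVneq s 0.
  pose D : {sigma_finite_measure set (measurableTypeR R) -> \bar R} := \d_(0 : measurableTypeR R).
  have i1 : D.-integrable setT (EFin \o (fun=> 1 : R)).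
    exact: (finite_measure_integrable_cst (\d_(0 : measurableTypeR R))).
  rewrite (PB _ _ D _ _ (fun x => rV1 x) (fun=> 1) (measurable_rV1 mX) (measurable_rV1 (@measurable_id _ _ _)) P1 i1)//.
  - have -> : (fun x => rV1 x) @^-1` B = A by apply/seteqP; split => x /=; rewrite /B/= mxE.
    by rewrite (integral_cst D mA) mul1e.
  - move=> b; under eq_Rintegral do rewrite mul1r dot1; rewrite cX s1 expr0n/= !mul0r oppr0 expR0.
    rewrite /Rintegral /D integral_dirac//; last first.
      apply/measurable_EFinP; apply: measurable_funM => //; apply: measurableT_comp measurable_cos _.
      by under eq_fun do rewrite dot1; exact: measurable_funM.
    by rewrite diracT mul1e/= dot1 mulr0 cos0 mulr1.
  - move=> b; under eq_Rintegral do rewrite mul1r dot1; rewrite sX.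
    rewrite /Rintegral /D integral_dirac//; last first.
      apply/measurable_EFinP; apply: measurable_funM => //; apply: measurableT_comp measurable_sin _.
      by under eq_fun do rewrite dot1; exact: measurable_funM.
    by rewrite diracT mul1e/= dot1 mulr0 sin0 mulr0.
rewrite (PB _ _ mu _ _ (fun x => rV1 x) (normal_pdf 0 s) (measurable_rV1 mX) (measurable_rV1 (@measurable_id _ _ _)) P1 (integrable_normal_pdf 0 s))//.
- rewrite /normal_prob; congr (\int[_]_(x in _) _)%E.
  by apply/seteqP; split => x /=; rewrite /B/= mxE.
- move=> b; under eq_Rintegral do rewrite mul1r dot1; rewrite cX.
  by under eq_Rintegral do rewrite dot1; rewrite (normal_pdf_cf (b 0 0) s1).1.
- move=> b; under eq_Rintegral do rewrite mul1r dot1; rewrite sX.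
  by under eq_Rintegral do rewrite dot1; rewrite (normal_pdf_cf (b 0 0) s1).2.
Qed.

End gaussian_law.

(** * Characteristic functions under square-integrable limits *)

Section cf_limit.
Context {R : realType}.

Lemma lipschitz_trig (f df : R -> R) : (forall x : R, is_derive x (1 : R) f (df x)) -> (forall x, `|df x| <= 1) ->
  forall x y, `|f x - f y| <= `|x - y|.
Proof.
move=> dfx df1; have cf x y : {within `[x, y], continuous f}.
  apply: continuous_subspaceT => z; apply: differentiable_continuous.
  by apply/derivable1_diffP; exact: ex_derive.
have aux x y : y <= x -> `|f x - f y| <= `|x - y|.
  move=> yx; have [c _ ->] := MVT_segment yx (fun z _ => dfx z) (cf y x).
  by rewrite normrM ler_piMl.
move=> x y; have [yx|/ltW xy] := leP y x; first exact: aux.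
by rewrite distrC (distrC x); exact: aux.
Qed.

Lemma cos_lipschitz (x y : R) : `|cos x - cos y| <= `|x - y|.
Proof. by apply: lipschitz_trig => z; rewrite normrN; exact: normr_sin_le1. Qed.

Lemma sin_lipschitz (x y : R) : `|sin x - sin y| <= `|x - y|.
Proof. by apply: lipschitz_trig => z; exact: normr_cos_le1. Qed.

Context d (T : measurableType d) (P : probability T R) (X : T -> R) (Z : nat -> T -> R).
Hypothesis mX : measurable_fun setT X.
Hypothesis mZ : forall j, measurable_fun setT (Z j).
Hypothesis ZX : tends0 (fun j => \int[P]_w ((Z j w - X w) ^+ 2)%:E)%E.

Let comp_int (c : R -> R) (b : R) (W : T -> R) : measurable_fun setT c -> (forall x, `|c x| <= 1) ->
  measurable_fun setT W -> P.-integrable setT (EFin \o (fun w => c (b * W w))).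
Proof.
move=> mc c1 mW.
rewrite (_ : EFin \o _ = EFin \o (fun w => 1 * c (b * W w))); last first.
  by apply/funext => w; rewrite /= mul1r.
apply: (@integrable_mul_bounded_by _ _ _ _ (fun=> 1) (fun w => c (b * W w)) 1) => //.
  exact: finite_measure_integrable_cst.
by apply: (measurableT_comp mc); exact: measurable_funM.
Qed.

Lemma cvg_cf (c : R -> R) (b : R) : measurable_fun setT c -> (forall x, `|c x| <= 1) ->
  (forall x y, `|c x - c y| <= `|x - y|) ->
  \int[P]_w c (b * Z j w) @[j --> \oo] --> \int[P]_w c (b * X w).
Proof.
move=> mc c1 cl; apply/cvgrPdist_le => e e0.
(* With [|a| <= dl^-1 a^2 + dl] and a squared distance of at most [dl ^+ 2], the error is at most
   [2 |b| dl <= e]; the [+ 1] covers [b = 0]. *)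
pose dl := e / (2 * (`|b| + 1)).
have b1 : 0 < `|b| + 1 by rewrite ltr_wpDl.
have dl0 : 0 < dl by rewrite divr_gt0// mulr_gt0.
have [N HN] := ZX (exprn_gt0 2 dl0).
exists N => // j Nj; have {}HN := HN j Nj.
have IX := comp_int b mc c1 mX; have IZ := comp_int b mc c1 (mZ j).
rewrite -RintegralB//.
apply: le_trans (le_normr_Rintegral measurableT _) _; first exact: integrableB_EFin.
have mZX : measurable_fun setT (fun w => (Z j w - X w) ^+ 2).
  by apply: measurable_funX; exact: measurable_funB.
have sqi : P.-integrable setT (EFin \o (fun w => (Z j w - X w) ^+ 2)).
  apply/integrableP; split; first exact/measurable_EFinP.
  under eq_integral do rewrite /= ger0_norm ?sqr_ge0//.
  exact: le_lt_trans HN (ltry _).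
have P1 : P.-integrable setT (EFin \o (fun=> dl : R)) by exact: finite_measure_integrable_cst.
have bnd : P.-integrable setT (EFin \o (fun w => `|b| * (dl^-1 * (Z j w - X w) ^+ 2 + dl))).
  by apply: integrableZl_EFin => //; apply: integrableD_EFin => //; exact: integrableZl_EFin.
apply: (@le_trans _ _ (\int[P]_w (`|b| * (dl^-1 * (Z j w - X w) ^+ 2 + dl)))).
  apply: le_Rintegral => //.
    by apply: integrable_norm => //; exact: integrableB_EFin.
  move=> w _; apply: le_trans (cl _ _) _; rewrite -mulrBr normrM ler_wpM2l//.
  rewrite distrC -(real_normK (num_real (Z j w - X w))); set a := `|_|.
  rewrite -subr_ge0 -(pmulr_rge0 _ dl0).
  rewrite (_ : dl * (dl^-1 * a ^+ 2 + dl - a) = (a - dl / 2) ^+ 2 + (1 - 4^-1) * dl ^+ 2); last first.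
    by field; exact: lt0r_neq0.
  by rewrite addr_ge0 ?sqr_ge0// mulr_ge0 ?sqr_ge0//; lra.
have sqi' : P.-integrable setT (EFin \o (fun w => dl^-1 * (Z j w - X w) ^+ 2)) by exact: integrableZl_EFin.
rewrite RintegralZl//; last exact: integrableD_EFin.
rewrite RintegralD// RintegralZl//.
have -> : \int[P]_w dl = dl.
  by rewrite /Rintegral (integral_cst P measurableT) [X in (_ * X)%E](@probability_setT _ _ _ P) mule1.
have E2 : \int[P]_w ((Z j w - X w) ^+ 2) <= dl ^+ 2.
  by rewrite -lee_fin -Rintegral_EFin.
apply: (@le_trans _ _ (`|b| * (dl + dl))).
  rewrite ler_wpM2l// lerD2r; apply: (@le_trans _ _ (dl^-1 * dl ^+ 2)).
    by rewrite ler_wpM2l// invr_ge0 ltW.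
  by rewrite expr2 mulKf// gt_eqF.
rewrite (_ : `|b| * (dl + dl) = e * (`|b| / (`|b| + 1))); last by rewrite /dl; field; exact: lt0r_neq0.
by rewrite ler_piMr ?(ltW e0)// ler_pdivrMr// mul1r lerDl.
Qed.

End cf_limit.

(** * Restriction of the field *)

Section L2_bounds.
Context {R : realType}.

Lemma ge0_integral_lin_le d (T : measurableType d) (m : {measure set T -> \bar R}) (f g h : T -> R) (a b : R) :
  measurable_fun setT f -> measurable_fun setT g -> measurable_fun setT h ->
  (forall x, 0 <= f x) -> (forall x, 0 <= g x) -> (forall x, 0 <= h x) -> 0 <= a -> 0 <= b ->
  (forall x, f x <= a * g x + b * h x) ->
  (\int[m]_x (f x)%:E <= a%:E * \int[m]_x (g x)%:E + b%:E * \int[m]_x (h x)%:E)%E.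
Proof.
move=> mf mg mh f0 g0 h0 a0 b0 fgh.
rewrite -!ge0_integralZl_real// -ge0_integralD//; first last.
- by apply/measurable_EFinP; exact: measurable_funM.
- by move=> x _; rewrite lee_fin mulr_ge0.
- by apply/measurable_EFinP; exact: measurable_funM.
- by move=> x _; rewrite lee_fin mulr_ge0.
apply: ge0_le_integral => //.
- by move=> x _; rewrite lee_fin.
- exact/measurable_EFinP.
- by apply: emeasurable_funD; apply/measurable_EFinP; exact: measurable_funM.
- by move=> x _; rewrite -EFinD lee_fin.
Qed.

Lemma tends0_le (u v : nat -> \bar R) (a : R) : 0 <= a -> tends0 v -> (forall j, u j <= a%:E * v j)%E -> tends0 u.
Proof.
move=> a0 tv uv e e0.
have a1 : 0 < a + 1 by rewrite ltr_wpDl.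
have [N HN] := tv _ (divr_gt0 e0 a1); exists N => j Nj; apply: le_trans (uv j) _.
apply: (@le_trans _ _ (a%:E * (e / (a + 1))%:E)%E); first by rewrite lee_wpmul2l ?lee_fin// HN.
by rewrite -EFinM lee_fin mulrCA ler_piMr ?(ltW e0)// ler_pdivrMr// mul1r lerDl.
Qed.

Lemma tends0D (u v : nat -> \bar R) : tends0 u -> tends0 v -> tends0 (fun j => u j + v j)%E.
Proof.
move=> tu tv e e0; have e2 : 0 < e / 2 by rewrite divr_gt0.
have [N HN] := tu _ e2; have [M HM] := tv _ e2; exists (maxn N M) => j; rewrite geq_max => /andP[Nj Mj].
by rewrite [e]splitr EFinD leeD ?HN ?HM.
Qed.

Lemma sqrB_le (x y z : R) : (x - y) ^+ 2 <= 2 * (x - z) ^+ 2 + 2 * (y - z) ^+ 2.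
Proof. by have := sqr_ge0 (x + y - 2 * z); nra. Qed.

Lemma sqnormCB_le (x y z : R[i]) : sqnormC (x - y) <= 2 * sqnormC (x - z) + 2 * sqnormC (y - z).
Proof.
case: x y z => [a b] [a' b'] [a'' b'']; rewrite /sqnormC /=.
by have := sqrB_le a a' a''; have := sqrB_le b b' b''; lra.
Qed.

Lemma wL2norm2B_le n (r : R) (x y z : 'rV[R]_n -> R[i]) :
  measurable_complex x -> measurable_complex y -> measurable_complex z ->
  (wL2norm2 r (fun xi => x xi - y xi)%R <=
   2%:E * wL2norm2 r (fun xi => x xi - z xi)%R + 2%:E * wL2norm2 r (fun xi => y xi - z xi)%R)%E.
Proof.
move=> mx my mz; apply: ge0_integral_lin_le => //; do ?[
  by apply: measurable_funM; [exact: measurable_enorm_pow|apply: measurable_sqnormC; exact: measurable_complexB]];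
  do ?[by move=> xi; rewrite mulr_ge0 ?powR_ge0 ?sqnormC_ge0].
have aux (w a b c : R) : 0 <= w -> a <= 2 * b + 2 * c -> w * a <= 2 * (w * b) + 2 * (w * c) by nra.
by move=> xi; apply: aux; [exact: powR_ge0|exact: sqnormCB_le].
Qed.

Lemma L2B_le d (T : measurableType d) (P : {measure set T -> \bar R}) (x y z : T -> R) :
  measurable_fun setT x -> measurable_fun setT y -> measurable_fun setT z ->
  (\int[P]_w ((x w - y w) ^+ 2)%:E <=
   2%:E * \int[P]_w ((x w - z w) ^+ 2)%:E + 2%:E * \int[P]_w ((y w - z w) ^+ 2)%:E)%E.
Proof.
move=> mx my mz; apply: ge0_integral_lin_le => //; do ?[by move=> w; exact: sqr_ge0];
  do ?[by apply: measurable_funX; exact: measurable_funB].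
by move=> w; exact: sqrB_le.
Qed.

Lemma tends0_L2_lin d (T : measurableType d) (P : {measure set T -> \bar R}) (a : R)
    (Z Z' : nat -> T -> R) (X X' : T -> R) :
  (forall j, measurable_fun setT (Z j)) -> (forall j, measurable_fun setT (Z' j)) ->
  measurable_fun setT X -> measurable_fun setT X' ->
  tends0 (fun j => \int[P]_w ((Z j w - X w) ^+ 2)%:E)%E ->
  tends0 (fun j => \int[P]_w ((Z' j w - X' w) ^+ 2)%:E)%E ->
  tends0 (fun j => \int[P]_w (((a * Z j w + Z' j w) - (a * X w + X' w)) ^+ 2)%:E)%E.
Proof.
move=> mZ mZ' mX mX' tZ tZ'.
have a2 : 0 <= 2 * a ^+ 2 by rewrite mulr_ge0// sqr_ge0.
have t1 := tends0_le a2 tZ (fun j => lexx _); have t2 := tends0_le (ler0n R 2) tZ' (fun j => lexx _).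
apply: (tends0_le ler01 (tends0D t1 t2)) => j; rewrite mul1e.
apply: ge0_integral_lin_le => //; do ?[by move=> w; exact: sqr_ge0].
- by apply: measurable_funX; apply: measurable_funB; apply: measurable_funD => //; exact: measurable_funM.
- by apply: measurable_funX; exact: measurable_funB.
- by apply: measurable_funX; exact: measurable_funB.
- move=> w; have := sqr_ge0 (a * (Z j w - X w) - (Z' j w - X' w)); nra.
Qed.

Lemma schwartz_dual_sum n (r : R) (u : ('rV[R]_n -> R) -> R) m (a : 'I_m -> R) (F : 'I_m -> 'rV[R]_n -> R) :
  schwartz_dual r u -> (forall i, schwartz_mom r (F i)) ->
  u (fun x => \sum_(i < m) a i * F i x) = \sum_(i < m) a i * u (F i).
Proof.
move=> [ulin _] mF.
have s0 := @schwartz_mom0 R n r.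
have u0 : u (fun=> 0) = 0.
  have := ulin 1 _ _ s0 s0; have -> : (fun _ : 'rV[R]_n => 1 * 0 + 0) = fun=> 0 :> R.
    by apply/funext => x; rewrite mulr0 addr0.
  by rewrite mul1r => h; apply/(addrI (u (fun=> 0))); rewrite -h addr0.
(* The functional is linear only on [S_r], so membership of the partial sums is proved in the same
   induction. *)
suff [] : schwartz_mom r (fun x => \sum_(i < m) a i * F i x) /\
   u (fun x => \sum_(i < m) a i * F i x) = \sum_(i < m) a i * u (F i) by [].
elim: (index_enum _) => [|i l [IHs IHu]].
  rewrite big_nil (_ : (fun x => _) = fun=> 0)//.
  by apply/funext => x; rewrite big_nil.
rewrite big_cons (_ : (fun x => _) = fun x => a i * F i x + \sum_(j <- l) a j * F j x).
  by split; [exact: schwartz_mom_lin|rewrite ulin// IHu].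
by apply/funext => x; rewrite big_cons.
Qed.

End L2_bounds.

Section fgf_increments.
Context {R : realType} (n : nat) (H s : R) d (T : measurableType d) (P : probability T R)
  (h : T -> ('rV[R]_n -> R) -> R).
Hypothesis h_dual : forall w, schwartz_dual H (h w).
Hypothesis h_gauss : forall phi, schwartz_mom H phi ->
  centered_gaussian P (fun w => h w phi) (hdot_norm2 (- s) phi).

(** Each sample is linear, so the increment is the field at one test function, and the second moment
    of a centered Gaussian is its variance. *)
Lemma fgf_increment phi psi : schwartz_mom H phi -> schwartz_mom H psi ->
  (\int[P]_w ((h w phi - h w psi) ^+ 2)%:E = wL2norm2 (- s) (fun xi => fourier phi xi - fourier psi xi)%R)%E.
Proof.
move=> mphi mpsi.
have mm := schwartz_mom_lin (-1) mpsi mphi.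
have phii := schwartz_integrable mphi.1; have psii := schwartz_integrable mpsi.1.
transitivity (\int[P]_w (h w (fun x => -1 * psi x + phi x) ^+ 2)%:E)%E.
  apply: eq_integral => w _; congr ((_ ^+ 2)%:E).
  by rewrite (h_dual w).1// mulN1r addrC.
rewrite (centered_gaussian_moment2 (h_gauss mm)).
apply: eq_integral => xi _; congr ((_ * _)%:E).
rewrite sqnormC_fourier cosT_lin// sinT_lin//.
have r1 := Re_fourier phi xi; have i1 := Im_fourier phi xi.
have r2 := Re_fourier psi xi; have i2 := Im_fourier psi xi.
move: r1 i1 r2 i2; case: (fourier phi xi) => a b; case: (fourier psi xi) => a' b' /= -> -> -> ->.
by rewrite /sqnormC/=; ring.
Qed.

End fgf_increments.

Section restriction.
Context {R : realType} (k p n : nat) (A : 'M[R]_(k, n)) (K : 'M[R]_(p, n)) (H : R).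
Hypothesis kpn : (k + p = n)%N.
Hypothesis k0 : (0 < k)%N.
Hypothesis AA : A *m A^T = 1%:M.
Hypothesis KK : K *m K^T = 1%:M.
Hypothesis AK : A *m K^T = 0.
Hypothesis AKn : A^T *m A + K^T *m K = 1%:M.
Hypothesis H0 : 0 <= H.
Context d (T : measurableType d) (P : probability T R) (h : T -> ('rV[R]_n -> R) -> R).
Hypothesis h_fgf : is_fgf (H + n%:R / 2) P h.
Context (J : 'Hom('rV[R]_k, 'rV[R]_n)).
Hypothesis JA : forall x, J x = x *m A.
Implicit Types phi : 'rV[R]_k -> R.

Local Notation s := (H + n%:R / 2).
Local Notation moll j := (mollify A K j.+1%:R^-1).
Local Notation lf := (lift_fourier p A).

Let h_dual w : schwartz_dual H (h w).
Proof. by have := h_fgf.1 w; rewrite addrK. Qed.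

Let h_gauss psi : schwartz_mom H psi -> centered_gaussian P (fun w => h w psi) (hdot_norm2 (- s) psi).
Proof. by have := h_fgf.2 psi; rewrite addrK. Qed.

Let ps : p%:R < 2 * s.
Proof.
have : 0 < k%:R :> R by rewrite ltr0n.
rewrite -kpn natrD; move: (k%:R : R) (p%:R : R) => x y; move: H0; lra.
Qed.

Let sk : s - p%:R / 2 = H + k%:R / 2.
Proof. by rewrite -kpn natrD; field. Qed.

Let n0 : (0 < n)%N. Proof. by rewrite -kpn addn_gt0 k0. Qed.

Let s0 : 0 <= s. Proof. by rewrite addr_ge0// divr_ge0. Qed.

Let e0 j : 0 < (j.+1%:R^-1 : R). Proof. by rewrite invr_gt0. Qed.

Let moll_mom j phi : schwartz_mom H phi -> schwartz_mom H (moll j phi).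
Proof. exact: (schwartz_mom_mollify kpn AA KK AK AKn (e0 j)). Qed.

Definition restr_const : R := Num.sqrt (moll_const p ^+ 2 * fibre_const p s).

Lemma restr_const_gt0 : 0 < restr_const.
Proof. by rewrite sqrtr_gt0 mulr_gt0 ?exprn_gt0 ?moll_const_gt0 ?fibre_const_gt0. Qed.

Lemma wL2norm2_lift phi : schwartz_mom H phi ->
  wL2norm2 (- s) (lf phi) = ((restr_const ^+ 2)%:E * hdot_norm2 (- (H + k%:R / 2)) phi)%E.
Proof.
move=> mphi; rewrite (wL2norm2_lift_fourier kpn k0 AA KK AK AKn ps (schwartz_measurable mphi.1)) sk.
by rewrite sqr_sqrtr// mulr_ge0 ?sqr_ge0// ltW// fibre_const_gt0.
Qed.

(** Here the field supplies finiteness: its variance at the mollification of index 0, which has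
    width 1, is a real number, and [hdot_norm2_fin] carries this over to [phi]. *)
Lemma wL2norm2_lift_fin phi : schwartz_mom H phi -> (wL2norm2 (- s) (lf phi) < +oo)%E.
Proof.
move=> mphi; rewrite wL2norm2_lift// lte_mul_pinfty ?lee_fin ?sqr_ge0//.
rewrite -sk; apply: (hdot_norm2_fin kpn k0 AA KK AK AKn ps mphi.1).
have := centered_gaussian_fin (h_gauss (moll_mom 0 mphi)).
by rewrite invr1.
Qed.

Let cvg_moll phi : schwartz_mom H phi ->
  tends0 (fun j => wL2norm2 (- s) (fun xi => fourier (moll j phi) xi - lf phi xi)%R) /\
  hdot_norm2 (- s) (moll j phi) @[j --> \oo] --> wL2norm2 (- s) (lf phi).
Proof.
move=> mphi; have [c1 c2] := cvg_mollify kpn AA KK AK AKn mphi.1 (wL2norm2_lift_fin mphi).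
split => //; apply/tends0P => // j; apply: integral_ge0 => xi _.
by rewrite lee_fin mulr_ge0 ?powR_ge0 ?sqnormC_ge0.
Qed.

Lemma hdot_lift phi : schwartz_mom H phi -> hdot (- s) (lift_test J phi) (lf phi).
Proof. by move=> mphi; apply: hdot_lift_test => //; [exact: mphi.1|exact: wL2norm2_lift_fin]. Qed.

Lemma fgf_test_lift phi : schwartz_mom H phi -> fgf_test s (lift_test J phi).
Proof.
move=> mphi; exists (lf phi); first exact: hdot_lift.
move=> e e_gt0; have e2 : 0 < e / 2 by rewrite divr_gt0.
have [N HN] := (cvg_moll mphi).1 _ e2; exists (moll N phi); first by rewrite addrK; exact: moll_mom.
by apply: le_lt_trans (HN N (leqnn _)) _; rewrite lte_fin ltr_pdivrMr// ltr_pMr// ltr1n.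
Qed.

Let mfou (psi : 'rV[R]_n -> R) : schwartz psi -> measurable_complex (fourier psi).
Proof.
by move=> /schwartz_measurable mpsi; split; [exact: measurable_fourier_Re|exact: measurable_fourier_Im].
Qed.

Let mlf phi : schwartz_mom H phi -> measurable_complex (lf phi).
Proof. by move=> mphi; apply: measurable_lift_fourier => //; exact: schwartz_measurable mphi.1. Qed.

Let mh psi : schwartz_mom H psi -> measurable_fun setT (fun w => h w psi).
Proof. by move=> /h_gauss[]. Qed.

Let L2_cauchy phi : schwartz_mom H phi -> forall e : R, 0 < e ->
  exists N, forall i j, (N <= i)%N -> (N <= j)%N ->
    (\int[P]_w ((h w (moll i phi) - h w (moll j phi)) ^+ 2)%:E <= e%:E)%E.
Proof.
move=> mphi e e_gt0; have e4 : 0 < e / 4 by rewrite divr_gt0.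
have [N HN] := (cvg_moll mphi).1 _ e4; exists N => i j Ni Nj.
have mi := moll_mom i mphi; have mj := moll_mom j mphi.
rewrite (fgf_increment h_dual h_gauss mi mj).
apply: le_trans (wL2norm2B_le (- s) (mfou mi.1) (mfou mj.1) (mlf mphi)) _.
have -> : e%:E = (2%:E * (e / 4)%:E + 2%:E * (e / 4)%:E)%E :> \bar R.
  by rewrite -!EFinM -EFinD; congr EFin; field.
by apply: leeD; rewrite lee_wpmul2l ?lee_fin//; exact: HN.
Qed.

(** [X] is the limit along the mollifications. Any other approximating sequence is close to them in
    the Sobolev norm, hence leads to the same [X] by [fgf_increment]. *)
Lemma fgf_ext_exists phi : schwartz_mom H phi -> exists X, is_fgf_ext s P h (lift_test J phi) X.
Proof.
move=> mphi.
have mY j : measurable_fun setT (fun w => h w (moll j phi)) by exact/mh/moll_mom.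
pose X := L2_limit (L2_cauchy mphi).
have mX : measurable_fun setT X by exact: measurable_L2_limit.
have YX : tends0 (fun j => \int[P]_w ((h w (moll j phi) - X w) ^+ 2)%:E)%E.
  by move=> e; exact: L2_complete.
exists X; split => // psi g; rewrite addrK => mpsi hg psig.
have [_ mr mi _ _] := hg.
(* The definition lets [g] be any representative of the transform; by [hdot_unique] it may be
   exchanged for [lf phi]. *)
have gE j : wL2norm2 (- s) (fun xi => fourier (psi j) xi - lf phi xi) =
            wL2norm2 (- s) (fun xi => fourier (psi j) xi - g xi).
  have W (g' : 'rV[R]_n -> R[i]) : measurable_complex g' ->
      measurable_fun setT (fun xi => (enorm xi `^ (2 * - s) * sqnormC (fourier (psi j) xi - g' xi))%:E).
    move=> mg'; apply/measurable_EFinP; apply: measurable_funM; first exact: measurable_enorm_pow.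
    by apply: measurable_sqnormC; apply: measurable_complexB => //; exact: mfou (mpsi j).1.
  apply: ae_eq_integral => //; [exact: W (mlf mphi)|exact: W (conj mr mi)|].
  have := hdot_unique n0 s0 (hdot_lift mphi) hg.
  by apply: filterS => xi e _; rewrite (e I).
have psi0 j : (0 <= wL2norm2 (- s) (fun xi => fourier (psi j) xi - g xi)%R)%E.
  by apply: integral_ge0 => xi _; rewrite lee_fin mulr_ge0 ?powR_ge0 ?sqnormC_ge0.
move/(tends0P psi0) in psig.
apply/tends0P; first by move=> j; apply: integral_ge0 => w _; rewrite lee_fin sqr_ge0.
(* Squares obey the triangle inequality only with a factor 2, which is paid twice: the final bound
   is [2 (e / 4) + 2 (e / 16) <= e]. *)
move=> e e_gt0; have e16 : 0 < e / 16 by rewrite divr_gt0.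
have [N HN] := psig _ e16.
have [M1 HM1] := (cvg_moll mphi).1 _ e16; have [M2 HM2] := YX _ e16.
pose i := maxn M1 M2; exists N => j Nj.
have mi' := moll_mom i mphi.
apply: le_trans (L2B_le P (mh (mpsi j)) mX (mh mi')) _.
apply: (@le_trans _ _ (2%:E * (e / 4)%:E + 2%:E * (e / 16)%:E)%E); last first.
  by rewrite -!EFinM -EFinD lee_fin; lra.
apply: leeD; rewrite lee_wpmul2l ?lee_fin//; last first.
  under eq_integral do rewrite -sqrrN opprB.
  exact: HM2 (leq_maxr _ _).
rewrite (fgf_increment h_dual h_gauss (mpsi j) mi').
apply: le_trans (wL2norm2B_le (- s) (mfou (mpsi j).1) (mfou mi'.1) (mlf mphi)) _.
have -> : (e / 4)%:E = (2%:E * (e / 16)%:E + 2%:E * (e / 16)%:E)%E :> \bar R.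
  by rewrite -!EFinM -EFinD; congr EFin; field.
apply: leeD; rewrite lee_wpmul2l ?lee_fin//; first by rewrite gE; exact: HN.
exact: HM1 (leq_maxl _ _).
Qed.

Lemma fgf_restr_L2 phi : schwartz_mom H phi ->
  measurable_fun setT (fun w => fgf_restr s P h J w phi) /\
  tends0 (fun j => \int[P]_w ((h w (moll j phi) - fgf_restr s P h J w phi) ^+ 2)%:E)%E.
Proof.
move=> mphi; have [mX ext] := getPex (fgf_ext_exists mphi).
split => //; apply/tends0P; first by move=> j; apply: integral_ge0 => w _; rewrite lee_fin sqr_ge0.
apply: (ext _ (lf phi)).
- by move=> j; rewrite addrK; exact: moll_mom.
- exact: hdot_lift.
- apply/tends0P; last exact: (cvg_moll mphi).1.
  by move=> j; apply: integral_ge0 => xi _; rewrite lee_fin mulr_ge0 ?powR_ge0 ?sqnormC_ge0.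
Qed.

Lemma fgf_restr_sum m (a : 'I_m -> R) (phi : 'I_m -> 'rV[R]_k -> R) : (forall i, schwartz_mom H (phi i)) ->
  measurable_fun setT (fun w => \sum_(i < m) a i * fgf_restr s P h J w (phi i)) /\
  tends0 (fun j => \int[P]_w ((h w (moll j (fun x => \sum_(i < m) a i * phi i x)) -
    \sum_(i < m) a i * fgf_restr s P h J w (phi i)) ^+ 2)%:E)%E.
Proof.
move=> mphi.
have E j w : h w (moll j (fun x => \sum_(i < m) a i * phi i x)) = \sum_(i < m) a i * h w (moll j (phi i)).
  rewrite -(schwartz_dual_sum a (h_dual w) (fun i => moll_mom j (mphi i))); congr (h w _).
  by apply/funext => x; rewrite /mollify mulr_suml; apply: eq_bigr => i _; rewrite mulrA.
have Eint j : (\int[P]_w ((h w (moll j (fun x => \sum_(i < m) a i * phi i x)) -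
    \sum_(i < m) a i * fgf_restr s P h J w (phi i)) ^+ 2)%:E =
   \int[P]_w ((\sum_(i < m) a i * h w (moll j (phi i)) - \sum_(i < m) a i * fgf_restr s P h J w (phi i)) ^+ 2)%:E)%E.
  by apply: eq_integral => w _; rewrite E.
suff [mS [_ tS]] : measurable_fun setT (fun w => \sum_(i < m) a i * fgf_restr s P h J w (phi i)) /\
  (forall j, measurable_fun setT (fun w => \sum_(i < m) a i * h w (moll j (phi i)))) /\
  tends0 (fun j => \int[P]_w ((\sum_(i < m) a i * h w (moll j (phi i)) -
    \sum_(i < m) a i * fgf_restr s P h J w (phi i)) ^+ 2)%:E)%E.
  by split => // e e_gt0; have [N HN] := tS e e_gt0; exists N => j Nj; rewrite Eint; exact: HN.
elim: (index_enum _) => [|i l [IHm [IHmj IHt]]].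
  rewrite (_ : (fun w => _) = fun=> 0); last by apply/funext => w; rewrite big_nil.
  split => //; split.
    by move=> j; rewrite (_ : (fun w => _) = fun=> 0)//; apply/funext => w; rewrite big_nil.
  move=> e e_gt0; exists 0%N => j _; under eq_integral do rewrite !big_nil subrr expr0n.
  by rewrite integral0 lee_fin ltW.
have [mX tX] := fgf_restr_L2 (mphi i).
have mhi j : measurable_fun setT (fun w => h w (moll j (phi i))) by exact/mh/moll_mom.
rewrite (_ : (fun w => _) = fun w => a i * fgf_restr s P h J w (phi i) +
    \sum_(i <- l) a i * fgf_restr s P h J w (phi i)); last by apply/funext => w; rewrite big_cons.
split; first by apply: measurable_funD => //; exact: measurable_funM.
split.
  move=> j; rewrite (_ : (fun w => _) = fun w => a i * h w (moll j (phi i)) +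
    \sum_(i <- l) a i * h w (moll j (phi i))); last by apply/funext => w; rewrite big_cons.
  by apply: measurable_funD => //; exact: measurable_funM.
move=> e e_gt0; have [N HN] := tends0_L2_lin (a i) mhi IHmj mX IHm tX IHt e_gt0.
by exists N => j Nj; under eq_integral do rewrite !big_cons; exact: HN.
Qed.

(** The characteristic functions at the mollifications have two limits to be equated: one from
    square-integrable convergence, the other from convergence of the variances. *)
Lemma has_fgf_law_restr : has_fgf_law (H + k%:R / 2) restr_const P (fgf_restr s P h J).
Proof.
move=> m a phi; rewrite addrK => mphi.
pose psi x := \sum_(i < m) a i * phi i x.
have mpsi : schwartz_mom H psi by exact: schwartz_mom_sum.
have [mS tS] := fgf_restr_sum a mphi.
rewrite -/psi -(wL2norm2_lift mpsi) in tS *.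
have V0 : (0 <= wL2norm2 (- s) (lf psi))%E.
  by apply: integral_ge0 => xi _; rewrite lee_fin mulr_ge0 ?powR_ge0 ?sqnormC_ge0.
pose v := fine (wL2norm2 (- s) (lf psi)).
have vE : wL2norm2 (- s) (lf psi) = (Num.sqrt v ^+ 2)%:E.
  by rewrite sqr_sqrtr ?fine_ge0// fineK// ge0_fin_numE// wL2norm2_lift_fin.
have cv : fine (hdot_norm2 (- s) (moll j psi)) @[j --> \oo] --> v.
  apply: fine_cvg; rewrite -/v fineK ?ge0_fin_numE ?wL2norm2_lift_fin//.
  exact: (cvg_moll mpsi).2.
have mZ j : measurable_fun setT (fun w => h w (moll j psi)) by exact/mh/moll_mom.
rewrite vE; apply: gaussian_of_cf => // b.
  have c1 := cvg_cf mS mZ tS (b := b) measurable_cos (@normr_cos_le1 R) (@cos_lipschitz R).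
  suff c2 : \int[P]_w cos (b * h w (moll j psi)) @[j --> \oo] --> expR (- (Num.sqrt v ^+ 2 * b ^+ 2 / 2)).
    exact: (cvg_unique _ c1 c2).
  under eq_fun => j do rewrite (centered_gaussian_cf b (h_gauss (moll_mom j mpsi))).1.
  rewrite sqr_sqrtr ?fine_ge0//.
  have lim : - (fine (hdot_norm2 (- s) (moll j psi)) * b ^+ 2 / 2) @[j --> \oo] --> - (v * b ^+ 2 / 2).
    by apply: cvgN; apply: cvgMl; exact: cvgMl.
  exact: (cvg_comp _ _ lim (@continuous_expR R _)).
have c1 := cvg_cf mS mZ tS (b := b) measurable_sin (@normr_sin_le1 R) (@sin_lipschitz R).
suff c2 : \int[P]_w sin (b * h w (moll j psi)) @[j --> \oo] --> (0 : R) by exact: (cvg_unique _ c1 c2).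
under eq_fun => j do rewrite (centered_gaussian_cf b (h_gauss (moll_mom j mpsi))).2.
exact: cvg_cst.
Qed.

(** The Cramer-Wold device: the characteristic function of a vector of values at [b] is that of one
    linear combination, taken at 1 for the restriction and at [restr_const] for [hbar]. Both are
    explicit in the same variance. *)
Lemma same_law_restr d' (T' : measurableType d') (P' : probability T' R) (hbar : T' -> ('rV[R]_k -> R) -> R) :
  is_fgf (H + k%:R / 2) P' hbar ->
  same_law (schwartz_mom H) P (fgf_restr s P h J) P' (fun w phi => restr_const * hbar w phi).
Proof.
move=> hb m t mt B mB.
have mt' i : schwartz_mom (H + k%:R / 2 - k%:R / 2) (t i) by rewrite addrK.
have hb_dual w : schwartz_dual H (hbar w) by have := hb.1 w; rewrite addrK.
have hb_gauss phi : schwartz_mom H phi -> centered_gaussian P' (fun w => hbar w phi) (hdot_norm2 (- (H + k%:R / 2)) phi).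
  by have := hb.2 phi; rewrite addrK.
have mX : measurable_fun setT (fun w => \row_i fgf_restr s P h J w (t i)).
  apply: measurable_fun_rV => i; rewrite (_ : _ \o _ = fun w => fgf_restr s P h J w (t i)).
    exact: (fgf_restr_L2 (mt i)).1.
  by apply/funext => w; rewrite /= /rV_coord mxE.
have mX' : measurable_fun setT (fun w => \row_i (restr_const * hbar w (t i))).
  apply: measurable_fun_rV => i; rewrite (_ : _ \o _ = fun w => restr_const * hbar w (t i)).
    by apply: measurable_funM => //; have [] := hb_gauss _ (mt i).
  by apply/funext => w; rewrite /= /rV_coord mxE.
have I1 : P.-integrable setT (EFin \o (fun=> 1 : R)) by exact: finite_measure_integrable_cst.
have I1' : P'.-integrable setT (EFin \o (fun=> 1 : R)) by exact: finite_measure_integrable_cst.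
have U := cf_unique mX mX' I1 I1'.
have mass d1 (T1 : measurableType d1) (Q : probability T1 R) (Z : T1 -> 'rV[R]_m) : measurable_fun setT Z ->
    (\int[Q]_(w in Z @^-1` B) (1 : R)%:E = Q (Z @^-1` B))%E.
  move=> mZ; rewrite (integral_cst Q) ?mul1e//.
  by rewrite -[_ @^-1` _]setTI; exact: mZ.
have D b w : dotrV b (\row_i fgf_restr s P h J w (t i)) = 1 * \sum_(i < m) b 0 i * fgf_restr s P h J w (t i).
  by rewrite mul1r; apply: eq_bigr => i _; rewrite mxE.
have D' b w : dotrV b (\row_i (restr_const * hbar w (t i))) =
    restr_const * hbar w (fun x => \sum_(i < m) b 0 i * t i x).
  rewrite (schwartz_dual_sum (b 0) (hb_dual w) mt) mulr_sumr.
  by apply: eq_bigr => i _; rewrite mxE mulrCA.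
have V (b : 'rV[R]_m) : _ := centered_gaussian_cf 1 (has_fgf_law_restr (b 0) mt').
have V' (b : 'rV[R]_m) : _ := centered_gaussian_cf restr_const (hb_gauss _ (schwartz_mom_sum (b 0) mt)).
have fV (b : 'rV[R]_m) : fine ((restr_const ^+ 2)%:E * hdot_norm2 (- (H + k%:R / 2)) (fun x => \sum_(i < m) b 0 i * t i x)%R)%E * 1 ^+ 2 =
    fine (hdot_norm2 (- (H + k%:R / 2)) (fun x => \sum_(i < m) b 0 i * t i x)) * restr_const ^+ 2.
  have := hb_gauss _ (schwartz_mom_sum (b 0) mt); move=> [_ [sg [_ <- _]]].
  by rewrite expr1n mulr1 -EFinM/= mulrC.
have {}U := U _ _ B mB; rewrite !mass// in U; apply: U => b.
- under eq_Rintegral do rewrite mul1r D.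
  under [RHS]eq_Rintegral do rewrite mul1r D'.
  by rewrite (V b).1 (V' b).1 fV.
- under eq_Rintegral do rewrite mul1r D.
  under [RHS]eq_Rintegral do rewrite mul1r D'.
  by rewrite (V b).2 (V' b).2.
Qed.

End restriction.

Theorem proposition1p1 (R : realType) (H : R) (H_ge0 : 0 <= H)
    (d k : nat) (k_ge1 : (1 <= k)%N) (k_lt_d : (k < d)%N)
    (dT : measure_display) (T : measurableType dT) (P : probability T R)
    (h : T -> ('rV[R]_d -> R) -> R)
    (h_fgf : is_fgf (H + d%:R / 2) P h)
    (V : {vspace 'rV[R]_d}) (dimV : (\dim V = k)%N)
    (J : 'Hom('rV[R]_k, 'rV[R]_d)) (J_iso : isometry_onto V J) :
  (forall phi : 'rV[R]_k -> R, schwartz_mom H phi ->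
     fgf_test (H + d%:R / 2) (lift_test J phi)) /\
  exists2 C : R, 0 < C &
    has_fgf_law (H + k%:R / 2) C P (fgf_restr (H + d%:R / 2) P h J) /\
    forall (dT' : measure_display) (T' : measurableType dT')
      (P' : probability T' R) (hbar : T' -> ('rV[R]_k -> R) -> R),
      is_fgf (H + k%:R / 2) P' hbar ->
      same_law (schwartz_mom H)
        P (fgf_restr (H + d%:R / 2) P h J)
        P' (fun w phi => C * hbar w phi).
Proof.
(* The rows of [A] are an orthonormal basis of [V]; those of [K] below span its orthogonal
   complement. *)
pose A := lin1_mx J; have JA x : J x = x *m A by rewrite mul_rV_lin1.
have AA : A *m A^T = 1%:M by apply: isometry_mx => x; rewrite -JA; exact: J_iso.1.
have kpd : (k + (d - k) = d)%N by rewrite subnKC// ltnW.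
have [K [KK AK AKd]] := orthonormal_completion kpd AA.
split; first exact: (fgf_test_lift kpd k_ge1 AA KK AK AKd H_ge0 h_fgf JA).
exists (restr_const (d - k) d H); first exact: (restr_const_gt0 kpd k_ge1 H_ge0).
split; first exact: (has_fgf_law_restr kpd k_ge1 AA KK AK AKd H_ge0 h_fgf JA).
by move=> dT' T' P' hbar hb; exact: (same_law_restr kpd k_ge1 AA KK AK AKd H_ge0 h_fgf JA hb).
Qed.
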